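(* Let $n\ge 1$ and let $f,g\in C_0^\infty(\mathbb R^n)$. There exists a positive constant $\epsilon_0$ such that for every $\epsilon\in[0,\epsilon_0]$ the Cauchy problem $$\Box_g\varphi-\varphi_t=Q(\varphi,\varphi),\qquad \varphi(0,x)=\epsilon f(x),\quad \varphi_t(0,x)=\epsilon g(x),$$ has a unique global smooth solution $\varphi$ on $[0,\infty)\times\mathbb R^n$.
   Context: Points of $[0,\infty)\times\mathbb R^n$ are written $(t,x)=(t,x_1,\dots,x_n)$; $\varphi_t=\partial_t\varphi$, $\varphi_i=\partial_{x_i}\varphi$. The de Sitter metric is $-dt^2+e^{t}\sum_{i=1}^n dx_i^2$. Its covariant wave operator is $$\Box_g\varphi=-\varphi_{tt}-\tfrac n2\varphi_t+e^{-t}\sum_{i=1}^n\varphi_{ii},$$ and $$Q(\varphi,\psi)=-\varphi_t\psi_t+e^{-t}\sum_{i=1}^n\varphi_i\psi_i .$$ The functions are real-valued. *)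

(* Defs.v *)
From HB Require Import structures.
From mathcomp Require Import all_boot all_order all_algebra.
From mathcomp Require Import all_classical all_reals all_analysis.

Set Implicit Arguments.
Unset Strict Implicit.
Unset Printing Implicit Defensive.

Import Order.TTheory GRing.Theory Num.Theory.
Import numFieldNormedType.Exports.

Local Open Scope classical_set_scope.
Local Open Scope ring_scope.

Section within.
Context {R : realType} {V : normedModType R}.
Implicit Types (D : set V) (f : V -> R) (v p : V).

(* Difference quotients are only taken at points of D, so that at a boundary
   point of D the derivative is one-sided in the directions transverse to the
   boundary. This is meaningful only if p + h v lies in D for arbitrarily small
   h != 0, which is always the case below. *)
Definition derivable_within D f p v :=
  cvg (h^-1 * (f (h *: v + p) - f p)
       @[h --> within [set h | D (h *: v + p)] 0^']).

Definition derive_within D f v p : R :=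
  lim (h^-1 * (f (h *: v + p) - f p)
       @[h --> within [set h | D (h *: v + p)] 0^']).

Fixpoint iter_derive_within D (I : Type) (e : I -> V) (s : seq I) f : V -> R :=
  if s is i :: s' then derive_within D (iter_derive_within D e s' f) (e i)
  else f.

(* C^oo on D, up to the boundary: the partial derivatives of all orders along
   the frame e exist and are continuous on D. *)
Definition smooth_on D (I : Type) (e : I -> V) f :=
  forall s : seq I,
    {within D, continuous (iter_derive_within D e s f)} /\
    forall i p, D p -> derivable_within D (iter_derive_within D e s f) p (e i).

Lemma within_interior D p v : D° p ->
  within [set h : R | D (h *: v + p)] 0^' = 0^'.
Proof.
move=> Dp; apply/seteqP; split => A; rewrite /within /=; last first.
  by apply: filterS => h Ah _.
suff Dh : \forall h \near (0 : R)^', D (h *: v + p).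
  by move=> DA; near=> h; apply: (near DA h) => //; near: h.
apply: cvg_within.
have : h *: v + p @[h --> (0 : R)] --> 0 *: v + p.
  by apply: cvgD; [apply: cvgZr_tmp; exact: cvg_id | exact: cvg_cst].
by rewrite scale0r add0r; apply; exact: Dp.
Unshelve. all: by end_near. Qed.

Lemma derivable_within_interior D f p v : D° p ->
  derivable_within D f p v <-> derivable f p v.
Proof. by move=> Dp; rewrite /derivable_within within_interior. Qed.

Lemma derive_within_interior D f v p : D° p ->
  derive_within D f v p = 'D_v f p.
Proof. by move=> Dp; rewrite /derive_within within_interior. Qed.

End within.

Section space.
Context {R : realType} {n : nat}.

Definition space_frame (i : 'I_n) : 'rV[R]_n := delta_mx 0 i.

Definition test_function (f : 'rV[R]_n -> R) :=
  smooth_on setT space_frame f /\ compact (closure [set x | f x != 0]).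

End space.

Section de_sitter.
Context {R : realType} {n : nat}.
Local Notation spacetime := (R^o * 'rV[R]_n)%type.
Implicit Types (phi psi : spacetime -> R) (p : spacetime).

Definition future : set spacetime := [set p | 0 <= p.1].

Definition spacetime_frame (a : option 'I_n) : spacetime :=
  if a is Some i then (0, delta_mx 0 i) else (1, 0).

Definition dt phi : spacetime -> R :=
  derive_within future phi (spacetime_frame None).

Definition dx (i : 'I_n) phi : spacetime -> R :=
  derive_within future phi (spacetime_frame (Some i)).

(* The covariant wave operator and the null form of the de Sitter metric
   - dt^2 + e^t (dx_1^2 + ... + dx_n^2). *)
Definition box phi p : R :=
  - dt (dt phi) p - n%:R / 2 * dt phi p
  + expR (- p.1) * \sum_(i < n) dx i (dx i phi) p.

Definition Q phi psi p : R :=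
  - (dt phi p * dt psi p) + expR (- p.1) * \sum_(i < n) dx i phi p * dx i psi p.

(* phi is a total function, but only its values at times t >= 0 matter here. *)
Definition global_smooth_solution (u0 u1 : 'rV[R]_n -> R) phi :=
  [/\ smooth_on future spacetime_frame phi,
      forall p, future p -> box phi p - dt phi p = Q phi phi p,
      forall x, phi (0, x) = u0 x
    & forall x, dt phi (0, x) = u1 x].

End de_sitter.

(* Main.v *)
(* The function v = 1 - exp(-phi) linearizes the equation: it solves
   v_tt + (n/2 + 1) v_t = exp(-t) Lap v, and phi = - ln (1 - v) is a global smooth
   solution as soon as v < 1 everywhere. The data of v are O(eps), so everything
   rests on a bound, uniform in time, for the linear equation.

   On the mode exp(i xi x) the linear equation is a'' + (n/2 + 1) a' + |xi|^2 exp(-t) a = 0,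
   and since exp(t) a'^2 + |xi|^2 a^2 decreases, |a| grows at most linearly in |xi|^2.
   Interpolating the data on the lattice of spacing 1/m by trigonometric polynomials
   gives exact solutions all of whose derivatives are bounded uniformly in m, thanks
   to the decay of the discrete Fourier coefficients. Their limit along an
   ultrafilter on m is the smooth solution sought.

   Uniqueness is an energy estimate in a backward light cone, in which the spatial
   integral is a sum over the lattice of spacing 1/m: the energy at the final time is
   O(1/m), whereas a nonzero velocity there would bound it from below. *)

Require Import Defs.
From mathcomp Require Import all_boot all_order all_algebra.
From mathcomp Require Import all_classical all_reals all_analysis.
From mathcomp Require Import ring lra.
Import Order.TTheory GRing.Theory Num.Theory.
Import numFieldNormedType.Exports.
Local Open Scope classical_set_scope.
Local Open Scope ring_scope.

Set Implicit Arguments.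
Unset Strict Implicit.
Unset Printing Implicit Defensive.

(** * Derivatives within a set *)

(** By the chain rule, [box] of F(phi) is F'(phi) [box] phi + F''(phi) Q(phi,phi); the equation
    becomes linear exactly when F'' = - F', which forces F = 1 - exp(-phi) up to an affine map.
    Since exp(-phi) makes sense for every solution, uniqueness needs no smallness; smallness is only
    spent on inverting F. The bound of a mode loses a factor 1 + |xi|^2, and a sup bound needs the
    sum over all frequencies, so both are paid for with derivatives of the data; hence the fixed
    number of derivatives in the final constant. Uniform bounds are used through Taylor remainders
    quadratic in the increment: these are closed inequalities, so they survive a merely pointwise
    limit and there yield the derivatives of the limit. An ultrafilter provides these pointwise
    limits for all derivatives at all points at once. *)

Lemma eq_fun_cvg {R : realType} (F : set_system R) (A B : R -> R) (l : R) :
  A =1 B -> A @ F --> l -> B @ F --> l.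
Proof. by move/funext->. Qed.

Section within_derivative.
Context {R : realType} {V : normedModType R} (D : set V).
Implicit Types (f g : V -> R) (p v : V) (l m : R).

(** A relation rather than a value: [derive_within] is a [lim], meaningful only once convergence is
    known, and the calculus rules below do not need the limit to be unique. *)
Definition wderive f v p l :=
  (h^-1 * (f (h *: v + p) - f p)
     @[h --> within [set h : R | D (h *: v + p)] 0^']) --> l.

(** Multiplying out the quotient makes h = 0 harmless, so no later estimate has to exclude it. *)
Lemma wderiveP f v p l : wderive f v p l <->
  forall e : R, 0 < e -> exists2 d : R, 0 < d &
    forall h, `|h| < d -> D (h *: v + p) ->
      `|f (h *: v + p) - f p - h * l| <= e * `|h|.
Proof.
split=> [/cvgrPdist_le H e e0|H].
  have := H e e0; rewrite /within /= => /nbhs_ballP[d /= d0 Hd].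
  exists d => // h hd Dh.
  have [->|h0] := eqVneq h 0.
    by rewrite scale0r add0r subrr mul0r subr0 normr0 mulr0.
  have := Hd h; rewrite /ball /= sub0r normrN => /(_ hd h0 Dh) K.
  have -> : f (h *: v + p) - f p - h * l =
     - (h * (l - h^-1 * (f (h *: v + p) - f p))).
    by rewrite mulrBr mulrA divff// mul1r opprB.
  by rewrite normrN normrM mulrC ler_wpM2r.
apply/cvgrPdist_le => e e0; have [d d0 Hd] := H e e0.
rewrite /within /=; apply/nbhs_ballP; exists d => //= h.
rewrite /ball /= sub0r normrN => hd h0 Dh.
have K := Hd h hd Dh.
have -> : l - h^-1 * (f (h *: v + p) - f p) =
    - (h^-1 * (f (h *: v + p) - f p - h * l)).
  by rewrite [h^-1 * (_ - h * l)]mulrBr mulKf// opprB.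
by rewrite normrN normrM normfV mulrC ler_pdivrMr ?normr_gt0.
Qed.

Lemma wderive_cvg f v p l : wderive f v p l ->
  f (h *: v + p) @[h --> within [set h : R | D (h *: v + p)] 0^'] --> f p.
Proof.
move=> H.
have h0 : h @[h --> within [set h : R | D (h *: v + p)] 0^'] --> (0 : R).
  by do 2 apply: cvg_within_filter; exact: cvg_id.
have : f p + h * (h^-1 * (f (h *: v + p) - f p))
   @[h --> within [set h : R | D (h *: v + p)] 0^'] --> f p + 0 * l.
  by apply: cvgD; [exact: cvg_cst|exact: (cvgM h0 H)].
rewrite mul0r addr0; apply: cvg_trans; apply: near_eq_cvg.
rewrite /within /=; apply/nbhs_ballP; exists 1 => //= h _ hn0 _.
by rewrite mulVKf// addrC subrK.
Qed.

Lemma wderive_cst (c : R) v p : wderive (fun=> c) v p 0.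
Proof.
rewrite /wderive; under eq_fun do rewrite subrr mulr0; exact: cvg_cst.
Qed.

Lemma wderiveD f g v p l m : wderive f v p l -> wderive g v p m ->
  wderive (fun q => f q + g q) v p (l + m).
Proof.
move=> Hf Hg; apply: (eq_fun_cvg _ (cvgD Hf Hg)) => h; rewrite /= !fctE; ring.
Qed.

Lemma wderiveM f g v p l m : wderive f v p l -> wderive g v p m ->
  wderive (fun q => f q * g q) v p (l * g p + f p * m).
Proof.
move=> Hf Hg.
apply: (eq_fun_cvg _ (cvgD (cvgM Hf (wderive_cvg Hg)) (cvgM (cvg_cst (f p)) Hg))).
by move=> h; rewrite !fctE /=; ring.
Qed.

Lemma wderiveZ (c : R) f v p l : wderive f v p l -> wderive (fun q => c * f q) v p (c * l).
Proof.
by move=> Hf; have := wderiveM (wderive_cst c v p) Hf; rewrite mul0r add0r.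
Qed.

Lemma wderiveN f v p l : wderive f v p l -> wderive (fun q => - f q) v p (- l).
Proof.
move=> /(@wderiveZ (-1)); rewrite mulN1r.
by congr (wderive _ _ _ _); apply/funext => q; rewrite mulN1r.
Qed.

Lemma wderive_bigsum (I : Type) (r : seq I) (F : I -> V -> R) v p (l : I -> R) :
  (forall i, wderive (F i) v p (l i)) ->
  wderive (fun q => \sum_(i <- r) F i q) v p (\sum_(i <- r) l i).
Proof.
move=> H; elim: r => [|i r IH].
  rewrite big_nil; have := @wderive_cst 0 v p.
  by congr (wderive _ _ _ _); apply/funext => q; rewrite big_nil.
rewrite big_cons; have := wderiveD (H i) IH.
by congr (wderive _ _ _ _); apply/funext => q; rewrite big_cons.
Qed.

(** Caratheodory's slope function of [phi] is continuous at [f p], so one never divides by an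
    increment of [f], which may vanish. *)
Lemma wderive_comp (phi : R -> R) f v p l (m : R) : wderive f v p l ->
  is_derive (f p) (1 : R) phi m -> wderive (fun q => phi (f q)) v p (m * l).
Proof.
move=> Hf /is_derive1_caratheodory[g [gE gc gp]].
have H2 : g (f (h *: v + p))
    @[h --> within [set h : R | D (h *: v + p)] 0^'] --> g (f p).
  exact: (cvg_comp _ _ (wderive_cvg Hf) gc).
rewrite -gp; apply: (eq_fun_cvg _ (cvgM H2 Hf)) => h.
by rewrite /= gE mulrCA.
Qed.

(** The bridge to ordinary calculus: on a line that stays in D near the point, the mean value
    theorem becomes available. *)
Lemma is_derive_wderive f v p l (s : R) :
  (exists2 d : R, 0 < d & forall h : R, `|h| < d -> D (h *: v + (s *: v + p))) ->
  wderive f v (s *: v + p) l ->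
  is_derive s (1 : R) (fun s => f (s *: v + p)) l.
Proof.
move=> [d0 d00 Dd] /wderiveP H.
have L : h^-1 *: (f ((h *: (1 : R) + s) *: v + p) - f (s *: v + p)) @[h --> (0 : R)^'] --> l.
  apply/cvgrPdist_le => e e0; have [d dp Hd] := H e e0.
  apply/nbhs_ballP; exists (Num.min d d0) => /=; first by rewrite lt_min dp.
  move=> h; rewrite /ball /= sub0r normrN lt_min => /andP[hd hd0] h0.
  have := Hd h hd (Dd h hd0).
  rewrite addrA -scalerDl => K.
  have -> : l - h^-1 *: (f ((h *: (1 : R) + s) *: v + p) - f (s *: v + p)) =
    - (h^-1 * (f ((h + s) *: v + p) - f (s *: v + p) - h * l)).
    by rewrite /GRing.scale /= mulr1 [h^-1 * (_ - h * l)]mulrBr mulKf// opprB.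
  by rewrite normrN normrM normfV mulrC ler_pdivrMr ?normr_gt0.
by split; [apply/cvg_ex; exists l; exact: L|exact: cvg_lim L].
Qed.

Lemma wderive_ext f g v p l : D p -> {in D, f =1 g} -> wderive f v p l -> wderive g v p l.
Proof.
move=> Dp fg /wderiveP H; apply/wderiveP => e /H[d d0 {}H]; exists d => // h hd Dh.
by rewrite -!fg ?inE//; exact: H.
Qed.

Lemma continuous_within_ext f g : {in D, f =1 g} ->
  {within D, continuous f} -> {within D, continuous g}.
Proof. exact: subspace_eq_continuous. Qed.

End within_derivative.

(** * Smooth functions and bounds on their derivatives *)

Section regularity.
Context {R : realType} {V : normedModType R} (D : set V) (I : Type) (e : I -> V).
Implicit Types (f g : V -> R) (P : (V -> R) -> Prop).

(** One induction scheme for both continuity ([Ck]) and boundedness ([Bk]) of all derivatives up to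
    order k. The derivative is an existential witness, so closure under sums, products and
    composition only has to exhibit a formula. *)
Fixpoint regular P k f : Prop :=
  P f /\ (if k is k'.+1 then forall i, exists g : V -> R,
    (forall p, D p -> wderive D f (e i) p (g p)) /\ regular P k' g else True).

Lemma regular0 P k f : regular P k f -> P f.
Proof. by case: k => [|k] []. Qed.

Lemma regularS P k f : regular P k.+1 f -> regular P k f.
Proof.
elim: k f => [f [Pf _]//|k IH f [Pf H]]; split=> // i.
by have [g [Hg Rg]] := H i; exists g; split=> //; exact: IH.
Qed.

Lemma regularW P k j f : (k <= j)%N -> regular P j f -> regular P k f.
Proof.
move=> /subnK <-; elim: (j - k)%N => // d IH; rewrite addSn => /regularS; exact: IH.
Qed.

Lemma regular_ext P k f g : (forall f g, {in D, f =1 g} -> P f -> P g) ->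
  {in D, f =1 g} -> regular P k f -> regular P k g.
Proof.
move=> HP fg; case: k => [[Pf _]|k [Pf H]]; split=> //; try exact: (HP _ _ fg).
move=> i; have [f' [Hf Rf]] := H i; exists f'; split=> // p Dp.
exact: (wderive_ext Dp fg (Hf p Dp)).
Qed.

Lemma regular_sub P Q k f : (forall f, P f -> Q f) -> regular P k f -> regular Q k f.
Proof.
move=> PQ; elim: k f => [f [Pf _]|k IH f [Pf H]]; split=> //; try exact: PQ.
by move=> i; have [g [Hg Rg]] := H i; exists g; split=> //; exact: IH.
Qed.

Definition Ck := regular (fun f => {within D, continuous f}).

Definition Bk (B : R) := regular (fun f => forall p, D p -> `|f p| <= B).

Lemma Bk0 B k f : Bk B k f -> forall p, D p -> `|f p| <= B.
Proof. exact: regular0. Qed.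

Lemma Ck0 k f : Ck k f -> {within D, continuous f}.
Proof. exact: regular0. Qed.

Lemma Ck_ext k f g : {in D, f =1 g} -> Ck k f -> Ck k g.
Proof. by apply: regular_ext => f' g'; exact: continuous_within_ext. Qed.

Lemma Ck_cst k (c : R) : Ck k (fun=> c).
Proof.
elim: k c => [|k IH] c; split=> //; try exact: cst_continuous.
by move=> i; exists (fun=> 0); split=> [p _|]; [exact: wderive_cst|exact: IH].
Qed.

Lemma CkD k f g : Ck k f -> Ck k g -> Ck k (fun p => f p + g p).
Proof.
elim: k f g => [|k IH] f g [cf Hf] [cg Hg]; split=> //.
- by move=> p; apply: continuousD; [exact: cf|exact: cg].
- by move=> p; apply: continuousD; [exact: cf|exact: cg].
move=> i; have [f' [Df Rf]] := Hf i; have [g' [Dg Rg]] := Hg i.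
by exists (fun p => f' p + g' p); split; [move=> p Dp; apply: wderiveD; auto|exact: IH].
Qed.

Lemma CkM k f g : Ck k f -> Ck k g -> Ck k (fun p => f p * g p).
Proof.
elim: k f g => [|k IH] f g Cf Cg; have [cf Hf] := Cf; have [cg Hg] := Cg; split=> //.
- by move=> p; apply: continuousM; [exact: cf|exact: cg].
- by move=> p; apply: continuousM; [exact: cf|exact: cg].
move=> i; have [f' [Df Rf]] := Hf i; have [g' [Dg Rg]] := Hg i.
exists (fun p => f' p * g p + f p * g' p); split; first by move=> p Dp; apply: wderiveM; auto.
by apply: CkD; apply: IH => //; exact: regularS.
Qed.

Lemma CkZ k (c : R) f : Ck k f -> Ck k (fun p => c * f p).
Proof. exact: CkM (Ck_cst _ _). Qed.

Lemma CkN k f : Ck k f -> Ck k (fun p => - f p).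
Proof.
by move/(@CkZ k (-1)); apply: Ck_ext => p _; rewrite mulN1r.
Qed.

Lemma Ck_sum k (n : nat) (F : 'I_n -> V -> R) : (forall i, Ck k (F i)) ->
  Ck k (fun q => \sum_(i < n) F i q).
Proof.
elim: n F => [|n IH] F H.
  by apply: Ck_ext (Ck_cst k 0) => p _; rewrite big_ord0.
apply: Ck_ext (CkD (H ord0) (IH _ (fun i => H (lift ord0 i)))) => p _.
by rewrite big_ord_recl.
Qed.

Lemma within_continuous_comp (phi : R -> R) f : {within D, continuous f} ->
  (forall p, D p -> {for f p, continuous phi}) ->
  {within D, continuous (fun p => phi (f p))}.
Proof.
move=> /subspace_continuousP cf cphi; apply/subspace_continuousP => p Dp.
exact: (cvg_comp _ _ (cf p Dp) (cphi p Dp)).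
Qed.

(* The derivative [phi'] of [phi] is allowed to involve [phi] itself, as for
   exp and for inv; smoothness of the composite then follows by induction. *)
Lemma Ck_comp k (phi phi' : R -> R) f :
  (forall j, (j < k)%N -> Ck j (fun p => phi (f p)) -> Ck j (fun p => phi' (f p))) ->
  (forall p, D p -> is_derive (f p) (1 : R) phi (phi' (f p))) ->
  Ck k f -> Ck k (fun p => phi (f p)).
Proof.
elim: k => [|k IH] Hphi Dphi Cf; have [cf Hf] := Cf.
  split=> //; apply: within_continuous_comp => // p Dp.
  by apply/differentiable_continuous/derivable1_diffP; have [] := Dphi p Dp.
split.
  apply: within_continuous_comp => // p Dp.
  by apply/differentiable_continuous/derivable1_diffP; have [] := Dphi p Dp.
move=> i; have [f' [Df Rf]] := Hf i.
exists (fun p => phi' (f p) * f' p); split.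
  by move=> p Dp; apply: wderive_comp; auto.
apply: CkM => //; apply: (Hphi) => //; apply: IH => //; last exact: regularS.
by move=> j jk; apply: Hphi; exact: ltnW.
Qed.

Lemma Ck_exp k f : Ck k f -> Ck k (fun p => expR (f p)).
Proof. by apply: Ck_comp => // p _; exact: is_derive_expR. Qed.

Lemma Ck_inv k f : (forall p, D p -> f p != 0) -> Ck k f -> Ck k (fun p => (f p)^-1).
Proof.
move=> f0; apply: (@Ck_comp _ _ (fun x => - ((x^-1) * (x^-1)))).
  by move=> j _ H; apply: CkN; exact: CkM.
move=> p Dp; have H := @is_deriveV _ id _ _ _ (f0 p Dp) (is_derive_id (f p) (1 : R)).
by apply: (is_derive_eq H); rewrite /GRing.scale /= mulr1 -exprVn expr2.
Qed.

Lemma Ck_ln k f : (forall p, D p -> 0 < f p) -> Ck k f -> Ck k (fun p => ln (f p)).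
Proof.
move=> f0 Cf; apply: (@Ck_comp _ _ (fun x => x^-1)) => //.
  move=> j jk _; apply: Ck_inv; last by apply: regularW Cf; exact: ltnW.
  by move=> p Dp; rewrite gt_eqF// f0.
by move=> p Dp; apply: is_derive1_ln; exact: f0.
Qed.

Lemma Bk_le (B C : R) k f : B <= C -> Bk B k f -> Bk C k f.
Proof.
by move=> BC; apply: regular_sub => {}f H p Dp; exact: le_trans (H p Dp) BC.
Qed.

Lemma BkD (B C : R) k f g : Bk B k f -> Bk C k g -> Bk (B + C) k (fun p => f p + g p).
Proof.
elim: k f g => [|k IH] f g [cf Hf] [cg Hg]; split=> //.
- by move=> p Dp; apply: le_trans (ler_normD _ _) _; apply: lerD; auto.
- by move=> p Dp; apply: le_trans (ler_normD _ _) _; apply: lerD; auto.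
move=> i; have [f' [Df Rf]] := Hf i; have [g' [Dg Rg]] := Hg i.
by exists (fun p => f' p + g' p); split; [move=> p Dp; apply: wderiveD; auto|exact: IH].
Qed.

(** The Leibniz rule doubles the number of terms with each derivative. *)
Lemma BkM (B C : R) k f g : 0 <= B -> 0 <= C -> Bk B k f -> Bk C k g ->
  Bk (2 ^+ k * (B * C)) k (fun p => f p * g p).
Proof.
move=> B0 C0; elim: k f g => [|k IH] f g Cf Cg;
  have [cf Hf] := Cf; have [cg Hg] := Cg; split=> //.
- by move=> p Dp; rewrite normrM mul1r; apply: ler_pM; auto.
- move=> p Dp; rewrite normrM; apply: (@le_trans _ _ (B * C)).
    by apply: ler_pM; auto.
  by rewrite ler_peMl ?mulr_ge0// exprn_ege1// ler1n.
move=> i; have [f' [Df Rf]] := Hf i; have [g' [Dg Rg]] := Hg i.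
exists (fun p => f' p * g p + f p * g' p); split; first by move=> p Dp; apply: wderiveM; auto.
rewrite exprS -mulrA mulr2n mulrDl mul1r.
by apply: BkD; apply: IH => //; exact: regularS.
Qed.

Lemma BkZ (B c : R) k f : Bk B k f -> Bk (`|c| * B) k (fun p => c * f p).
Proof.
elim: k f => [|k IH] f [cf Hf]; split=> //.
- by move=> p Dp; rewrite normrM ler_wpM2l //; auto.
- by move=> p Dp; rewrite normrM ler_wpM2l //; auto.
move=> i; have [f' [Df Rf]] := Hf i; exists (fun p => c * f' p); split.
  by move=> p Dp; apply: wderiveZ; auto.
exact: IH.
Qed.

(** The constant is chosen before [f]: it depends on B and k alone. The derivative exp(f) f' is
    handled by the product bound, one order lower. *)
Lemma Bk_exp (B : R) k : 0 <= B ->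
  exists2 C : R, 0 <= C & forall f, Bk B k f -> Bk C k (fun p => expR (f p)).
Proof.
move=> B0; have eB f : (forall p, D p -> `|f p| <= B) ->
    forall p, D p -> `|expR (f p)| <= expR B.
  move=> fB p Dp; rewrite ger0_norm ?expR_ge0// ler_expR.
  exact: le_trans (ler_norm _) (fB p Dp).
elim: k => [|k [C C0 IH]].
  by exists (expR B) => [|f [fB _]]; [exact: expR_ge0|split=> //; exact: eB].
exists (expR B + 2 ^+ k * (C * B)).
  by rewrite addr_ge0 ?expR_ge0// !mulr_ge0// exprn_ge0.
move=> f [fB Hf]; split.
  by move=> p Dp; apply: le_trans (eB f fB p Dp) _; rewrite lerDl !mulr_ge0// exprn_ge0.
move=> i; have [f' [Df Rf]] := Hf i; exists (fun p => expR (f p) * f' p); split.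
  by move=> p Dp; apply: wderive_comp; auto.
apply: (@Bk_le (2 ^+ k * (C * B))); first by rewrite lerDr expR_ge0.
by apply: BkM => //; apply: IH; apply: regularS; split.
Qed.

(** The factor [eps] comes from two sources: at order zero from |1 - exp(x)| <= |x| exp(B), and at
    higher orders from the explicit [eps] in the derivative eps f' exp(- eps f). *)
Lemma Bk_exp_small (B : R) k : 0 <= B -> exists2 C : R, 0 <= C &
  forall f, Bk B k f -> forall eps : R, 0 <= eps <= 1 ->
    Bk (C * eps) k (fun p => 1 - expR (- (eps * f p))).
Proof.
move=> B0; have [C C0 HC] := Bk_exp k B0.
exists (B * expR B + 2 ^+ k * (B * C)).
  by rewrite addr_ge0 ?mulr_ge0 ?expR_ge0// exprn_ge0.
move=> f Hf eps /andP[e0 e1].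
have eC : Bk C k (fun p => expR (- (eps * f p))).
  apply: HC; have := BkZ (- eps) Hf; rewrite normrN ger0_norm//.
  under eq_fun do rewrite mulNr; apply: Bk_le; rewrite ler_piMl//.
have b0 p : D p -> `|1 - expR (- (eps * f p))| <= B * expR B * eps.
  move=> Dp; set x := - (eps * f p); have xB : `|x| <= B * eps.
    by rewrite normrN normrM ger0_norm// mulrC ler_wpM2r//; exact: (Bk0 Hf).
  have xB' : `|x| <= B by apply: le_trans xB _; rewrite ler_piMr.
  have := expR_ge1Dx x; have := expR_ge1Dx (- x); rewrite expRN => h1 h2.
  have h3 : expR x <= expR B by rewrite ler_expR; exact: le_trans (ler_norm _) xB'.
  have h4 : 1 <= expR B by rewrite -expR0 ler_expR.
  (* The inequality 1 - x <= exp(-x), multiplied by exp(x). *)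
  have h5 : expR x - 1 <= x * expR x.
    have := ler_wpM2l (expR_ge0 x) h1; rewrite mulfV ?gt_eqF ?expR_gt0//; lra.
  apply: (@le_trans _ _ (`|x| * expR B)); last first.
    by rewrite -mulrA [_ * eps]mulrC mulrA ler_wpM2r ?expR_ge0.
  have h6 : x * expR x <= `|x| * expR B.
    by apply: le_trans (ler_norm _) _; rewrite normrM [`|expR x|]ger0_norm ?expR_ge0 ?ler_wpM2l.
  rewrite ler_norml; apply/andP; split; first lra.
  have h7 : `|x| * 1 <= `|x| * expR B by rewrite ler_wpM2l.
  have := ler_norm (- x); rewrite normrN; lra.
have Cpos j : 0 <= 2 ^+ j * (B * C) * eps by rewrite !mulr_ge0// exprn_ge0.
case: k Hf HC eC Cpos => [|k] Hf HC eC Cpos.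
  split=> // p Dp; apply: le_trans (b0 p Dp) _; rewrite mulrDl lerDl; exact: (Cpos 0%N).
split.
  by move=> p Dp; apply: le_trans (b0 p Dp) _; rewrite mulrDl lerDl; exact: (Cpos k.+1).
move=> i; have [_ /(_ i)[f' [Df Rf]]] := Hf.
exists (fun p => eps * (f' p * expR (- (eps * f p)))); split.
  move=> p Dp; have := wderiveD (wderive_cst D 1 (e i) p)
    (wderiveN (wderive_comp (wderiveN (wderiveZ (c := eps) (Df p Dp))) (is_derive_expR _))).
  by congr (wderive _ _ _ _ _); ring.
have := BkZ eps (BkM B0 C0 Rf (regularS eC)); rewrite ger0_norm//.
apply: Bk_le; rewrite mulrC ler_wpM2r// -[leLHS]add0r lerD ?mulr_ge0 ?expR_ge0//.
by rewrite ler_wpM2r ?mulr_ge0// exprS ler_peMl ?exprn_ge0// ler1n.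
Qed.

(** Points of difference quotients exist arbitrarily close to p, so limits are unique; from here on
    [wderive] determines [derive_within]. *)
Hypothesis D_proper : forall p i, D p ->
  ProperFilter (within [set h : R | D (h *: e i + p)] 0^').

Lemma wderive_derive_within f i p l : D p -> wderive D f (e i) p l ->
  derive_within D f (e i) p = l.
Proof. by move=> Dp H; apply: cvg_lim => //; exact: D_proper. Qed.

Lemma wderive_uniq f i p l m : D p -> wderive D f (e i) p l -> wderive D f (e i) p m -> l = m.
Proof. by move=> Dp /(wderive_derive_within Dp) <- /(wderive_derive_within Dp). Qed.

Lemma derive_within_wderive f i p : derivable_within D f p (e i) ->
  wderive D f (e i) p (derive_within D f (e i) p).
Proof. by []. Qed.

Lemma smooth_onP f : smooth_on D e f <-> forall k, Ck k f.
Proof.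
split=> [sf k|Cf].
  have smD g : smooth_on D e g -> forall i, smooth_on D e (derive_within D g (e i)).
    (* The head of the list is the outermost derivative, so the innermost one, to be peeled off
       here, is the last entry. *)
    move=> sg i s; have := sg (rcons s i).
    suff -> : iter_derive_within D e (rcons s i) g =
      iter_derive_within D e s (derive_within D g (e i)) by [].
    by elim: s => //= j s ->.
  elim: k f sf => [|k IH] f sf; have [cf df] := sf [::]; split=> //.
  move=> i; exists (derive_within D f (e i)); split; last by apply: IH; exact: smD.
  by move=> p Dp; apply: derive_within_wderive; exact: df.
have Citer s k : Ck k (iter_derive_within D e s f).
  elim: s k => [//|i s IH] k /=; have [_ /(_ i)[g [Hg Rg]]] := IH k.+1.
  apply: Ck_ext Rg => p; rewrite inE => Dp.
  by rewrite (wderive_derive_within Dp (Hg p Dp)).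
move=> s; split; first by have [] := Citer s 0%N.
move=> i p Dp; have [_ /(_ i)[g [Hg _]]] := Citer s 1%N.
by apply/cvg_ex; exists (g p); exact: Hg.
Qed.

Lemma Ck_deriv f : (forall k, Ck k f) -> forall i,
  (forall k, Ck k (derive_within D f (e i))) /\
  forall p, D p -> wderive D f (e i) p (derive_within D f (e i) p).
Proof.
move=> Cf i; split=> [k|p Dp].
  have [_ /(_ i)[g [Hg Rg]]] := Cf k.+1; apply: Ck_ext Rg => p; rewrite inE => Dp.
  by rewrite (wderive_derive_within Dp (Hg p Dp)).
have [_ /(_ i)[g [Hg Rg]]] := Cf 1%N; apply: derive_within_wderive.
by apply/cvg_ex; exists (g p); exact: Hg.
Qed.

End regularity.

(** * The equation of a Fourier mode *)

Section power_series.
Context {R : realType}.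
Implicit Types (c : R^nat) (r x : R).

(** Abel's form of having radius of convergence at least 1. Boundedness can be read off a recurrence
    and is stable under termwise differentiation. *)
Definition radius_ge1 c :=
  forall r, 0 < r < 1 -> exists C, forall k, `|c k| * r ^+ k <= C.

Lemma radius_ge1_cvg c x : radius_ge1 c -> `|x| < 1 -> cvgn (pseries c x).
Proof.
(* With r halfway between |x| and 1, the series is dominated by a geometric one of ratio |x| / r. *)
move=> Hc x1; pose r := (1 + `|x|) / 2.
have r0 : 0 < r by rewrite /r; have := normr_ge0 x; lra.
have xr : `|x| < r by rewrite /r; lra.
have [|C HC] := Hc r; first by rewrite r0 /r; lra.
have C0 : 0 <= C.
  by apply: le_trans (HC 0%N); rewrite mulr_ge0 ?exprn_ge0// ltW.
apply: normed_cvg; apply: (@series_le_cvg _ _ (geometric C (`|x| / r))).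
- by move=> n; rewrite normr_ge0.
- by move=> n; rewrite /geometric /= mulr_ge0// exprn_ge0// divr_ge0// ltW.
- move=> n /=; rewrite exprMn exprVn mulrA ler_pdivlMr ?exprn_gt0//.
  by rewrite normrM normrX mulrAC ler_wpM2r// exprn_ge0.
apply: is_cvg_geometric_series.
by rewrite normrM normr_id normfV [`|r|]gtr0_norm// ltr_pdivrMr// mul1r.
Qed.

Lemma bernoulli_ge (d : R) k : 0 <= d -> 1 + k%:R * d <= (1 + d) ^+ k.
Proof.
move=> d0; elim: k => [|k IH]; first by rewrite mul0r addr0.
rewrite exprS; apply: (@le_trans _ _ ((1 + d) * (1 + k%:R * d))); last first.
  by rewrite ler_wpM2l// addr_ge0.
rewrite -natr1; have := mulr_ge0 (ler0n R k) (mulr_ge0 d0 d0); lra.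
Qed.

(** Differentiation costs a factor k + 1, absorbed by enlarging r to s = (1 + r)/2: with s/r = 1 +
    d, Bernoulli gives k + 1 <= (1 + 1/d)(1 + k d) <= (1 + 1/d)(s/r)^k. *)
Lemma radius_ge1_diffs c : radius_ge1 c -> radius_ge1 (pseries_diffs c).
Proof.
move=> Hc r /andP[r0 r1]; pose s := (1 + r) / 2.
have [|C HC] := Hc s; first by rewrite /s; lra.
have s0 : 0 < s by rewrite /s; lra.
pose d := s / r - 1.
have d0 : 0 < d by rewrite /d subr_gt0 ltr_pdivlMr// /s; lra.
exists ((1 + d^-1) / s * C) => k.
have sE : s ^+ k = r ^+ k * (1 + d) ^+ k.
  by rewrite -exprMn /d addrC subrK mulrCA divff ?mulr1// gt_eqF.
rewrite /pseries_diffs normrM ger0_norm//.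
have h1 : k.+1%:R * r ^+ k <= (1 + d^-1) * s ^+ k.
  have rk0 : 0 <= r ^+ k by rewrite exprn_ge0 ?ltW.
  rewrite sE mulrCA [leLHS]mulrC ler_wpM2l//.
  apply: (@le_trans _ _ ((1 + d^-1) * (1 + k%:R * d))).
    have -> : (1 + d^-1) * (1 + k%:R * d) = 1 + k%:R * d + d^-1 + k%:R * (d^-1 * d).
      by ring.
    rewrite mulVf ?gt_eqF// -natr1.
    have := mulr_ge0 (ler0n R k) (ltW d0).
    have : 0 <= d^-1 by rewrite invr_ge0 ltW.
    lra.
  by rewrite ler_wpM2l ?bernoulli_ge ?ltW// addr_gt0// invr_gt0.
rewrite mulrAC; apply: le_trans (ler_wpM2r (normr_ge0 _) h1) _.
rewrite -!mulrA ler_wpM2l//; first by rewrite addr_ge0// invr_ge0 ltW.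
rewrite ler_pdivlMl//; have := HC k.+1; rewrite exprS; lra.
Qed.

Lemma radius_ge1_derive c x : radius_ge1 c -> `|x| < 1 ->
  is_derive x (1 : R) (fun x => limn (pseries c x)) (limn (pseries (pseries_diffs c) x)).
Proof.
move=> Hc x1; pose K := (1 + `|x|) / 2.
have K0 : 0 < K by rewrite /K; have := normr_ge0 x; lra.
have K1 : `|K| < 1 by rewrite gtr0_norm// /K; lra.
apply: (@pseries_snd_diffs _ c K).
- exact: radius_ge1_cvg.
- by apply: radius_ge1_cvg => //; exact: radius_ge1_diffs.
- by apply: radius_ge1_cvg => //; do 2 apply: radius_ge1_diffs.
- by rewrite [`|K|]gtr0_norm// /K; lra.
Qed.

End power_series.

Lemma is_derive_expRN {R : realType} (t : R) :
  is_derive t (1 : R) (fun t => expR (- t)) (- expR (- t)).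
Proof. by apply: is_derive_eq; rewrite /GRing.scale /= ?mulr1 mulrN1. Qed.

Lemma is_derive_1subexpRN {R : realType} (t : R) :
  is_derive t (1 : R) (fun t => 1 - expR (- t)) (expR (- t)).
Proof.
have H := is_deriveB (is_derive_cst (1 : R) t (1 : R)) (is_derive_expRN t).
by apply: (is_derive_eq H); rewrite sub0r opprK.
Qed.

Section mode_equation.
Context {R : realType} (mu lam : R).

(* Coefficients of the solution of (1 - y) S'' + (mu - 1) S' + lam S = 0; the
   substitution y = 1 - exp(-t) turns it into a'' + mu a' + lam exp(-t) a = 0. *)
Fixpoint mode_coef2 (a0 a1 : R) k : R * R :=
  if k is k'.+1 then
    let: (x, y) := mode_coef2 a0 a1 k' in
    (y, ((k'.+1%:R - mu) * y - lam * x / k'.+1%:R) / k'.+2%:R)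
  else (a0, a1).

Definition mode_coef a0 a1 k := (mode_coef2 a0 a1 k).1.

Lemma mode_coefSS a0 a1 k : mode_coef a0 a1 k.+2 =
  ((k.+1%:R - mu) * mode_coef a0 a1 k.+1 - lam * mode_coef a0 a1 k / k.+1%:R) / k.+2%:R.
Proof. by rewrite /mode_coef /=; case: (mode_coef2 a0 a1 k). Qed.

(** For the weighted values u k = |c k| r^k the recurrence bounds u (k+2) by a combination of u
    (k+1) and u k with nonnegative coefficients, whose sum is at most 1 as soon as (1 - r) k >= |mu|
    + |lam|. From that index K on, any common bound of two consecutive values propagates. *)
Lemma mode_coef_radius a0 a1 : radius_ge1 (mode_coef a0 a1).
Proof.
move=> r /andP[r0 r1]; set c := mode_coef a0 a1.
pose K := (Num.truncn ((`|mu| + `|lam|) / (1 - r))).+1.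
have HK k : (K <= k)%N -> `|mu| + `|lam| <= (1 - r) * k%:R.
  move=> Kk; rewrite -ler_pdivrMl ?subr_gt0// mulrC.
  apply: ltW; apply: lt_le_trans (truncnS_gt _) _; by rewrite ler_nat.
pose u k := `|c k| * r ^+ k.
have u0 k : 0 <= u k by rewrite mulr_ge0// exprn_ge0// ltW.
have step k C : (K <= k)%N -> u k <= C -> u k.+1 <= C -> u k.+2 <= C.
  move=> Kk uk uk1; have C0 : 0 <= C := le_trans (u0 k) uk.
  have h1 : u k.+2 <= ((k.+1%:R + `|mu|) * r * u k.+1 + `|lam| * u k) / k.+2%:R.
    rewrite /u /c mode_coefSS -/c normrM normfV [`|k.+2%:R|]ger0_norm//.
    rewrite mulrAC ler_wpM2r// ?invr_ge0//.
    apply: le_trans (ler_wpM2r _ (ler_normB _ _)) _; first by rewrite exprn_ge0 ?ltW.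
    rewrite mulrDl lerD//.
      rewrite normrM !exprS.
      have h : `|k.+1%:R - mu| <= k.+1%:R + `|mu|.
        by apply: le_trans (ler_normB _ _) _; rewrite ger0_norm.
      have rk0 : 0 <= r ^+ k by rewrite exprn_ge0 ?ltW.
      have W0 : 0 <= `|c k.+1| * (r * (r * r ^+ k)) by rewrite !mulr_ge0// ltW.
      have E : (k.+1%:R + `|mu|) * r * (`|c k.+1| * (r * r ^+ k)) =
        (k.+1%:R + `|mu|) * (`|c k.+1| * (r * (r * r ^+ k))) by ring.
      by rewrite E -mulrA ler_wpM2r.
    rewrite !normrM normfV [`|k.+1%:R|]ger0_norm// !exprS.
    have h : r * (r * r ^+ k) / k.+1%:R <= r ^+ k.
      have rk0 : 0 <= r ^+ k by rewrite exprn_ge0 ?ltW.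
      rewrite ler_pdivrMr// mulrA mulrC ler_wpM2l//.
      apply: (@le_trans _ _ 1); last by rewrite ler1n.
      by rewrite mulr_ile1// ltW.
    have E : `|lam| * `|c k| * k.+1%:R^-1 * (r * (r * r ^+ k)) =
      `|lam| * `|c k| * (r * (r * r ^+ k) / k.+1%:R) by ring.
    by rewrite E [leRHS]mulrA ler_wpM2l// mulr_ge0.
  apply: le_trans h1 _; rewrite ler_pdivrMr//.
  have h2 : (k.+1%:R + `|mu|) * r * u k.+1 <= (k.+1%:R + `|mu|) * r * C.
    by rewrite ler_wpM2l// mulr_ge0 ?addr_ge0// ltW.
  have h3 : `|lam| * u k <= `|lam| * C by rewrite ler_wpM2l.
  apply: le_trans (lerD h2 h3) _; rewrite -mulrDl mulrC ler_wpM2l//.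
  have h4 := HK k Kk.
  have h5 : `|mu| * r <= `|mu| by rewrite ler_piMr// ltW.
  rewrite -[k.+2]addn2 -[k.+1]addn1 !natrD; lra.
(* The recurrence has order two, so the initial bound has to cover index K + 1 as well. *)
pose C := \sum_(j < K.+2) u j.
have uC j : (j < K.+2)%N -> u j <= C.
  by move=> jK; rewrite /C (bigD1 (Ordinal jK))//= lerDl sumr_ge0.
exists C => k; rewrite -/(u k).
suff H j : u (K + j)%N <= C /\ u (K + j).+1 <= C.
  have [kK|Kk] := ltnP k K.+2; first exact: uC.
  have [+ _] := H (k - K)%N; rewrite subnKC//; exact: ltnW (ltnW Kk).
elim: j => [|j [IH1 IH2]].
  by rewrite addn0; split; apply: uC.
by rewrite addnS; split=> //; apply: step => //; exact: leq_addr.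
Qed.

Lemma mode_coef_series a0 a1 (y : R) : `|y| < 1 ->
  let S j := limn (pseries (iter j (@pseries_diffs R) (mode_coef a0 a1)) y) in
  (1 - y) * S 2%N = (1 - mu) * S 1%N - lam * S 0%N.
Proof.
move=> y1 S; set c := mode_coef a0 a1 in S *.
have cv j : cvgn (pseries (iter j (@pseries_diffs R) c) y).
  apply: radius_ge1_cvg => //; elim: j => [|j IH]; first exact: mode_coef_radius.
  exact: radius_ge1_diffs.
pose c1 := pseries_diffs c; pose c2 := pseries_diffs c1.
(* The recurrence, cleared of denominators: the coefficientwise form of the differential
   equation. *)
have e : forall k, c2 k = k%:R * c1 k + (1 - mu) * c1 k - lam * c k.
  move=> k; rewrite /c2 /c1 /pseries_diffs /c mode_coefSS.
  rewrite -[in RHS]natr1; have h1 : k.+1%:R != 0 :> R by [].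
  have h2 : k.+2%:R != 0 :> R by [].
  move: h1 h2; rewrite -natr1 -[k.+2]addn2 natrD => h1 h2.
  by field; rewrite h1 h2.
(* The zeroth term of the sum of k c1_k y^k vanishes, and what remains is y times the partial sum of
   c2 with one term fewer; hence the shift of n. *)
have e' n : pseries c2 y n.+1 = y * pseries c2 y n + (1 - mu) * pseries c1 y n.+1
    - lam * pseries c y n.+1.
  have E1 : pseries c2 y n.+1 = \sum_(0 <= k < n.+1) (k%:R * c1 k * y ^+ k) +
       (1 - mu) * pseries c1 y n.+1 - lam * pseries c y n.+1.
    rewrite /pseries /series /= !mulr_sumr -big_split /= -sumrB.
    by apply: eq_bigr => k _; rewrite e; ring.
  rewrite E1; congr (_ + _ - _).
  rewrite big_nat_recl//= mul0r mul0r add0r /pseries /series /= mulr_sumr.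
  by apply: eq_bigr => k _; rewrite /c2 /pseries_diffs exprS; ring.
have l2 := cv 2%N; have l1 := cv 1%N; have l0 := cv 0%N.
have sh (f : nat -> R) : cvgn f -> (fun n => f n.+1) @ \oo --> limn f.
  by move=> cf; move: (cf); rewrite -(cvg_shiftS f).
have L : (fun n => pseries c2 y n.+1) @ \oo --> y * S 2%N + (1 - mu) * S 1%N - lam * S 0%N.
  under eq_fun do rewrite e'.
  apply: cvgB; last by apply: cvgMr; exact: sh.
  by apply: cvgD; apply: cvgMr => //; exact: sh.
have E : S 2%N = y * S 2%N + (1 - mu) * S 1%N - lam * S 0%N.
  exact: (cvg_unique _ (sh _ l2) L).
by rewrite mulrBl mul1r {1}E; ring.
Qed.

(** Existence for all t >= 0 comes at once, because then y = 1 - exp(-t) stays in [0, 1), inside the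
    disc of convergence; b is a' by the chain rule. *)
Lemma mode_exists (a0 a1 : R) : exists a b : R -> R,
  [/\ a 0 = a0, b 0 = a1 & forall t : R, 0 <= t ->
    is_derive t (1 : R) a (b t) /\
    is_derive t (1 : R) b (- mu * b t - lam * expR (- t) * a t)].
Proof.
pose S j y := limn (pseries (iter j (@pseries_diffs R) (mode_coef a0 a1)) y).
have S0 j : S j 0 = iter j (@pseries_diffs R) (mode_coef a0 a1) 0%N.
  rewrite /S; apply: cvg_lim => //; rewrite -cvg_shiftS.
  set f := (X in X @ _ --> _); suff -> : f = fun=> iter j (@pseries_diffs R) (mode_coef a0 a1) 0%N.
    exact: cvg_cst.
  apply/funext => n; rewrite /f /pseries /series /= big_nat_recl//= mulr1 big1 ?addr0//.
  by move=> i _; rewrite exprS mul0r mulr0.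
have dS j y : `|y| < 1 -> is_derive y (1 : R) (S j) (S j.+1 y).
  move=> y1; apply: radius_ge1_derive => //.
  elim: j => [|j IH]; first exact: mode_coef_radius.
  exact: radius_ge1_diffs.
exists (fun t => S 0%N (1 - expR (- t))), (fun t => S 1%N (1 - expR (- t)) * expR (- t)).
split.
- by rewrite oppr0 expR0 subrr S0.
- by rewrite oppr0 expR0 subrr S0 /= /pseries_diffs mul1r mulr1.
move=> t t0.
have e0 := expR_gt0 (- t).
have e1 : expR (- t) <= 1 by rewrite -expR0 ler_expR oppr_le0.
have y1 : `|1 - expR (- t)| < 1 by rewrite ger0_norm; lra.
have de := is_derive_expRN t; have dy := is_derive_1subexpRN t.
have dSy j : is_derive t (1 : R) (fun t => S j (1 - expR (- t)))
    (S j.+1 (1 - expR (- t)) * expR (- t)).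
  exact (@is_derive1_comp _ (S j) (fun t => 1 - expR (- t)) _ _ _ (dS j _ y1) dy).
split; first exact: dSy.
have H1 := dSy 1%N.
apply: (is_derive_eq (is_deriveM H1 de)).
have := mode_coef_series a0 a1 y1; rewrite -/(S 0%N _) -/(S 1%N _) -/(S 2%N _).
rewrite subKr /GRing.scale /= => E.
have -> : expR (- t) * (S 2%N (1 - expR (- t)) * expR (- t)) =
   expR (- t) * (expR (- t) * S 2%N (1 - expR (- t))) by ring.
by rewrite E /S /=; ring.
Qed.

End mode_equation.

(** * Mean value and Taylor estimates on the line *)

Section mean_value.
Context {R : realType}.
Implicit Types (f g : R -> R) (a b c x t : R).

Lemma mvt_le f df a b c : a <= b ->
  (forall x, a < x < b -> is_derive x (1 : R) f (df x)) ->
  (forall x, a < x < b -> df x <= c) ->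
  {within `[a, b], continuous f} -> f b - f a <= c * (b - a).
Proof.
move=> ab df1 dfc cf; have [->|ne] := eqVneq a b; first by rewrite !subrr mulr0.
have ab' : a < b by rewrite lt_neqAle ne.
have df2 x : x \in `]a, b[ -> is_derive x (1 : R) f (df x) by rewrite in_itv; exact: df1.
have [x] := MVT ab' df2 cf; rewrite in_itv /= => xab ->; rewrite ler_wpM2r ?subr_ge0//; exact: dfc.
Qed.

Lemma derive_within_itv f df a b :
  (forall x, a <= x <= b -> is_derive x (1 : R) f (df x)) ->
  {within `[a, b], continuous f}.
Proof.
move=> H; apply/subspace_continuousP => x /=; rewrite in_itv /= => xab.
have cx : {for x, continuous f}.
  by apply/differentiable_continuous/derivable1_diffP; have [] := H x xab.
by apply: cvg_within_filter; exact: cx.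
Qed.

Lemma derive_dist_le f df a b c :
  (forall x, Num.min a b <= x <= Num.max a b -> is_derive x (1 : R) f (df x)) ->
  (forall x, Num.min a b <= x <= Num.max a b -> `|df x| <= c) ->
  `|f b - f a| <= c * `|b - a|.
Proof.
wlog ab : a b / a <= b.
  move=> W; have /orP[ab|ba] := le_total a b; first exact: W.
  rewrite minC maxC => H1 H2; rewrite distrC [`|b - a|]distrC.
  exact: W.
rewrite (min_l ab) (max_r ab) => H1 H2.
have cf := derive_within_itv H1.
have lt x : a < x < b -> a <= x <= b by move=> /andP[? ?]; rewrite !ltW.
rewrite ler_norml [`|b - a|]ger0_norm ?subr_ge0//; apply/andP; split.
  rewrite lerNl; have := @mvt_le (fun x => - f x) (fun x => - df x) a b c ab.
  rewrite opprB opprK addrC; apply.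
  - by move=> x /lt xab; have := H1 x xab => ?; exact: is_deriveN.
  - by move=> x /lt /H2; apply: le_trans; rewrite -normrN; exact: ler_norm.
  - by move=> x; apply: continuousN; exact: cf.
apply: (mvt_le ab (df := df)) => //.
  by move=> x /lt; exact: H1.
by move=> x /lt /H2; apply: le_trans; exact: ler_norm.
Qed.

(** The mean value bound applied twice; this loses the factor 1/2 of the sharp remainder. Increments
    of either sign are allowed, as needed in space and for backward steps in time. *)
Lemma taylor1_le f f1 f2 a b c :
  (forall x, Num.min a b <= x <= Num.max a b -> is_derive x (1 : R) f (f1 x)) ->
  (forall x, Num.min a b <= x <= Num.max a b -> is_derive x (1 : R) f1 (f2 x)) ->
  (forall x, Num.min a b <= x <= Num.max a b -> `|f2 x| <= c) ->
  `|f b - f a - (b - a) * f1 a| <= c * `|b - a| ^+ 2.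
Proof.
move=> H1 H2 H3.
have c0 : 0 <= c.
  by apply: le_trans (normr_ge0 _) (H3 a _); rewrite ge_min lexx le_max lexx.
have := @derive_dist_le (fun x => f x - (x - a) * f1 a) (fun x => f1 x - f1 a) a b (c * `|b - a|).
rewrite subrr mul0r subr0 addrAC expr2 mulrA; apply=> x xab.
  have ? := H1 x xab; apply: is_derive_eq.
  by rewrite /GRing.scale /= !(mulr0, mulr1, subr0, addr0, add0r).
have xle : `|x - a| <= `|b - a|.
  have /orP[ab|ba] := le_total a b; move: xab; rewrite ?(min_l ab) ?(max_r ab) => /andP[xa xb].
    by rewrite !ger0_norm ?subr_ge0// lerD2r.
  move: xa xb; rewrite (min_r ba) (max_l ba) => xa xb.
  by rewrite !ler0_norm ?subr_le0// lerN2 lerD2r.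
have [m M] : Num.min a b <= Num.min a x /\ Num.max a x <= Num.max a b.
  case/andP: xab => xa xb; split.
    by rewrite le_min xa ge_min lexx.
  by rewrite ge_max xb le_max lexx.
apply: le_trans (@derive_dist_le f1 f2 a x c _ _) _.
- by move=> y /andP[ya yx]; apply: H2; rewrite (le_trans m)// (le_trans yx).
- by move=> y /andP[ya yx]; apply: H3; rewrite (le_trans m)// (le_trans yx).
by rewrite ler_wpM2l.
Qed.

End mean_value.

(** * Bounds for a single mode *)

Section mode_energy.
Context {R : realType} (mu lam : R) (a b : R -> R).
Hypothesis mu1 : 1 <= 2 * mu.
Hypothesis lam0 : 0 <= lam.
Hypothesis da : forall t : R, 0 <= t -> is_derive t (1 : R) a (b t).
Hypothesis db : forall t : R, 0 <= t ->
  is_derive t (1 : R) b (- mu * b t - lam * expR (- t) * a t).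

Let expN2 (t : R) : is_derive t (1 : R) (fun s => expR (- (s / 2))) (- (expR (- (t / 2)) / 2)).
Proof.
have d : is_derive t (1 : R) (fun s : R => - (s / 2)) (- (2^-1)).
  by apply: is_derive_eq; rewrite /GRing.scale /= !(mulr0, mulr1, addr0, add0r, mul1r).
have := @is_derive1_comp _ expR (fun s => - (s / 2)) t _ _ (is_derive_expR _) d.
by rewrite mulrN.
Qed.

Lemma nonincreasing0 (f df : R -> R) (t : R) : 0 <= t ->
  (forall s : R, 0 <= s -> is_derive s (1 : R) f (df s)) ->
  (forall s : R, 0 <= s -> df s <= 0) -> f t <= f 0.
Proof.
move=> t0 H1 H2; have := @mvt_le _ f df 0 t 0 t0.
rewrite mul0r subr_le0; apply.
- by move=> x /andP[/ltW x0 _]; exact: H1.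
- by move=> x /andP[/ltW x0 _]; exact: H2.
- by apply: (derive_within_itv (df := df)) => x /andP[x0 _]; exact: H1.
Qed.

(* exp(t) b^2 + lam a^2 is nonincreasing, so that b decays like exp(-t/2) and a
   stays bounded. *)
Lemma mode_bound (K t : R) : 0 <= K -> b 0 ^+ 2 + lam * a 0 ^+ 2 <= K ^+ 2 -> 0 <= t ->
  `|b t| <= K /\ `|a t| <= `|a 0| + 2 * K.
Proof.
move=> K0 HK t0.
have bt s : 0 <= s -> `|b s| <= K * expR (- (s / 2)).
  move=> s0.
  have E : expR s * b s ^+ 2 + lam * a s ^+ 2 <= K ^+ 2.
    apply: le_trans HK; rewrite -[b 0 ^+ 2]mul1r -expR0.
    (* The mixed terms in a b cancel because the weight exp(s) undoes the factor exp(-s) of the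
       equation; what is left has the sign of 1 - 2 mu. *)
    apply: (@nonincreasing0 (fun s => expR s * b s ^+ 2 + lam * a s ^+ 2)
      (fun s => expR s * b s ^+ 2 * (1 - 2 * mu))) => //.
      move=> u u0; have da' := da u0; have db' := db u0.
      apply: is_derive_eq; rewrite /GRing.scale /=.
      have e1 : expR u * expR (- u) = 1 by rewrite -expRD subrr expR0.
      transitivity (expR u * b u ^+ 2 * (1 - 2 * mu) +
        (1 - expR u * expR (- u)) * (2 * lam * a u * b u)); first by ring.
      by rewrite e1 subrr mul0r addr0.
    move=> u u0; apply: mulr_ge0_le0; last by rewrite subr_le0.
    by apply: mulr_ge0; [exact: expR_ge0|exact: sqr_ge0].
  have h0 : 0 <= lam * a s ^+ 2 by rewrite mulr_ge0 ?sqr_ge0.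
  have E2 : expR (s / 2) * expR (s / 2) = expR s by rewrite -expRD -splitr.
  have E3 : expR (s / 2) * expR (- (s / 2)) = 1 by rewrite -expRD subrr expR0.
  have h2 : `|expR (s / 2) * b s| <= K.
    rewrite -(ler_pXn2r (n := 2))// ?nnegrE//.
    by rewrite -normrX ger0_norm ?sqr_ge0// exprMn expr2 E2; lra.
  rewrite normrM gtr0_norm ?expR_gt0// in h2.
  have := ler_wpM2r (expR_ge0 (- (s / 2))) h2.
  by rewrite mulrAC E3 mul1r.
have e1 s : 0 <= s -> expR (- (s / 2)) <= 1.
  by move=> s0; rewrite -[leRHS]expR0 ler_expR oppr_le0 divr_ge0.
split; first by apply: le_trans (bt t t0) _; rewrite ler_piMr// e1.
have := expR_ge0 (- (t / 2)); have := mulr_ge0 K0 (expR_ge0 (- (t / 2))) => Ke _.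
(* The added term 2 K exp(-s/2) has derivative - K exp(-s/2), which dominates sg b; the two signs
   give the two-sided bound. *)
have H (sg : R) : sg = 1 \/ sg = -1 -> sg * a t <= sg * a 0 + 2 * K.
  move=> Hsg; have : sg * a t + 2 * K * expR (- (t / 2)) <= sg * a 0 + 2 * K * expR (- (0 / 2)).
    apply: (@nonincreasing0 (fun s => sg * a s + 2 * K * expR (- (s / 2)))
      (fun s => sg * b s - K * expR (- (s / 2)))) => // s s0.
      have da' := da s0; have de := expN2 s; apply: is_derive_eq.
      by rewrite /GRing.scale /= ; field.
    rewrite subr_le0; apply: le_trans (bt s s0).
    by case: Hsg => ->; rewrite ?mul1r ?mulN1r; [|rewrite -normrN]; exact: ler_norm.
  by rewrite mul0r oppr0 expR0 mulr1; lra.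
have H1 := H 1 (or_introl erefl); have H2 := H (-1) (or_intror erefl).
have := ler_norm (a 0); have := ler_norm (- a 0); rewrite normrN => h1 h2.
rewrite ler_norml; lra.
Qed.

End mode_energy.

(** The two fundamental solutions. K = 1 + lam serves both, since 1 and lam are at most (1 + lam)^2;
    then |a| <= 1 + 2 K. A bound polynomial in lam can be absorbed by powers of [freq_weight]. *)
Lemma mode_bound2 {R : realType} (mu lam : R) : 1 <= 2 * mu -> 0 <= lam ->
  forall a0 a1 : R, (a0, a1) = (1, 0) \/ (a0, a1) = (0, 1) ->
  exists a b : R -> R, [/\ a 0 = a0, b 0 = a1 & forall t : R, 0 <= t -> [/\
    is_derive t (1 : R) a (b t),
    is_derive t (1 : R) b (- mu * b t - lam * expR (- t) * a t),
    `|a t| <= 3 * (1 + lam) & `|b t| <= 3 * (1 + lam)]].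
Proof.
move=> mu1 lam0 a0 a1 H; have [a [b [ea eb dab]]] := mode_exists mu lam a0 a1.
exists a, b; split=> // t t0.
have da s s0 := (dab s s0).1; have db s s0 := (dab s s0).2.
have [||h1 h2] := mode_bound mu1 lam0 da db (K := 1 + lam) _ _ t0; first by rewrite addr_ge0.
  rewrite ea eb; have := sqr_ge0 lam.
  by case: H => -[-> ->]; rewrite !(expr0n, expr1n, mulr0, mulr1, addr0, add0r) sqrrD; lra.
split; [exact: da|exact: db| |].
  apply: le_trans h2 _; rewrite ea; case: H => -[-> _]; rewrite ?normr1 ?normr0; lra.
by apply: le_trans h1 _; lra.
Qed.

(** * The lattice and its dual *)

Section lattice.
Context {R : realType} (n m : nat).
Hypothesis m_gt0 : (0 < m)%N.

Local Notation N := ((m ^ 2 + m ^ 2).+1)%N.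
Local Notation lattice := {ffun 'I_n -> 'I_N}.
Implicit Types (j k : lattice) (i : 'I_n) (l : 'I_N).

Definition centered l : R := l%:R - (m ^ 2)%:R.

(* The lattice has spacing 1/m and side 2m, and [freq] runs through its dual;
   both exhaust space as m -> oo, so that the data need not be made periodic. *)
Definition pt j : 'rV[R]_n := \row_i (centered (j i) / m%:R).

Definition freq k i : R := 2 * pi * centered (k i) * m%:R / N%:R.

Definition lattice_succ i j : lattice := [ffun a => if a == i then ordS (j i) else j a].

Let mR_gt0 : 0 < m%:R :> R. Proof. by rewrite ltr0n. Qed.
Let mR_neq0 : m%:R != 0 :> R. Proof. by rewrite gt_eqF. Qed.
Let mR_ge1 : 1 <= m%:R :> R. Proof. by rewrite ler1n. Qed.

Lemma lattice_succ_inj i : injective (lattice_succ i).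
Proof.
move=> j j' /ffunP E; apply/ffunP => a; have := E a; rewrite !ffunE.
by case: eqP => [->|//]; apply: (can_inj (@ordSK _)).
Qed.

(** The second case is the wrap-around: it shifts by the full period N, and both end values have
    modulus m^2, that is, distance m after scaling. *)
Lemma centeredS l : centered (ordS l) = centered l + 1 \/
  [/\ centered (ordS l) = centered l + 1 - N%:R, centered l = m%:R ^+ 2
    & centered (ordS l) = - m%:R ^+ 2].
Proof.
have [lN|Nl] := ltnP l.+1 N.
  by left; rewrite /centered /= modn_small// -natr1; ring.
have lE : l = (m ^ 2 + m ^ 2)%N :> nat.
  by apply/eqP; rewrite eqn_leq -ltnS ltn_ord -ltnS Nl.
right; rewrite /centered /= lE modnn -!natr1 !natrD !natrX; split; ring.
Qed.

(* The cyclic successor wraps around only where Z vanishes. *)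
Lemma lattice_shift (Z : 'rV[R]_n -> R) i :
  (forall x : 'rV[R]_n, m%:R <= `|x 0 i| -> Z x = 0) ->
  \sum_(j : lattice) Z (m%:R^-1 *: delta_mx 0 i + pt j) = \sum_(j : lattice) Z (pt j).
Proof.
move=> Z0; rewrite [RHS](reindex_inj (@lattice_succ_inj i)) /=; apply: eq_bigr => j _.
have [H|[_ H1 H2]] := centeredS (j i).
  congr Z; apply/rowP => a; rewrite !mxE !ffunE eqxx /=.
  case: eqP => [->|_]; last by rewrite mulr0 add0r.
  by rewrite H mulr1 [RHS]mulrDl div1r addrC.
rewrite !Z0//; rewrite !mxE ?ffunE ?eqxx /=.
  rewrite H2 expr2 mulNr mulfK// normrN ger0_norm//.
rewrite H1 expr2 mulfK// mulr1 ger0_norm ?addr_ge0 ?invr_ge0//.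
by rewrite lerDr invr_ge0.
Qed.

(* A telescoping majorant. *)
Lemma inv1Dsqr_le (x d : R) : 0 < d <= 1 -> 0 <= x \/ x <= - d ->
  (1 + x ^+ 2)^-1 <= 4 / d * ((x + d) / (1 + `|x + d|) - x / (1 + `|x|)).
Proof.
move=> /andP[d0 d1]; have pos : 0 < 1 + x ^+ 2 by rewrite ltr_pwDl// sqr_ge0.
case=> xs.
  rewrite !ger0_norm; [|lra|lra].
  have a0 : 0 < 1 + (x + d) by lra.
  have b0 : 0 < 1 + x by lra.
  have -> : 4 / d * ((x + d) / (1 + (x + d)) - x / (1 + x)) =
    4 / ((1 + (x + d)) * (1 + x)) by field; rewrite !gt_eqF//.
  rewrite ler_pdivlMr ?mulr_gt0// mulrC ler_pdivrMr//.
  have := mulr_ge0 xs (ltW d0); have := sqr_ge0 (1 - x); have := sqr_ge0 x.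
  have : 0 <= x * (1 - d) by rewrite mulr_ge0// subr_ge0.
  rewrite sqrrB !expr2; nra.
rewrite !ler0_norm; [|lra|lra].
have a0 : 0 < 1 - (x + d) by lra.
have b0 : 0 < 1 - x by lra.
have -> : 4 / d * ((x + d) / (1 - (x + d)) - x / (1 - x)) =
    4 / ((1 - (x + d)) * (1 - x)) by field; rewrite !gt_eqF//.
rewrite ler_pdivlMr ?mulr_gt0// mulrC ler_pdivrMr//.
have : 0 <= - x * (1 - d) by rewrite mulr_ge0; lra.
have := sqr_ge0 (1 + x); have := sqr_ge0 x; rewrite sqrrD !expr2; nra.
Qed.

(** A Riemann sum of 1/(1 + x^2) with the volume element 1/m left out. The telescoping function x/(1
    + |x|) has values in [-1, 1], so its total increase is at most 2. *)
Lemma sum_inv1Dsqr : \sum_l (1 + (centered l / m%:R) ^+ 2)^-1 <= 8 * m%:R.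
Proof.
pose g (x : R) := x / (1 + `|x|).
have g1 x : `|g x| <= 1.
  rewrite /g normrM normfV [`|1 + _|]ger0_norm ?addr_ge0//.
  by rewrite ler_pdivrMr ?ltr_pwDl// mul1r lerDr.
pose y (a : nat) : R := (a%:R - (m ^ 2)%:R) / m%:R.
have step l : (1 + (centered l / m%:R) ^+ 2)^-1 <= 4 * m%:R * (g (y l.+1) - g (y l)).
  have -> : y l.+1 = y l + m%:R^-1 by rewrite /y -natr1; ring.
  rewrite (_ : 4 * m%:R = 4 / (m%:R^-1)); last by rewrite invrK.
  apply: inv1Dsqr_le; first by rewrite invr_gt0 mR_gt0 invf_le1.
  (* Zero is a lattice point, so no lattice interval has it in its interior. *)
  rewrite /y; have [ml|lm] := leqP (m ^ 2)%N l.
    by left; rewrite divr_ge0// subr_ge0 ler_nat.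
  have h : l%:R + 1 <= (m ^ 2)%:R :> R by rewrite natr1 ler_nat.
  by right; rewrite -[leRHS]mulN1r ler_pM2r ?invr_gt0// /centered; lra.
apply: le_trans (ler_sum _ (fun l _ => step l)) _.
rewrite -mulr_sumr -(big_mkord xpredT (fun a => g (y a.+1) - g (y a))) telescope_sumr//.
have := g1 (y N); have := g1 (y 0%N); rewrite !ler_norml => /andP[h1 _] /andP[_ h2].
rewrite (_ : 8 * m%:R = 4 * m%:R * 2); last by ring.
rewrite ler_wpM2l ?mulr_ge0//; lra.
Qed.

Let N_neq0 : N%:R != 0 :> R. Proof. by rewrite pnatr_eq0. Qed.

Let freqE (c k x p : R) : x != 0 -> p != 0 ->
  c * k * x / p = k / x * (c * x ^+ 2 / p).
Proof. by move=> x0 p0; field; rewrite x0 p0. Qed.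

Lemma sum_prod (phi : 'I_N -> R) :
  \sum_(j : lattice) \prod_(i < n) phi (j i) = (\sum_l phi l) ^+ n.
Proof.
by rewrite -(bigA_distr_bigA (fun (i : 'I_n) l => phi l)) prodr_const card_ord.
Qed.

Lemma lattice_sum_le :
  \sum_(j : lattice) \prod_(i < n) (1 + pt j 0 i ^+ 2)^-1 <= (8 * m%:R) ^+ n.
Proof.
under eq_bigr do under eq_bigr do rewrite mxE.
rewrite (sum_prod (fun l => (1 + (centered l / m%:R) ^+ 2)^-1)).
rewrite lerXn2r ?nnegrE ?sum_inv1Dsqr ?mulr_ge0//.
by apply: sumr_ge0 => l _; rewrite invr_ge0 addr_ge0// sqr_ge0.
Qed.

(** Each frequency is at least as large in modulus as the lattice coordinate of the same index,
    because 2 pi m^2 >= N; the sum is thus compared with the one over the lattice. *)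
Lemma freq_sum_le :
  \sum_(k : lattice) \prod_(i < n) (1 + freq k i ^+ 2)^-1 <= (8 * m%:R) ^+ n.
Proof.
rewrite (sum_prod (fun l => (1 + (2 * pi * centered l * m%:R / N%:R) ^+ 2)^-1)).
have p0 l (x : R) : 0 <= (1 + x ^+ 2)^-1 by rewrite invr_ge0 addr_ge0// sqr_ge0.
apply: lerXn2r; rewrite ?nnegrE; [|by rewrite mulr_ge0|].
  by apply: sumr_ge0 => l _; exact: p0.
apply: le_trans sum_inv1Dsqr; apply: ler_sum => l _.
rewrite lef_pV2 ?posrE ?ltr_pwDl ?sqr_ge0// lerD2l -ler_sqrt ?sqr_ge0// !sqrtr_sqr.
rewrite (_ : 2 * pi * centered l * m%:R / N%:R =
  centered l / m%:R * (2 * pi * m%:R ^+ 2 / N%:R)); last first.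
  by rewrite freqE.
rewrite [leRHS]normrM ler_peMr// ger0_norm.
  rewrite ler_pdivlMr// mul1r -natr1 natrD natrX.
  have := pi_ge2 R; have : 1 <= m%:R ^+ 2 :> R by rewrite exprn_ege1.
  nra.
by rewrite divr_ge0// !mulr_ge0// ?pi_ge0// exprn_ge0.
Qed.

Lemma N_ge : m%:R ^+ 2 <= N%:R :> R.
Proof. by rewrite -natrX ler_nat leqW// leq_addr. Qed.

Lemma cosD2pi_int (a b : nat) (x : R) : cos (x + 2 * pi * (a%:R - b%:R)) = cos x.
Proof.
rewrite -[RHS](periodicn (@cosD2pi R) a) -[LHS](periodicn (@cosD2pi R) b).
by congr cos; rewrite -(mulr_natr _ a) -(mulr_natr _ b) -(mulr_natr pi 2); ring.
Qed.

Lemma sinD2pi_int (a b : nat) (x : R) : sin (x + 2 * pi * (a%:R - b%:R)) = sin x.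
Proof.
rewrite -[RHS](periodicn (@sinD2pi R) a) -[LHS](periodicn (@sinD2pi R) b).
by congr sin; rewrite -(mulr_natr _ a) -(mulr_natr _ b) -(mulr_natr pi 2); ring.
Qed.

Lemma cos_neq1 (x : R) : 0 < `|x| < 2 * pi -> cos x != 1.
Proof.
move=> /andP[x0 x2]; rewrite -(cos_norm x) [`|x|]splitr.
rewrite cosD -!expr2 cos2sin2 -addrA -opprD subr_eq addrC -subr_eq subrr eq_sym.
rewrite -mulr2n mulrn_eq0 /= expf_eq0 /= gt_eqF// sin_gt0_pi//.
by rewrite divr_gt0//= ltr_pdivrMr// mulrC.
Qed.

Lemma freq_pt k j : \sum_(i < n) freq k i * pt j 0 i =
  \sum_(i < n) 2 * pi * centered (k i) * centered (j i) / N%:R.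
Proof.
apply: eq_bigr => i _; rewrite /freq mxE [_ * m%:R / _]mulrAC.
by rewrite mulrACA mulfV// mulr1 mulrAC.
Qed.

(* Shifting one coordinate of k rotates the pair of sums of cos and of sin by an
   angle which is not a multiple of 2 pi, so that both vanish. *)
Lemma freq_orthogonal j j' :
  \sum_(k : lattice) cos (\sum_(i < n) freq k i * (pt j 0 i - pt j' 0 i)) =
  if j == j' then N%:R ^+ n else 0.
Proof.
case: eqP => [->|/eqP ne].
  under eq_bigr do (under eq_bigr do rewrite subrr mulr0; rewrite big1// cos0).
  by rewrite sumr_const card_ffun !card_ord natrX.
have [i ni] : exists i, j i != j' i.
  apply/existsP; apply: contraNT ne; rewrite negb_exists => /forallP H.
  by apply/eqP/ffunP => i; apply/eqP; have := H i; rewrite negbK.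
pose d a : R := (j a)%:R - (j' a)%:R.
pose Th k : R := \sum_(a < n) 2 * pi * centered (k a) * d a / N%:R.
have E k : \sum_(i < n) freq k i * (pt j 0 i - pt j' 0 i) = Th k.
  under eq_bigr do rewrite mulrBr; rewrite sumrB !freq_pt -sumrB.
  by apply: eq_bigr => a _; rewrite /centered /d; ring.
under eq_bigr do rewrite E.
(* The rotation angle produced by one shift; it is no multiple of 2 pi because 0 < |d i| < N. *)
pose w : R := 2 * pi * d i / N%:R.
have ThS k : (Th (lattice_succ i k) = Th k + w) \/
   (Th (lattice_succ i k) + 2 * pi * d i = Th k + w).
  have Ek : Th (lattice_succ i k) =
      Th k + 2 * pi * (centered (ordS (k i)) - centered (k i)) * d i / N%:R.
    rewrite /Th !(bigD1 i (P := xpredT))//= ffunE eqxx.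
    rewrite [X in _ + X = _](eq_bigr (fun a => 2 * pi * centered (k a) * d a / N%:R)).
      by ring.
    by move=> a ai; rewrite ffunE (negbTE ai).
  rewrite Ek /w; case: (centeredS (k i)) => [->|[-> _ _]].
    by left; ring.
  right; transitivity (Th k + 2 * pi * d i / N%:R + 2 * pi * d i * (1 - N%:R / N%:R)).
    by ring.
  by rewrite mulfV// subrr mulr0 addr0.
have cosS k : cos (Th (lattice_succ i k)) = cos (Th k + w).
  by case: (ThS k) => <- //; rewrite cosD2pi_int.
have sinS k : sin (Th (lattice_succ i k)) = sin (Th k + w).
  by case: (ThS k) => <- //; rewrite sinD2pi_int.
set S := \sum_(k : lattice) _; pose T := \sum_(k : lattice) sin (Th k).
have ES : S = S * cos w - T * sin w.
  rewrite {1}/S (reindex_inj (@lattice_succ_inj i)) /=.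
  under eq_bigr do rewrite cosS cosD.
  by rewrite sumrB -!mulr_suml.
have ET : T = T * cos w + S * sin w.
  rewrite {1}/T (reindex_inj (@lattice_succ_inj i)) /=.
  under eq_bigr do rewrite sinS sinD.
  by rewrite big_split /= -!mulr_suml.
have : cos w != 1.
  apply: cos_neq1; rewrite /w normrM normfV (ger0_norm (ler0n _ _)) normrM.
  rewrite [`|2 * pi|]ger0_norm ?mulr_ge0 ?pi_ge0//.
  have d0 : 0 < `|d i|.
    by rewrite normr_gt0 subr_eq0 eqr_nat; apply: contraNneq ni => /val_inj ->.
  have p0 := pi_gt0 R.
  rewrite divr_gt0 ?mulr_gt0//= ltr_pdivrMr// ltr_pM2l ?mulr_gt0//.
  rewrite ltr_norml ltrNl opprB !ltrBlDr.
  by rewrite !ltr_wpDr// ltr_nat.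
(* The pair (S, T) is fixed by the rotation: a linear system whose determinant is (1 - cos w)^2 +
   sin(w)^2. *)
move=> c1; have : S * ((1 - cos w) ^+ 2 + sin w ^+ 2) = 0.
  have e1 : S * (1 - cos w) + T * sin w = 0 by lra.
  have e2 : T * (1 - cos w) - S * sin w = 0 by lra.
  transitivity ((S * (1 - cos w) + T * sin w) * (1 - cos w) -
     (T * (1 - cos w) - S * sin w) * sin w); first by ring.
  by rewrite e1 e2 !mul0r subrr.
move/eqP; rewrite mulf_eq0 => /orP[/eqP//|].
rewrite paddr_eq0 ?sqr_ge0// => /andP[]; rewrite sqrf_eq0 subr_eq0 eq_sym.
by rewrite (negbTE c1).
Qed.

End lattice.

Arguments centered : simpl never.
Arguments pt : simpl never.
Arguments freq : simpl never.

(** * Finite differences *)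

Section finite_differences.
Context {R : realType} {n : nat}.
Local Notation E := (@space_frame R n).
Local Notation BkS := (Bk setT E).
Implicit Types (F G : 'rV[R]_n -> R) (i : 'I_n) (h B L : R).

Definition dq h i F x := h^-1 * (F (h *: E i + x) - F x).

Lemma is_derive_lineT F i p l (s : R) : wderive setT F (E i) (s *: E i + p) l ->
  is_derive s (1 : R) (fun s => F (s *: E i + p)) l.
Proof. by apply: is_derive_wderive; exists 1. Qed.

Lemma Bk_translate B k F v : BkS B k F -> BkS B k (fun x => F (v + x)).
Proof.
elim: k F => [|k IH] F [F0 HF]; split=> //; try by move=> p _; exact: F0.
move=> i; have [g [Dg Hg]] := HF i; exists (fun x => g (v + x)); split; last exact: IH.
move=> p _; have /wderiveP H := Dg (v + p) I; apply/wderiveP => e /H[d d0 Hd].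
by exists d => // h hd _; rewrite addrCA; exact: Hd.
Qed.

Lemma Bk_dist_le B k F i (a : R) (x : 'rV[R]_n) : BkS B k.+1 F ->
  `|F (a *: E i + x) - F x| <= B * `|a|.
Proof.
move=> [_ /(_ i)[g [Dg /Bk0 Hg]]].
have := @derive_dist_le _ (fun s => F (s *: E i + x)) (fun s => g (s *: E i + x)) 0 a B.
rewrite scale0r add0r subr0; apply=> s _; last exact: Hg.
by apply: is_derive_lineT; exact: Dg.
Qed.

Lemma Bk_dq B k F h i : h != 0 -> BkS B k.+1 F -> BkS B k (dq h i F).
Proof.
move=> h0; elim: k F => [|k IH] F HF.
  split=> // p _; rewrite /dq normrM normfV mulrC ler_pdivrMr ?normr_gt0//.
  exact: Bk_dist_le HF.
split.
  move=> p _; rewrite /dq normrM normfV mulrC ler_pdivrMr ?normr_gt0//.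
  exact: Bk_dist_le HF.
move=> a; have [_ /(_ a)[g [Dg Hg]]] := HF.
exists (dq h i g); split; last exact: IH.
move=> p _; apply: wderiveZ; apply: wderiveD; last exact: wderiveN (Dg p I).
have /wderiveP H := Dg (h *: E i + p) I; apply/wderiveP => e /H[d d0 Hd].
by exists d => // t td _; rewrite addrCA; exact: Hd.
Qed.

Definition vanish L F := forall x : 'rV[R]_n, (exists i, L <= `|x 0 i|) -> F x = 0.

Definition second_dq h i F x := dq h i (dq h i F) (- (h *: E i) + x).

(** A discrete version of 1 - Laplacian. It acts on the k-th Fourier coefficient as a scalar at
    least [freq_weight k / 4], so each application yields one power of decay. *)
Definition helmholtz h F x := F x - \sum_(i < n) second_dq h i F x.

Lemma second_dqE h i F x : h != 0 -> second_dq h i F x =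
  h ^- 2 * (F (h *: E i + x) + F (- (h *: E i) + x) - 2 * F x).
Proof.
by move=> h0; rewrite /second_dq /dq !addNKr -exprVn; field.
Qed.

Lemma Bk_second_dq B k F h i : h != 0 -> BkS B k.+2 F -> BkS B k (second_dq h i F).
Proof. by move=> h0 HF; apply: Bk_translate; do 2 apply: Bk_dq => //. Qed.

Lemma Bk_cst0 k : BkS 0 k (fun=> 0).
Proof.
elim: k => [|k IH]; split=> //; try by move=> p _; rewrite normr0.
by move=> i; exists (fun=> 0); split=> // p _; exact: wderive_cst.
Qed.

Lemma Bk_big B k (G : 'I_n -> 'rV[R]_n -> R) (r : seq 'I_n) :
  (forall i, BkS B k (G i)) -> BkS ((size r)%:R * B) k (fun x => \sum_(i <- r) G i x).
Proof.
move=> H; elim: r => [|i r IH].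
  rewrite mul0r (_ : (fun x => _) = fun=> 0); first exact: Bk_cst0.
  by apply/funext => x; rewrite big_nil.
rewrite (_ : (fun x => _) = fun x => G i x + \sum_(i <- r) G i x); last first.
  by apply/funext => x; rewrite big_cons.
by rewrite /= -natr1 mulrDl mul1r addrC; exact: BkD.
Qed.

Lemma Bk_helmholtz B k F h : h != 0 -> BkS B k.+2 F ->
  BkS ((1 + n%:R) * B) k (helmholtz h F).
Proof.
move=> h0 HF; rewrite mulrDl mul1r; apply: BkD.
  by apply: regularW HF; rewrite leqW.
have := BkZ (-1) (Bk_big (enum 'I_n) (fun i => Bk_second_dq i h0 HF)).
rewrite normrN1 mul1r size_enum_ord.
by under eq_fun do rewrite mulN1r big_enum.
Qed.

Lemma vanish_translate L h i F : `|h| <= 1 -> vanish L F ->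
  vanish (L + 1) (fun x => F (h *: E i + x)).
Proof.
move=> h1 HF x [a xa]; apply: HF; exists a; rewrite !mxE eqxx /=.
have : `|h * (a == i)%:R| <= 1.
  by case: eqP => _; rewrite ?mulr1 ?mulr0 ?normr0.
have := ler_normD (h * (a == i)%:R + x 0 a) (- (h * (a == i)%:R)).
by rewrite normrN addrAC subrr add0r; lra.
Qed.

Lemma vanish_helmholtz L h F : h != 0 -> `|h| <= 1 -> vanish L F ->
  vanish (L + 1) (helmholtz h F).
Proof.
move=> h0 h1 HF x Hx; rewrite /helmholtz.
have FL : vanish (L + 1) F.
  by move=> y [a ya]; apply: HF; exists a; lra.
rewrite FL// sub0r big1 ?oppr0// => i _; rewrite second_dqE// (FL x Hx).
have -> : F (h *: E i + x) = 0 := vanish_translate i h1 HF Hx.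
have -> : F (- (h *: E i) + x) = 0.
  by rewrite -scaleNr; apply: (@vanish_translate L (- h) i F _ HF) => //; rewrite normrN.
by rewrite mulr0 subr0 addr0 mulr0.
Qed.

End finite_differences.

(** By the mean value theorem sin(x/2) >= (x/2) cos(x/2), so sin x >= x cos(x/2)^2 = x (1 + cos
    x)/2, and cos x >= 0 here. *)
Lemma sin_ge_half {R : realType} (x : R) : 0 <= x <= pi / 2 -> x / 2 <= sin x.
Proof.
move=> /andP[x0 x1]; have p0 := pi_gt0 R.
have [->|xn0] := eqVneq x 0; first by rewrite mul0r sin0.
have xp : 0 < x by rewrite lt_neqAle eq_sym xn0.
have y0 : 0 < x / 2 by rewrite divr_gt0.
have [|c] := @MVT R sin cos 0 (x / 2) y0 (fun x _ => is_derive_sin x).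
  by apply: (derive_within_itv (df := cos)) => y _; exact: is_derive_sin.
rewrite in_itv /= sin0 !subr0 => /andP[c0 c1] sE.
have cx : 0 <= cos x by apply: cos_ge0_pihalf; lra.
have cy0 : 0 <= cos (x / 2) by apply: cos_ge0_pihalf; lra.
have cc : cos (x / 2) <= cos c.
  by apply: ltW; rewrite ltr_cos// in_itv /=; apply/andP; split; lra.
have E1 : sin x = 2 * sin (x / 2) * cos (x / 2).
  by rewrite {1}[x]splitr sinD; ring.
have E2 : cos x = 2 * cos (x / 2) ^+ 2 - 1.
  by rewrite {1}[x]splitr cosD -!expr2 sin2cos2; ring.
rewrite E1 sE.
have h1 : cos (x / 2) * (x / 2) * cos (x / 2) <= cos c * (x / 2) * cos (x / 2).
  by rewrite ler_wpM2r// ler_wpM2r// ltW.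
have h2 : x / 2 <= x * cos (x / 2) ^+ 2.
  by apply: ler_wpM2l; [exact: ltW|lra].
rewrite expr2 in h2; lra.
Qed.

(** Valid on the whole period, not only near 0: this makes the discrete Laplacian comparable to
    |xi|^2 at all lattice frequencies. *)
Lemma cos_le_quad {R : realType} (y : R) : `|y| <= pi -> y ^+ 2 / 8 <= 1 - cos y.
Proof.
move=> yp; rewrite -cos_norm -(real_normK (num_real y)).
have h : `|y| / 2 / 2 <= sin (`|y| / 2).
  by apply: sin_ge_half; rewrite divr_ge0//=; lra.
have E2 : 1 - cos `|y| = 2 * sin (`|y| / 2) ^+ 2.
  by rewrite {1}[`|y|]splitr cosD -!expr2 cos2sin2; ring.
rewrite E2; have : (`|y| / 2 / 2) ^+ 2 <= sin (`|y| / 2) ^+ 2.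
  by rewrite lerXn2r ?nnegrE ?divr_ge0//; apply: le_trans h; rewrite !divr_ge0.
have -> : (`|y| / 2 / 2) ^+ 2 = `|y| ^+ 2 / 16 by field.
lra.
Qed.

(** * Discrete Fourier coefficients *)

Section coefficients.
Context {R : realType} {n : nat} (m : nat).
Hypothesis m_gt0 : (0 < m)%N.
Local Notation N := ((m ^ 2 + m ^ 2).+1)%N.
Local Notation lattice := {ffun 'I_n -> 'I_N}.
Local Notation E := (@space_frame R n).
Local Notation BkS := (Bk setT E).
Local Notation pt := (@pt R n m).
Local Notation freq := (@freq R n m).
Local Notation centered := (@centered R m).
Implicit Types (F G : 'rV[R]_n -> R) (i : 'I_n) (B L th : R) (k j : lattice).

Let mR_gt0 : 0 < m%:R :> R. Proof. by rewrite ltr0n. Qed.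
Let mR_neq0 : m%:R != 0 :> R. Proof. by rewrite gt_eqF. Qed.
Let mR_ge1 : 1 <= m%:R :> R. Proof. by rewrite ler1n. Qed.
Let h : R := m%:R^-1.
Let h_neq0 : h != 0. Proof. by rewrite invr_eq0. Qed.
Let h_gt0 : 0 < h. Proof. by rewrite invr_gt0. Qed.
Let h_le1 : h <= 1. Proof. by rewrite invf_le1. Qed.

Definition dot k (x : 'rV[R]_n) : R := \sum_(i < n) freq k i * x 0 i.

Lemma dotD k x y : dot k (x + y) = dot k x + dot k y.
Proof. by rewrite -big_split; apply: eq_bigr => i _; rewrite mxE mulrDr. Qed.

Lemma dotZE k (a : R) i : dot k (a *: E i) = a * freq k i.
Proof.
rewrite /dot (bigD1 i)//= !mxE !eqxx /= big1 ?addr0; first by rewrite mulr1 mulrC.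
by move=> l li; rewrite !mxE eqxx (negbTE li) /= !mulr0.
Qed.

(** The real part of exp(i th) times the complex Fourier coefficient. The phase replaces complex
    numbers: th = [dot k x] gives the k-th term of the interpolating polynomial at x, and adding
    pi/2 differentiates. *)
Definition coef k F th : R := N%:R ^- n * \sum_(j : lattice) F (pt j) * cos (th - dot k (pt j)).

Lemma coef_translate k F i th : vanish m%:R F ->
  coef k (fun x => F (h *: E i + x)) th = coef k F (th + h * freq k i).
Proof.
move=> VF; rewrite /coef; congr (_ * _).
rewrite -(lattice_shift m_gt0 (Z := fun x => F x * cos (th + h * freq k i - dot k x)) (i := i)).
  by apply: eq_bigr => j _; rewrite dotD dotZE opprD addrA addrK.
by move=> x mx; rewrite VF ?mul0r//; exists i.
Qed.

(** The forward case applied to the translated function, whose support is larger by h <= 1; hence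
    the margin in the hypothesis. *)
Lemma coef_translateN k F i th : vanish (m%:R - 1) F ->
  coef k (fun x => F (- (h *: E i) + x)) th = coef k F (th - h * freq k i).
Proof.
move=> VF; have V : vanish m%:R (fun x => F (- (h *: E i) + x)).
  have := @vanish_translate _ _ (m%:R - 1) (- h) i F _ VF.
  by rewrite scaleNr subrK; apply; rewrite normrN gtr0_norm.
have := coef_translate k i (th - h * freq k i) V; rewrite subrK => <-.
by congr coef; apply/funext => x; rewrite addKr.
Qed.

Definition symbol k i : R := 2 * m%:R ^+ 2 * (1 - cos (h * freq k i)).

(** Centring the indices keeps h [freq] within [- pi, pi], where the quadratic bound on 1 - cos
    holds. *)
Lemma symbol_ge k i : freq k i ^+ 2 / 4 <= symbol k i.
Proof.
have : `|h * freq k i| <= pi.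
  rewrite /h /freq mulrA mulrCA mulVf// mulr1 normrM normfV [`|N%:R|]ger0_norm//.
  rewrite ler_pdivrMr// normrM [`|2 * pi|]ger0_norm ?mulr_ge0 ?pi_ge0//.
  rewrite [2 * pi]mulrC -mulrA ler_wpM2l ?pi_ge0//.
  have : `|centered (k i)| <= (m ^ 2)%:R.
    rewrite /centered ler_norml lerBrDr addNr ler0n /= lerBlDr -natrD ler_nat.
    by rewrite -ltnS ltn_ord.
  have -> : N%:R = (m ^ 2)%:R + (m ^ 2)%:R + 1 :> R by rewrite -natrD natr1.
  by lra.
move=> /cos_le_quad H; rewrite /symbol.
have -> : freq k i ^+ 2 / 4 = 2 * m%:R ^+ 2 * ((h * freq k i) ^+ 2 / 8).
  by rewrite /h; field.
by rewrite ler_wpM2l// mulr_ge0// sqr_ge0.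
Qed.

Lemma coefD k F G th : coef k (fun x => F x + G x) th = coef k F th + coef k G th.
Proof.
rewrite /coef -mulrDr -big_split; congr (_ * _).
by apply: eq_bigr => j _; rewrite mulrDl.
Qed.

Lemma coefZ k F (c : R) th : coef k (fun x => c * F x) th = c * coef k F th.
Proof.
rewrite /coef [RHS]mulrCA [X in _ = _ * X]mulr_sumr; congr (_ * _).
by apply: eq_bigr => j _; rewrite mulrA.
Qed.

Lemma coef_bigsum k (r : seq 'I_n) (G : 'I_n -> 'rV[R]_n -> R) th :
  coef k (fun x => \sum_(i <- r) G i x) th = \sum_(i <- r) coef k (G i) th.
Proof.
elim: r => [|i r IH].
  by rewrite big_nil /coef big1 ?mulr0// => j _; rewrite big_nil mul0r.
by rewrite big_cons -IH -coefD; under eq_fun do rewrite big_cons.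
Qed.

Lemma coef_second_dq k F i th : vanish (m%:R - 1) F ->
  coef k (second_dq h i F) th = - symbol k i * coef k F th.
Proof.
move=> VF; have VF' : vanish m%:R F.
  by move=> x [a xa]; apply: VF; exists a; lra.
have -> : second_dq h i F = fun x => h ^- 2 *
    (F (h *: E i + x) + F (- (h *: E i) + x) + (- 2) * F x).
  by apply/funext => x; rewrite second_dqE// mulNr.
rewrite coefZ !coefD coefZ coef_translate// coef_translateN//.
have -> : coef k F (th + h * freq k i) + coef k F (th - h * freq k i) =
    2 * cos (h * freq k i) * coef k F th.
  rewrite /coef -mulrDr -big_split /= [RHS]mulrCA [X in _ = _ * X]mulr_sumr; congr (_ * _).
  apply: eq_bigr => j _; rewrite -mulrDr [RHS]mulrCA; congr (_ * _).
  rewrite [th + _ - _]addrAC [th - _ - _]addrAC.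
  by move: (th - dot _ _) => x; rewrite cosD cosB; ring.
by rewrite /symbol /h exprVn invrK; ring.
Qed.

Lemma coef_helmholtz k F th : vanish (m%:R - 1) F ->
  coef k (helmholtz h F) th = (1 + \sum_(i < n) symbol k i) * coef k F th.
Proof.
move=> VF; have -> : helmholtz h F = fun x => F x + -1 * \sum_(i < n) second_dq h i F x.
  by apply/funext => x; rewrite mulN1r.
rewrite coefD coefZ coef_bigsum mulrDl mul1r; congr (_ + _).
rewrite mulN1r mulr_suml -sumrN; apply: eq_bigr => i _.
by rewrite coef_second_dq// mulNr opprK.
Qed.

Definition freq_weight k : R := 1 + \sum_(i < n) freq k i ^+ 2.

Lemma freq_weight_ge1 k : 1 <= freq_weight k.
Proof. by rewrite lerDl sumr_ge0// => i _; rewrite sqr_ge0. Qed.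

Lemma freq_weight_le k : freq_weight k / 4 <= 1 + \sum_(i < n) symbol k i.
Proof.
rewrite /freq_weight mulrDl lerD//; first by lra.
by rewrite mulr_suml; apply: ler_sum => i _; exact: symbol_ge.
Qed.

(** Each application widens the support by at most 1, and it must stay inside the lattice for the
    shifts to be exact. *)
Lemma coef_iter r L F k th : vanish L F -> L + r%:R <= m%:R ->
  coef k (iter r (helmholtz h) F) th = (1 + \sum_(i < n) symbol k i) ^+ r * coef k F th.
Proof.
elim: r L F => [|r IH] L F VF Lr; first by rewrite mul1r.
rewrite iterSr (IH (L + 1)); last first.
- by move: Lr; rewrite -natr1; lra.
- by apply: vanish_helmholtz => //; rewrite gtr0_norm.
rewrite coef_helmholtz ?exprSr ?mulrA//.
move=> x [a xa]; apply: VF; exists a; apply: le_trans xa.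
by move: Lr; rewrite -natr1; have := ler0n R r; lra.
Qed.

(** Only points of the cube of half-side L contribute. They are counted by inserting the product of
    the (1 + L^2)/(1 + x_i^2), which is at least 1 there; dividing the resulting m^n by N^n >=
    m^(2n) leaves h^n. *)
Lemma coef_le B L F k th : 0 <= B -> 0 <= L -> (forall x, `|F x| <= B) -> vanish L F ->
  `|coef k F th| <= B * (8 * (1 + L ^+ 2)) ^+ n * h ^+ n.
Proof.
move=> B0 L0 FB VF; rewrite /coef normrM ger0_norm; last by rewrite invr_ge0 exprn_ge0.
have pos (x : R) : 0 < 1 + x ^+ 2 by rewrite ltr_pwDl// sqr_ge0.
have H : `|\sum_(j : lattice) F (pt j) * cos (th - dot k (pt j))| <=
  B * (1 + L ^+ 2) ^+ n * (8 * m%:R) ^+ n.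
  apply: le_trans (ler_norm_sum _ _ _) _.
  have K (j : lattice) : `|F (pt j) * cos (th - dot k (pt j))| <=
      B * (1 + L ^+ 2) ^+ n * \prod_(i < n) (1 + pt j 0 i ^+ 2)^-1.
    rewrite normrM; apply: (@le_trans _ _ `|F (pt j)|).
      by rewrite ler_piMr// cos_max.
    have [/existsP[i Hi]|] := boolP [exists i, L <= `|pt j 0 i|].
      rewrite VF ?normr0; last by exists i.
      apply: mulr_ge0; first by rewrite mulr_ge0// exprn_ge0// (ltW (pos _)).
      by apply: prodr_ge0 => a _; rewrite invr_ge0 (ltW (pos _)).
    rewrite negb_exists => /forallP H; apply: le_trans (FB _) _.
    rewrite -mulrA ler_peMr// -[X in _ ^+ X]card_ord -prodr_const -big_split /=.
    apply: (big_ind (fun x : R => 1 <= x)) => // [x y|i _]; first exact: mulr_ege1.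
    rewrite ler_pdivlMr// mul1r lerD2l.
    have := H i; rewrite -ltNge => /ltW Hi.
    by rewrite -(real_normK (num_real (pt j 0 i))) lerXn2r ?nnegrE.
  apply: le_trans (ler_sum _ (fun j _ => K j)) _.
  rewrite -mulr_sumr ler_wpM2l ?mulr_ge0 ?exprn_ge0 ?(ltW (pos _))//.
  exact: lattice_sum_le.
rewrite mulrC ler_pdivrMr ?exprn_gt0//; apply: le_trans H _.
have hN : m%:R <= h * N%:R by rewrite /h ler_pdivlMl// -expr2; exact: N_ge.
have K : (1 + L ^+ 2) * (8 * m%:R) <= 8 * (1 + L ^+ 2) * (h * N%:R).
  by rewrite mulrA [_ * 8]mulrC ler_wpM2l// mulr_ge0// (ltW (pos _)).
rewrite -[leLHS]mulrA -[leRHS]mulrA -[leRHS]mulrA -!exprMn ler_wpM2l//.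
by rewrite lerXn2r ?nnegrE ?mulr_ge0 ?(ltW (pos _)) ?(ltW h_gt0).
Qed.

(* Summation by parts, r times. *)
Lemma coef_decay r B L F k th : 0 <= B -> 0 <= L -> L + r%:R <= m%:R ->
  BkS B r.*2 F -> vanish L F ->
  `|coef k F th| * freq_weight k ^+ r <=
    4 ^+ r * ((1 + n%:R) ^+ r * B * (8 * (1 + (L + r%:R) ^+ 2)) ^+ n * h ^+ n).
Proof.
move=> B0 L0 Lr HF VF; set G := iter r (helmholtz h) F.
have HG : BkS ((1 + n%:R) ^+ r * B) 0 G.
  rewrite /G; elim: r B F B0 HF {Lr VF G} => [|r IH] B F B0 HF; first by rewrite mul1r.
  rewrite iterSr exprSr -mulrA; apply: IH; first by rewrite mulr_ge0// addr_ge0.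
  exact: Bk_helmholtz.
have VG : vanish (L + r%:R) G.
  rewrite /G; elim: r L F VF {L0 Lr HF G HG} => [|r IH] L F VF; first by rewrite addr0.
  rewrite iterSr -natr1 [r%:R + 1]addrC addrA; apply: IH.
  by apply: vanish_helmholtz => //; rewrite gtr0_norm.
have := @coef_le _ _ G k th _ _ (fun x => Bk0 HG I) VG.
rewrite (@coef_iter r L F k th VF Lr) normrM normrX => H.
have {}H := H (mulr_ge0 (exprn_ge0 _ (addr_ge0 ler01 (ler0n R n))) B0)
  (addr_ge0 L0 (ler0n R r)).
rewrite -ler_pdivrMl ?exprn_gt0//; apply: le_trans H.
rewrite mulrCA [leRHS]mulrC ler_wpM2l// -exprVn -exprMn.
have w0 := freq_weight_ge1 k; have w1 := freq_weight_le k.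
rewrite lerXn2r ?nnegrE//; first by rewrite mulr_ge0//; lra.
by apply: le_trans (ler_norm _); rewrite mulrC.
Qed.

(** [freq_weight] dominates each 1 + xi_i^2, so its n-th power dominates their product and the sum
    factorizes. This is why summability costs n powers. *)
Lemma freq_weight_sum_le : \sum_(k : lattice) freq_weight k ^- n <= (8 * m%:R) ^+ n.
Proof.
apply: le_trans (freq_sum_le n m_gt0); apply: ler_sum => k _.
rewrite -exprVn -[X in _ ^+ X]card_ord -prodr_const; apply: ler_prod => i _.
have w0 := freq_weight_ge1 k; rewrite invr_ge0 (le_trans ler01)//=.
have wp : 0 < freq_weight k := lt_le_trans ltr01 w0.
have fp : 0 < 1 + freq k i ^+ 2 by rewrite ltr_pwDl// sqr_ge0.
rewrite lef_pV2 ?posrE//.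
rewrite /freq_weight lerD2l (bigD1 i)//= lerDl sumr_ge0// => a _; exact: sqr_ge0.
Qed.

(** Of the p + n powers of decay, n are spent on summability. The h^n of the coefficients cancels
    the m^n of that sum, so the bound does not depend on m. *)
Lemma coef_sum_le p B L F (th : lattice -> R) : 0 <= B -> 0 <= L -> L + (p + n)%:R <= m%:R ->
  BkS B (p + n).*2 F -> vanish L F ->
  \sum_(k : lattice) freq_weight k ^+ p * `|coef k F (th k)| <=
  4 ^+ (p + n) * (1 + n%:R) ^+ (p + n) * (8 * (1 + (L + (p + n)%:R) ^+ 2)) ^+ n * 8 ^+ n * B.
Proof.
move=> B0 L0 Lr HF VF; set C := 4 ^+ _ * _ * _.
have K k : freq_weight k ^+ p * `|coef k F (th k)| <= C * B * h ^+ n * freq_weight k ^- n.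
  have w1 := freq_weight_ge1 k; have w0 : 0 < freq_weight k by apply: lt_le_trans w1.
  rewrite ler_pdivlMr ?exprn_gt0// mulrAC -exprD mulrC.
  apply: le_trans (coef_decay k (th k) B0 L0 Lr HF VF) _.
  by rewrite /C le_eqVlt; apply/orP; left; apply/eqP; ring.
apply: le_trans (ler_sum _ (fun k _ => K k)) _.
have C0 : 0 <= C by rewrite /C !mulr_ge0 ?exprn_ge0 ?mulr_ge0 ?addr_ge0 ?sqr_ge0.
rewrite -mulr_sumr; apply: le_trans (ler_wpM2l _ freq_weight_sum_le) _.
  by apply: mulr_ge0; [exact: mulr_ge0|apply: exprn_ge0; exact: ltW].
have e1 : h ^+ n * m%:R ^+ n = 1 by rewrite -exprMn /h mulVf// expr1n.
rewrite le_eqVlt; apply/orP; left; apply/eqP; rewrite exprMn.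
transitivity (C * 8 ^+ n * B * (h ^+ n * m%:R ^+ n)); first by ring.
by rewrite e1 mulr1.
Qed.

(** Discrete Fourier inversion: after exchanging the sums, orthogonality keeps only the term at
    j. *)
Lemma coef_interpolates F (j : lattice) :
  \sum_(k : lattice) coef k F (dot k (pt j)) = F (pt j).
Proof.
rewrite -mulr_sumr exchange_big /=.
transitivity (N%:R ^- n * (F (pt j) * N%:R ^+ n)); last first.
  by rewrite mulrC mulfK// expf_neq0// pnatr_eq0.
congr (_ * _); rewrite (bigD1 j)//= [X in _ + X]big1 ?addr0; last first.
  move=> j' j'j; rewrite -mulr_sumr.
  under eq_bigr do rewrite -sumrB.
  under eq_bigr do under eq_bigr do rewrite -mulrBr.
  by rewrite freq_orthogonal// eq_sym (negbTE j'j) mulr0.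
rewrite -mulr_sumr; congr (_ * _).
under eq_bigr do rewrite -sumrB.
under eq_bigr do under eq_bigr do rewrite -mulrBr.
by rewrite freq_orthogonal// eqxx.
Qed.

End coefficients.

(** * Functions on the future *)

Lemma within_proper {R : realType} {V : normedModType R} (D : set V) (v p : V) :
  (forall d : R, 0 < d -> exists2 h : R, 0 < `|h| < d & D (h *: v + p)) ->
  ProperFilter (within [set h : R | D (h *: v + p)] 0^').
Proof.
move=> H; apply: Build_ProperFilter_ex => P.
rewrite /within /= => /nbhs_ballP[d /= d0 Hd].
have [h /andP[h0 hd] Dh] := H d d0; exists h.
by apply: Hd => //; [rewrite /ball /= sub0r normrN|rewrite -normr_gt0].
Qed.

Lemma setT_proper {R : realType} {V : normedModType R} (I : Type) (e : I -> V) (p : V) i :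
  setT p -> ProperFilter (within [set h : R | setT (h *: e i + p)] 0^').
Proof.
by move=> _; apply: within_proper => d d0; exists (d / 2) => //; rewrite gtr0_norm; lra.
Qed.

Lemma wderive_quad {R : realType} {V : normedModType R} (D : set V) f (v p : V) (l C : R) :
  (forall h, `|h| <= 1 -> D (h *: v + p) -> `|f (h *: v + p) - f p - h * l| <= C * `|h| ^+ 2) ->
  wderive D f v p l.
Proof.
move=> H; apply/wderiveP => e e0.
have C1 : 0 < `|C| + 1 by rewrite ltr_wpDl.
exists (Num.min 1 (e / (`|C| + 1))); first by rewrite lt_min ltr01 divr_gt0.
move=> h; rewrite lt_min => /andP[/ltW h1 he] Dh; apply: le_trans (H h h1 Dh) _.
rewrite expr2 mulrA ler_wpM2r//; apply: (@le_trans _ _ ((`|C| + 1) * `|h|)).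
  by rewrite ler_wpM2r//; have := ler_norm C; lra.
by rewrite mulrC -ler_pdivlMr// ltW.
Qed.

Section future.
Context {R : realType} {n : nat}.
Local Notation spacetime := (R^o * 'rV[R]_n)%type.
Local Notation e := (@spacetime_frame R n).
Local Notation D := (@future R n).

Lemma frame_time (h : R) (t : R) (x : 'rV[R]_n) :
  h *: e None + (t, x) = (h + t, x) :> spacetime.
Proof. by congr pair; rewrite /= ?scaler0 ?add0r// /GRing.scale /= mulr1. Qed.

Lemma frame_space (h : R) i (t : R) (x : 'rV[R]_n) :
  h *: e (Some i) + (t, x) = (t, h *: space_frame i + x) :> spacetime.
Proof. by congr pair; rewrite /= scaler0 add0r. Qed.

Lemma future_proper (p : spacetime) a : D p ->
  ProperFilter (within [set h : R | D (h *: e a + p)] 0^').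
Proof.
case: p => t x t0; rewrite /future /= in t0; apply: within_proper => d d0.
exists (d / 2); first by rewrite gtr0_norm; lra.
by case: a => [i|]; rewrite ?frame_space ?frame_time /future /=; lra.
Qed.

(** F is controlled only along the axes, so x is changed into y one coordinate at a time. *)
Lemma coordinatewise_dist_le (F : 'rV[R]_n -> R) (K d : R) (x y : 'rV[R]_n) :
  (forall z i h, `|h| <= d -> `|F (h *: space_frame i + z) - F z| <= K) ->
  (forall i, `|y 0 i - x 0 i| <= d) -> `|F y - F x| <= n%:R * K.
Proof.
move=> H yx; pose path j : 'rV[R]_n := \row_i (if (i < j)%N then y 0 i else x 0 i).
have pathP j : (j <= n)%N -> `|F (path j) - F x| <= j%:R * K.
  elim: j => [|j IH] jn.
    have -> : path 0%N = x by apply/rowP => i; rewrite mxE.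
    by rewrite subrr normr0 mul0r.
  pose i := Ordinal jn.
  have E : path j.+1 = (y 0 i - x 0 i) *: space_frame i + path j.
    apply/rowP => a; rewrite !mxE eqxx /= ltnS leq_eqVlt.
    have [->|ai] := eqVneq a i; first by rewrite ltnn eqxx /= mulr1 subrK.
    rewrite mulr0 add0r; suff -> : (a == j :> nat) = false by [].
    by apply/negbTE; move: ai; apply: contraNneq => aj; apply/eqP/val_inj.
  rewrite -(subrKA (F (path j))) -natr1 mulrDl mul1r addrC.
  apply: le_trans (ler_normD _ _) _; apply: lerD; first exact: IH (ltnW jn).
  by rewrite E; exact: H.
have -> : y = path n by apply/rowP => i; rewrite mxE ltn_ord.
exact: pathP.
Qed.

(** The path moves in space at the new time and then in time, so it never leaves the future. *)
Lemma lipschitz_continuous (F : spacetime -> R) (K : R) : 0 <= K ->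
  (forall p a (h : R), D p -> `|h| <= 1 -> D (h *: e a + p) ->
    `|F (h *: e a + p) - F p| <= K * `|h|) ->
  {within D, continuous F}.
Proof.
move=> K0 H; apply/subspace_continuousP => -[t x] Dp; rewrite /future /= in Dp.
apply/cvgrPdist_le => eps eps0; rewrite /within /=.
(* K + 1 instead of K, because K may vanish and one divides by it; n + 1 counts the steps of the
   path. *)
have K1 : 0 < n.+1%:R * (K + 1) by rewrite mulr_gt0// ltr_wpDl.
pose d := Num.min 1 (eps / (n.+1%:R * (K + 1))).
have d0 : 0 < d by rewrite lt_min ltr01 divr_gt0.
apply/nbhs_ballP; exists d => //= -[s y] [/= st [_ xy]] Dq; rewrite /future /= in Dq.
have d1 : d <= 1 by rewrite ge_min lexx.
have de : d * (n.+1%:R * (K + 1)) <= eps.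
  by rewrite -ler_pdivlMr// ge_min lexx orbT.
have step (p : spacetime) a (h : R) : D p -> D (h *: e a + p) -> `|h| < d ->
    `|F (h *: e a + p) - F p| <= (K + 1) * d.
  move=> D1 D2 hd; apply: le_trans (H _ _ _ D1 _ D2) _.
    exact: le_trans (ltW hd) d1.
  by apply: ler_pM => //; [rewrite lerDl|exact: ltW].
have H1 : `|F (s, y) - F (s, x)| <= n%:R * ((K + 1) * d).
  apply: (@coordinatewise_dist_le (fun z => F (s, z)) _ d) => [z i h hd|i].
    rewrite -frame_space; apply: le_trans (H (s, z) (Some i) h Dq _ _) _.
    - exact: le_trans hd d1.
    - by rewrite frame_space.
    - by apply: ler_pM => //; rewrite lerDl.
  by have := xy 0 i; rewrite /ball /= distrC => /ltW.
have E0 : (s, x) = (s - t) *: e None + (t, x) :> spacetime by rewrite frame_time subrK.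
have H0 : `|F (s, x) - F (t, x)| <= (K + 1) * d.
  rewrite E0; apply: step => //; first by rewrite -E0.
  by move: st; rewrite /ball /= distrC.
rewrite distrC -(subrKA (F (s, x))); apply: le_trans (ler_normD _ _) _.
apply: le_trans (lerD H1 H0) _.
by apply: le_trans de; rewrite -natr1; lra.
Qed.

Lemma Ck_time k : Ck D e k (fun p : spacetime => p.1 : R).
Proof.
case: k => [|k].
  split=> //; apply: (@lipschitz_continuous _ 1) => // -[t x] a h _ _ _.
  by case: a => [i|]; rewrite ?frame_space ?frame_time /= ?subrr ?normr0 ?addrK mul1r.
split.
  apply: (@lipschitz_continuous _ 1) => // -[t x] a h _ _ _.
  by case: a => [i|]; rewrite ?frame_space ?frame_time /= ?subrr ?normr0 ?addrK mul1r.
move=> a; exists (fun=> if a is None then 1 else 0); split; last exact: Ck_cst.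
move=> [t x] _; apply: (@wderive_quad _ _ _ _ _ _ _ 0) => h _ _.
case: a => [i|]; rewrite ?frame_space ?frame_time /= mul0r.
  by rewrite subrr mulr0 subr0 normr0.
by rewrite addrK mulr1 subrr normr0.
Qed.

End future.

(** * Limits along an ultrafilter *)

Section ultralimit.
Context {R : realType} (U : set_system nat) {UF : UltraFilter U} (U_oo : \oo `<=` U).
Implicit Types (x : nat -> R) (l C : R).

(** The image of an ultrafilter is an ultrafilter, and it contains a compact segment. Thus every
    bounded sequence converges along the same [U], and no subsequences have to be extracted. *)
Lemma ultra_bounded_cvg x C : (\forall m \near \oo, `|x m| <= C) ->
  x @ U --> lim (x @ U).
Proof.
move=> xC; have := @segment_compact R (- C) C; rewrite compact_ultra.
have UX : UltraFilter (x @ U).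
  split; first exact: fmap_proper_filter.
  move=> G PG sUG; apply/seteqP; split=> // A GA.
  have [UA|UnA] := pselect (U (x @^-1` A)); first exact: UA.
  have UCA : U (x @^-1` (~` A)).
    have [//|nUCA] := pselect (U (x @^-1` (~` A))).
    (* If every member of U met the preimage of A, the traces would generate a proper filter finer
       than U and containing that preimage, against the maximality of U. *)
    have [B BU HB] : exists2 B, U B & ~ (B `&` (x @^-1` A) !=set0).
      apply: contrapT => H; apply: UnA.
      pose G' := filter_from U (fun B => B `&` (x @^-1` A)).
      have PG' : ProperFilter G'.
        apply: filter_from_proper.
          apply: filter_from_filter; first by exists setT; exact: filterT.
          move=> B B' UB UB'; exists (B `&` B'); first exact: filterI.
          by move=> z [[? ?] ?].
        by move=> B UB; apply: contrapT => K; apply: H; exists B.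
      have sUG' : U `<=` G' by move=> B UB; exists B => // z [].
      by rewrite -(max_filter PG' sUG'); exists setT; [exact: filterT|move=> z []].
    exfalso; apply: nUCA; apply: filterS BU => z Bz /= Az.
    by apply: HB; exists z.
  have : G (A `&` ~` A) by apply: filterI => //; exact: sUG.
  by rewrite setICr => /filter_not_empty.
move=> /(_ (x @ U) UX); case.
  apply: U_oo; apply: filterS xC => m; rewrite /= in_itv /= -ler_norml.
  by [].
by move=> l [_ /= xl]; apply/cvg_ex; exists l.
Qed.

Lemma ultra_lim_le x l C : x @ U --> l -> (\forall m \near \oo, `|x m| <= C) -> `|l| <= C.
Proof.
move=> xl xC; apply/ler_addgt0Pr => d d0.
have /cvgrPdist_le/(_ d d0) H := xl.
have [m [/= H1 H2]] := filter_ex (filterI H (U_oo xC)).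
rewrite -(subrK (x m) l); apply: le_trans (ler_normD _ _) _.
by rewrite addrC lerD.
Qed.

End ultralimit.

Lemma cvg_bigsum {R : realType} (U : set_system nat) {UF : Filter U} (I : Type) (r : seq I)
    (F : I -> nat -> R) (l : I -> R) :
  (forall i, F i @ U --> l i) ->
  (fun m => \sum_(i <- r) F i m) @ U --> \sum_(i <- r) l i.
Proof.
move=> H; elim: r => [|i r IH].
  by rewrite big_nil; under eq_fun do rewrite big_nil; exact: cvg_cst.
by rewrite big_cons; under eq_fun do rewrite big_cons; exact: cvgD.
Qed.

(** * Solutions with trigonometric data *)

Lemma is_derive_bigsum {R : realType} (I : Type) (r : seq I) (F : I -> R -> R)
    (dF : I -> R) (x : R) :
  (forall i, is_derive x (1 : R) (F i) (dF i)) ->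
  is_derive x (1 : R) (fun y => \sum_(i <- r) F i y) (\sum_(i <- r) dF i).
Proof.
move=> H; elim: r => [|i r IH].
  rewrite big_nil; have -> : (fun y => \sum_(i <- [::]) F i y) = cst 0.
    by apply/funext => y; rewrite big_nil.
  exact: is_derive_cst.
rewrite big_cons; have -> : (fun y => \sum_(i <- i :: r) F i y) =
  F i + (fun y => \sum_(i <- r) F i y).
  by apply/funext => y; rewrite big_cons.
exact: is_deriveD.
Qed.

Lemma mode_family {R : realType} (mu : R) : 1 <= 2 * mu ->
  forall a0 a1 : R, (a0, a1) = (1, 0) \/ (a0, a1) = (0, 1) ->
  exists a : bool -> R -> R -> R, forall lam : R, 0 <= lam ->
  [/\ a false lam 0 = a0, a true lam 0 = a1 & forall t : R, 0 <= t -> [/\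
    is_derive t (1 : R) (a false lam) (a true lam t),
    is_derive t (1 : R) (a true lam)
      (- mu * a true lam t - lam * expR (- t) * a false lam t) &
    forall tb, `|a tb lam t| <= 3 * (1 + lam)]].
Proof.
move=> mu1 a0 a1 H.
have E (lam : R) : exists ab : (R -> R) * (R -> R), 0 <= lam ->
  [/\ ab.1 0 = a0, ab.2 0 = a1 & forall t : R, 0 <= t -> [/\
    is_derive t (1 : R) ab.1 (ab.2 t),
    is_derive t (1 : R) ab.2 (- mu * ab.2 t - lam * expR (- t) * ab.1 t),
    `|ab.1 t| <= 3 * (1 + lam) & `|ab.2 t| <= 3 * (1 + lam)]].
  (* A dummy pair for negative lam, where nothing is claimed; it lets the choice range over all
     reals. *)
  have [lam0|lam0] := leP 0 lam; last by exists (id, id).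
  by have [a [b ab]] := mode_bound2 mu1 lam0 H; exists (a, b).
have [ab Hab] := choice E.
exists (fun tb lam => if tb then (ab lam).2 else (ab lam).1) => lam lam0.
have [H1 H2 H3] := Hab lam lam0; split=> // t t0; have [? ? ? ?] := H3 t t0.
by split=> // -[].
Qed.

Section approximation.
Context {R : realType} {n : nat} (mu L : R).
Context (f g : 'rV[R]_n -> R) (a b : bool -> R -> R -> R).
Hypothesis ha : forall lam : R, 0 <= lam ->
  [/\ a false lam 0 = 1, a true lam 0 = 0 & forall t : R, 0 <= t -> [/\
    is_derive t (1 : R) (a false lam) (a true lam t),
    is_derive t (1 : R) (a true lam)
      (- mu * a true lam t - lam * expR (- t) * a false lam t) &
    forall tb, `|a tb lam t| <= 3 * (1 + lam)]].
Hypothesis hb : forall lam : R, 0 <= lam ->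
  [/\ b false lam 0 = 0, b true lam 0 = 1 & forall t : R, 0 <= t -> [/\
    is_derive t (1 : R) (b false lam) (b true lam t),
    is_derive t (1 : R) (b true lam)
      (- mu * b true lam t - lam * expR (- t) * b false lam t) &
    forall tb, `|b tb lam t| <= 3 * (1 + lam)]].
Hypothesis L0 : 0 <= L.
Hypothesis Vf : vanish L f.
Hypothesis Vg : vanish L g.
Local Notation E := (@space_frame R n).
Local Notation BkS := (Bk setT E).
Implicit Types (s : seq 'I_n) (t : R) (x : 'rV[R]_n) (tb : bool) (m : nat).

Local Notation lattice m := {ffun 'I_n -> 'I_((m ^ 2 + m ^ 2).+1)%N}.

(** The symbol of the true Laplacian, unlike [symbol]: the approximations solve the differential
    equation itself, and the discrete operator only serves to prove decay. *)
Definition lap_symbol m (k : lattice m) : R := \sum_(i < n) freq k i ^+ 2.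

(** Each space derivative multiplies by a frequency and advances the phase by a quarter turn. *)
Definition phase m (k : lattice m) s x : R := dot k x + (size s)%:R * (pi / 2).

Definition mode m tb (k : lattice m) s t x : R := (\prod_(i <- s) freq k i) *
  (a tb (lap_symbol k) t * coef k f (phase k s x) + b tb (lap_symbol k) t * coef k g (phase k s x)).

(* For m -> oo, these trigonometric polynomials in x, which solve the linear
   equation exactly, and the derivatives of which are indexed by s and tb, tend
   to the solution with initial data f and g. *)
Definition approx m tb s t x : R := \sum_(k : lattice m) mode tb k s t x.

Lemma lap_symbol_ge0 m (k : lattice m) : 0 <= lap_symbol k.
Proof. by apply: sumr_ge0 => i _; exact: sqr_ge0. Qed.

Lemma is_derive_coef m (k : lattice m) F (th : R) :
  is_derive th (1 : R) (coef k F) (coef k F (th + pi / 2)).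
Proof.
have H (j : lattice m) : is_derive th (1 : R) (fun th => F (pt j) * cos (th - dot k (pt j)))
   (F (pt j) * cos (th + pi / 2 - dot k (pt j))).
  rewrite addrAC cosDpihalf mulrN.
  have d1 : is_derive th (1 : R) (fun th => th - dot k (pt j)) 1.
    have := is_deriveB (is_derive_id th (1 : R)) (is_derive_cst (dot k (pt j)) th (1 : R)).
    by rewrite subr0.
  have d2 := @is_derive1_comp _ cos (fun th => th - dot k (pt j)) th _ _
    (is_derive_cos _) d1.
  have d3 := is_deriveZ (F (pt j)) d2.
  by apply: (is_derive_eq d3); rewrite /GRing.scale /= mulr1 mulrN.
have S := is_derive_bigsum (index_enum (lattice m)) H.
by have d3 := is_deriveZ (((m ^ 2 + m ^ 2).+1)%:R ^- n : R) S; apply: (is_derive_eq d3).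
Qed.

Lemma coefDpi m (k : lattice m) F (th : R) : coef k F (th + pi) = - coef k F th.
Proof.
rewrite /coef -mulrN -sumrN; congr (_ * _); apply: eq_bigr => j _.
by rewrite -mulrN addrAC cosDpi.
Qed.

Lemma approx_dx m tb s i t x (c : R) :
  is_derive c (1 : R) (fun c => approx m tb s t (c *: E i + x))
    (approx m tb (i :: s) t (c *: E i + x)).
Proof.
apply: is_derive_bigsum => k; rewrite /mode.
have dph F : is_derive c (1 : R) (fun c => coef k F (phase k s (c *: E i + x)))
  (freq k i * coef k F (phase k (i :: s) (c *: E i + x))).
  have d1 : is_derive c (1 : R) (fun c => phase k s (c *: E i + x)) (freq k i).
    rewrite /phase; have -> : (fun c => dot k (c *: E i + x) + (size s)%:R * (pi / 2)) =
       (freq k i \*: id) + cst (dot k x + (size s)%:R * (pi / 2)) :> (R -> R).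
      apply/funext => y; rewrite dotD dotZE /= -addrA [y * _]mulrC.
      by [].
    have := is_deriveD (is_deriveZ (freq k i) (is_derive_id c (1 : R)))
      (is_derive_cst (dot k x + (size s)%:R * (pi / 2)) c (1 : R)).
    by rewrite /GRing.scale /= mulr1 addr0.
  have := @is_derive1_comp _ (coef k F) (fun c => phase k s (c *: E i + x)) c _ _
    (is_derive_coef k F _) d1.
  rewrite mulrC; suff -> : phase k s (c *: E i + x) + pi / 2 =
    phase k (i :: s) (c *: E i + x) by [].
  by rewrite /phase /= -[(size s).+1%:R]natr1 [in RHS]mulrDl mul1r addrA.
have H := is_deriveZ (\prod_(i <- s) freq k i) (is_deriveD
  (is_deriveZ (a tb (lap_symbol k) t) (dph f)) (is_deriveZ (b tb (lap_symbol k) t) (dph g))).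
apply: (is_derive_eq H); rewrite /GRing.scale /= big_cons; ring.
Qed.

Lemma mode_dt (A : R -> R) dA (B : R -> R) dB (c u v t : R) :
  is_derive t (1 : R) A dA -> is_derive t (1 : R) B dB ->
  is_derive t (1 : R) (fun t => c * (A t * u + B t * v)) (c * (dA * u + dB * v)).
Proof.
move=> HA HB.
have -> : (fun t => c * (A t * u + B t * v)) = (fun t => c * (u * A t + v * B t)).
  by apply/funext => y; ring.
have H := is_deriveZ c (is_deriveD (is_deriveZ u HA) (is_deriveZ v HB)).
by apply: (is_derive_eq H); rewrite /GRing.scale /= [u * _]mulrC [v * _]mulrC.
Qed.

Lemma approx_dt m s t x : 0 <= t ->
  is_derive t (1 : R) (fun t => approx m false s t x) (approx m true s t x).
Proof.
move=> t0; apply: is_derive_bigsum => k; rewrite /mode.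
have [_ _ /(_ t t0)[da _ _]] := ha (lap_symbol_ge0 k).
have [_ _ /(_ t t0)[db _ _]] := hb (lap_symbol_ge0 k).
exact: mode_dt.
Qed.

(** Two quarter turns amount to a change of sign. *)
Lemma mode_dxx m tb (k : lattice m) s t x :
  \sum_(i < n) mode tb k [:: i, i & s] t x = - lap_symbol k * mode tb k s t x.
Proof.
rewrite /lap_symbol mulNr mulr_suml -sumrN; apply: eq_bigr => i _; rewrite /mode !big_cons.
have -> : phase k [:: i, i & s] x = phase k s x + pi.
  by rewrite /phase /= -[(size s).+2%:R]natr1 -[(size s).+1%:R]natr1; field.
rewrite !coefDpi; ring.
Qed.

Lemma approx_dtt m s t x : 0 <= t ->
  is_derive t (1 : R) (fun t => approx m true s t x)
  (- mu * approx m true s t x + expR (- t) * \sum_(i < n) approx m false [:: i, i & s] t x).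
Proof.
move=> t0; rewrite /approx exchange_big /= !mulr_sumr -big_split /=.
apply: is_derive_bigsum => k; rewrite mode_dxx /mode.
have [_ _ /(_ t t0)[_ da _]] := ha (lap_symbol_ge0 k).
have [_ _ /(_ t t0)[_ db _]] := hb (lap_symbol_ge0 k).
apply: (is_derive_eq (mode_dt _ _ _ da db)); ring.
Qed.

(** The constant of [coef_sum_le] with p + 1 powers kept: p for the frequency factors of p
    derivatives, one for the growth 1 + lam of the modes. The 6 is the 3 of the mode bound times the
    two pieces of data. *)
Definition approx_bound (p : nat) : R :=
  6 * (4 ^+ (p.+1 + n) * (1 + n%:R) ^+ (p.+1 + n) *
    (8 * (1 + (L + (p.+1 + n)%:R) ^+ 2)) ^+ n * 8 ^+ n).

Lemma approx_bound_ge0 p : 0 <= approx_bound p.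
Proof.
by rewrite /approx_bound !mulr_ge0 ?exprn_ge0 ?mulr_ge0 ?addr_ge0 ?sqr_ge0.
Qed.

Lemma approx_le m tb s t x (B : R) : (0 < m)%N -> 0 <= B -> 0 <= t ->
  L + ((size s).+1 + n)%:R <= m%:R ->
  BkS B ((size s).+1 + n).*2 f -> BkS B ((size s).+1 + n).*2 g ->
  `|approx m tb s t x| <= approx_bound (size s) * B.
Proof.
move=> m0 B0 t0 Lm Hf Hg; apply: le_trans (ler_norm_sum _ _ _) _.
have K (k : lattice m) : `|mode tb k s t x| <= 3 *
    (freq_weight k ^+ (size s).+1 * `|coef k f (phase k s x)| +
     freq_weight k ^+ (size s).+1 * `|coef k g (phase k s x)|).
  have w1 : 1 <= freq_weight k :> R := freq_weight_ge1 k.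
  have w0 : 0 <= freq_weight k :> R by apply: le_trans w1.
  have [_ _ /(_ t t0)[_ _ /(_ tb) ba]] := ha (lap_symbol_ge0 k).
  have [_ _ /(_ t t0)[_ _ /(_ tb) bb]] := hb (lap_symbol_ge0 k).
  rewrite /mode normrM -mulrDr [leRHS]mulrCA exprSr -[leRHS]mulrA.
  apply: ler_pM => //.
    rewrite normr_prod.
    elim: (s) => [|i s' IH]; first by rewrite big_nil expr0.
    rewrite big_cons exprS; apply: ler_pM => //; first exact: prodr_ge0.
    have : `|freq k i| ^+ 2 <= freq_weight k - 1 :> R.
      rewrite (real_normK (num_real (freq k i))) /freq_weight addrAC subrr add0r (bigD1 i)//= lerDl.
      by apply: sumr_ge0 => l _; exact: sqr_ge0.
    have := sqr_ge0 (`|freq k i| - 1 : R); rewrite sqrrB expr1n mulr1.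
    have := sqr_ge0 (`|freq k i| : R); lra.
  apply: le_trans (ler_normD _ _) _; rewrite [`|a tb _ _ * _|]normrM [`|b tb _ _ * _|]normrM.
  rewrite [leRHS]mulrA [leRHS]mulrDr.
  by apply: lerD; apply: ler_wpM2r => //; rewrite mulrC.
apply: le_trans (ler_sum _ (fun k _ => K k)) _.
rewrite -mulr_sumr big_split /=.
have := coef_sum_le m0 (fun k => phase k s x) B0 L0 Lm Hf Vf.
have := coef_sum_le m0 (fun k => phase k s x) B0 L0 Lm Hg Vg.
rewrite /approx_bound -!mulrA; set Z := 4 ^+ _ * _; lra.
Qed.

Lemma approx_data m (j : lattice m) : (0 < m)%N ->
  approx m false [::] 0 (pt j) = f (pt j) /\ approx m true [::] 0 (pt j) = g (pt j).
Proof.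
move=> m0; split.
  rewrite -[RHS](coef_interpolates m0); apply: eq_bigr => k _.
  have [a0 _ _] := ha (lap_symbol_ge0 k); have [b0 _ _] := hb (lap_symbol_ge0 k).
  by rewrite /mode big_nil a0 b0 mul0r addr0 !mul1r /phase /= mul0r addr0.
rewrite -[RHS](coef_interpolates m0); apply: eq_bigr => k _.
have [_ a0 _] := ha (lap_symbol_ge0 k); have [_ b0 _] := hb (lap_symbol_ge0 k).
by rewrite /mode big_nil a0 b0 mul0r add0r !mul1r /phase /= mul0r addr0.
Qed.

End approximation.

(** * Existence for the linear equation *)

Lemma nearest_lattice {R : realType} (m : nat) (r : R) : (0 < m)%N -> `|r| <= m%:R ->
  exists l : 'I_((m ^ 2 + m ^ 2).+1)%N, `|r - centered l / m%:R| <= m%:R^-1.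
Proof.
move=> m0 rm; have mp : 0 < m%:R :> R by rewrite ltr0n.
have /andP[r1 r2] : - m%:R <= r <= m%:R by rewrite -ler_norml.
pose z := (r + m%:R) * m%:R.
have z0 : 0 <= z by apply: mulr_ge0; lra.
have /andP[z1 z2] := truncn_itv z0.
have lN : (Num.truncn z < (m ^ 2 + m ^ 2).+1)%N.
  rewrite ltnS -(ler_nat R); apply: le_trans z1 _.
  by rewrite natrD natrX /z expr2 -mulrDl; apply: ler_wpM2r; lra.
exists (Ordinal lN).
have -> : r - centered (Ordinal lN) / m%:R = (z - (Num.truncn z)%:R) / m%:R.
  by rewrite /centered /z /= natrX; field; rewrite gt_eqF.
rewrite normrM normfV (ger0_norm (ltW mp)) ler_pdivrMr// mulVf ?gt_eqF//.
rewrite ger0_norm ?subr_ge0//; move: z2; rewrite -[(Num.truncn z).+1%:R]natr1; lra.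
Qed.

Section existence.
Context {R : realType} {n : nat}.
Local Notation spacetime := (R^o * 'rV[R]_n)%type.
Local Notation e := (@spacetime_frame R n).
Local Notation D := (@future R n).
Local Notation E := (@space_frame R n).
Local Notation BkS := (Bk setT E).

(* [w tb s] is the derivative of the solution along s in space, and once more in
   time if tb. The bound does not depend on time and is linear in the data: this
   is what keeps 1 - w away from 0 when the data are small. *)
Lemma linear_existence (mu L : R) (f g : 'rV[R]_n -> R) : 1 <= 2 * mu -> 0 <= L ->
  vanish L f -> vanish L g ->
  (forall k, exists2 B, 0 <= B & BkS B k f /\ BkS B k g) ->
  exists w : bool -> seq 'I_n -> spacetime -> R,
  [/\ forall tb s k, Ck D e k (w tb s),
      forall tb s i p, D p -> wderive D (w tb s) (e (Some i)) p (w tb (i :: s) p),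
      forall s p, D p -> wderive D (w false s) (e None) p (w true s p),
      forall s p, D p -> wderive D (w true s) (e None) p
        (- mu * w true s p + expR (- p.1) * \sum_(i < n) w false [:: i, i & s] p)
    & [/\ forall x, w false [::] (0, x) = f x, forall x, w true [::] (0, x) = g x
        & forall B, 0 <= B -> BkS B (1 + n).*2 f -> BkS B (1 + n).*2 g ->
          forall p, D p -> `|w false [::] p| <= approx_bound (n := n) L 0 * B]].
Proof.
move=> mu1 L0 Vf Vg Bfg.
have [a ha] := mode_family mu1 (or_introl (erefl (1, 0))).
have [b hb] := mode_family mu1 (or_intror (erefl (0, 1))).
have [U [UU U_oo]] := ultraFilterLemma eventually_filter.
pose T m := @approx R n f g a b m.
pose w tb s (p : spacetime) := lim (T m tb s p.1 p.2 @[m --> U]).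
(* The threshold on m depends on s, since the lattice must contain the support widened once per
   summation by parts; the bound itself is uniform in t and x. *)
have Tle s : exists2 C, 0 <= C & \forall m \near \oo, forall tb t x, 0 <= t ->
    `|T m tb s t x| <= C.
  have [B B0 [Hf Hg]] := Bfg ((size s).+1 + n).*2.
  exists (approx_bound (n := n) L (size s) * B); first by rewrite mulr_ge0// approx_bound_ge0.
  near=> m => tb t x t0; apply: (approx_le ha hb) => //.
  - by near: m; exact: nbhs_infty_gt.
  - by near: m; exact: nbhs_infty_ger.
have cvT tb s (p : spacetime) : D p -> T m tb s p.1 p.2 @[m --> U] --> w tb s p.
  move=> Dp; have [C C0 HC] := Tle s.
  by apply: (ultra_bounded_cvg U_oo (C := C)); near=> m; apply: (near HC m).
have lapb s : exists2 C, 0 <= C & \forall m \near \oo, forall tb t x, 0 <= t ->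
    (forall i, `|T m tb [:: i, i & s] t x| <= C) /\
    `|\sum_(i < n) T m tb [:: i, i & s] t x| <= C.
  have /choice[C HC] : forall i : 'I_n, exists C, 0 <= C /\ \forall m \near \oo,
      forall tb t x, 0 <= t -> `|T m tb [:: i, i & s] t x| <= C.
    by move=> i; have [C C0 H] := Tle [:: i, i & s]; exists C.
  exists (\sum_i C i); first by apply: sumr_ge0 => i _; have [] := HC i.
  (* Finitely many directions, so the maximum of their thresholds serves all of them. *)
  have [N HN] : exists N, forall m, (N <= m)%N -> forall i tb t x, 0 <= t ->
      `|T m tb [:: i, i & s] t x| <= C i.
    have /choice[N HN] : forall i : 'I_n, exists N, forall m, (N <= m)%N ->
        forall tb t x, 0 <= t -> `|T m tb [:: i, i & s] t x| <= C i.
      by move=> i; have [_ [N _ HN]] := HC i; exists N => m Nm; exact: HN.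
    exists (\max_i N i) => m Nm i; apply: HN; apply: leq_trans Nm.
    exact: (leq_bigmax i).
  exists N => // m Nm tb t x t0; split=> [i|].
    apply: le_trans (HN m Nm i tb t x t0) _.
    by rewrite (bigD1 i)//= lerDl sumr_ge0// => l _; have [] := HC l.
  by apply: le_trans (ler_norm_sum _ _ _) _; apply: ler_sum => i _; exact: HN.
have cvq (X Y Z : nat -> R) (x y z h : R) : X @ U --> x -> Y @ U --> y -> Z @ U --> z ->
    (fun m => X m - Y m - h * Z m) @ U --> x - y - h * z.
  by move=> Xx Yy Zz; exact: cvgB (cvgB Xx Yy) (cvgM (cvg_cst h) Zz).
(* Taylor remainders bounded uniformly in m pass to the pointwise limit; this shows that the limit
   of the derivatives is the derivative of the limit. *)
have quadx s : exists2 C, 0 <= C & forall tb i (p : spacetime) (h : R), D p ->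
    `|w tb s (h *: e (Some i) + p) - w tb s p - h * w tb (i :: s) p| <= C * `|h| ^+ 2.
  have [C C0 HC] := lapb s; exists C => // tb i [t x] h Dp.
  have Dq : D (h *: e (Some i) + (t, x)) by rewrite frame_space.
  apply: (ultra_lim_le U_oo (cvq _ _ _ _ _ _ h (cvT tb s _ Dq) (cvT tb s _ Dp)
    (cvT tb (i :: s) _ Dp))).
  near=> m; rewrite frame_space /=.
  have := @taylor1_le _ (fun c => T m tb s t (c *: E i + x))
    (fun c => T m tb (i :: s) t (c *: E i + x))
    (fun c => T m tb [:: i, i & s] t (c *: E i + x)) 0 h C.
  rewrite scale0r add0r !subr0; apply=> c _; try exact: approx_dx.
  by have /(_ tb t (c *: E i + x) Dp)[/(_ i)] : forall tb t x, 0 <= t ->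
    (forall i, `|T m tb [:: i, i & s] t x| <= C) /\
    `|\sum_(i < n) T m tb [:: i, i & s] t x| <= C by near: m.
have expN1 (t : R) : 0 <= t -> `|expR (- t)| <= 1.
  by move=> t0; rewrite ger0_norm ?expR_ge0// -[leRHS]expR0 ler_expR oppr_le0.
have quadt s : exists2 C, 0 <= C & forall (p : spacetime) (h : R), D p ->
    D (h *: e None + p) ->
    `|w false s (h *: e None + p) - w false s p - h * w true s p| <= C * `|h| ^+ 2.
  have [C C0 HC] := lapb s; have [C' C'0 HC'] := Tle s.
  exists (`|mu| * C' + C); first by rewrite addr_ge0// mulr_ge0.
  move=> [t x] h Dp Dq.
  apply: (ultra_lim_le U_oo (cvq _ _ _ _ _ _ h (cvT false s _ Dq) (cvT false s _ Dp)
    (cvT true s _ Dp))).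
  rewrite frame_time /future /= in Dq; rewrite /future /= in Dp.
  have min0 c : Num.min t (h + t) <= c <= Num.max t (h + t) -> 0 <= c.
    by move=> /andP[+ _]; apply: le_trans; rewrite le_min Dp.
  near=> m; rewrite frame_time /=.
  have := @taylor1_le _ (fun c => T m false s c x) (fun c => T m true s c x)
    (fun c => - mu * T m true s c x + expR (- c) * \sum_(i < n) T m false [:: i, i & s] c x)
    t (h + t) (`|mu| * C' + C).
  rewrite addrK; apply=> c /min0 c0.
  - exact: (approx_dt f g ha hb).
  - exact: (approx_dtt f g ha hb).
  have H1 : `|T m true s c x| <= C'.
    have H : forall tb t x, 0 <= t -> `|T m tb s t x| <= C' by near: m.
    exact: H.
  have H2 : `|\sum_(i < n) T m false [:: i, i & s] c x| <= C.
    by have /(_ false c x c0)[] : forall tb t x, 0 <= t ->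
    (forall i, `|T m tb [:: i, i & s] t x| <= C) /\
    `|\sum_(i < n) T m tb [:: i, i & s] t x| <= C by near: m.
  apply: le_trans (ler_normD _ _) _; rewrite !normrM normrN.
  apply: lerD; first by rewrite ler_wpM2l.
  by rewrite -[C]mul1r ler_pM// expN1.
have quadtt s : exists2 C, 0 <= C & forall (p : spacetime) (h : R), D p ->
    D (h *: e None + p) ->
    `|w true s (h *: e None + p) - w true s p - h * (- mu * w true s p +
       expR (- p.1) * \sum_(i < n) w false [:: i, i & s] p)| <= C * `|h| ^+ 2.
  have [C C0 HC] := lapb s; have [C' C'0 HC'] := Tle s.
  (* A bound for the third time derivative: the equation bounds w_tt by |mu| C' + C, and the product
     rule for exp(-t) times the Laplacian gives two terms bounded by C. *)
  exists (`|mu| * (`|mu| * C' + C) + (C + C)).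
    by rewrite !addr_ge0// mulr_ge0// addr_ge0// mulr_ge0.
  move=> [t x] h Dp Dq.
  have cvS : (fun m => \sum_(i < n) T m false [:: i, i & s] t x) @ U -->
      \sum_(i < n) w false [:: i, i & s] (t, x).
    by apply: cvg_bigsum => i; exact: (cvT false [:: i, i & s] (t, x)).
  have cvZ : (fun m => - mu * T m true s t x +
      expR (- t) * \sum_(i < n) T m false [:: i, i & s] t x) @ U -->
      - mu * w true s (t, x) + expR (- t) * \sum_(i < n) w false [:: i, i & s] (t, x).
    exact: cvgD (cvgM (cvg_cst _) (cvT true s _ Dp)) (cvgM (cvg_cst _) cvS).
  apply: (ultra_lim_le U_oo (cvq _ _ _ _ _ _ h (cvT true s _ Dq) (cvT true s _ Dp) cvZ)).
  rewrite frame_time /future /= in Dq; rewrite /future /= in Dp.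
  have min0 c : Num.min t (h + t) <= c <= Num.max t (h + t) -> 0 <= c.
    by move=> /andP[+ _]; apply: le_trans; rewrite le_min Dp.
  near=> m; rewrite frame_time /=.
  have HC1 : forall tb t x, 0 <= t -> `|T m tb s t x| <= C' by near: m.
  have HC2 : forall tb t x, 0 <= t ->
    (forall i, `|T m tb [:: i, i & s] t x| <= C) /\
    `|\sum_(i < n) T m tb [:: i, i & s] t x| <= C by near: m.
  pose S tb c := \sum_(i < n) T m tb [:: i, i & s] c x.
  pose F1 c := - mu * T m true s c x + expR (- c) * S false c.
  have := @taylor1_le _ (fun c => T m true s c x) F1
    (fun c => - mu * F1 c + (expR (- c) * S true c + S false c * - expR (- c)))
    t (h + t) (`|mu| * (`|mu| * C' + C) + (C + C)).
  have dS (c : R) : 0 <= c -> is_derive c (1 : R) (S false) (S true c).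
    by move=> c0; apply: is_derive_bigsum => i; exact: (approx_dt f g ha hb).
  rewrite addrK; apply=> c /min0 c0.
  - exact: (approx_dtt f g ha hb).
  - have d1 : is_derive c (1 : R) (fun c => T m true s c x) (F1 c).
      exact: (approx_dtt f g ha hb).
    exact: (is_deriveD (is_deriveZ (- mu) d1) (is_deriveM (is_derive_expRN c) (dS c c0))).
  have [_ H2] := HC2 false c x c0; have [_ H3] := HC2 true c x c0.
  have e1 := expN1 c c0.
  have HF : `|F1 c| <= `|mu| * C' + C.
    rewrite /F1; apply: le_trans (ler_normD _ _) _; rewrite !normrM normrN.
    apply: lerD; first by rewrite ler_wpM2l// HC1.
    by rewrite -[C]mul1r ler_pM.
  apply: le_trans (ler_normD _ _) _; apply: lerD.
    by rewrite normrM normrN ler_wpM2l.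
  apply: le_trans (ler_normD _ _) _; apply: lerD.
    by rewrite normrM -[C]mul1r ler_pM.
  by rewrite normrM normrN -[C]mulr1 ler_pM.
have wle tb s : exists2 C, 0 <= C & forall p, D p -> `|w tb s p| <= C.
  have [C C0 HC] := Tle s; exists C => // p Dp.
  apply: (ultra_lim_le U_oo (cvT tb s p Dp)).
  have : \forall m \near \oo, forall tb t x, 0 <= t -> `|T m tb s t x| <= C by [].
  by apply: filterS => m; apply.
have hx tb s i p : D p -> wderive D (w tb s) (e (Some i)) p (w tb (i :: s) p).
  by move=> Dp; have [C _ HC] := quadx s; apply: (@wderive_quad _ _ _ _ _ _ _ C) => h _ _; exact: HC.
have ht s p : D p -> wderive D (w false s) (e None) p (w true s p).
  move=> Dp; have [C _ HC] := quadt s.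
  by apply: (@wderive_quad _ _ _ _ _ _ _ C) => h _ Dh; exact: HC.
have htt s p : D p -> wderive D (w true s) (e None) p
    (- mu * w true s p + expR (- p.1) * \sum_(i < n) w false [:: i, i & s] p).
  move=> Dp; have [C _ HC] := quadtt s.
  by apply: (@wderive_quad _ _ _ _ _ _ _ C) => h _ Dh; exact: HC.
(* For |h| <= 1 a quadratic remainder is at most linear, so with a bounded derivative it gives a
   Lipschitz bound. *)
have quad_lip (F G : spacetime -> R) a0 (C C' : R) (p : spacetime) (h : R) :
    0 <= C -> `|h| <= 1 -> `|G p| <= C' ->
    `|F (h *: e a0 + p) - F p - h * G p| <= C * `|h| ^+ 2 ->
    `|F (h *: e a0 + p) - F p| <= (C + C') * `|h|.
  move=> C0 h1 Gp H; rewrite -[X in `|X|](subrK (h * G p)).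
  apply: le_trans (ler_normD _ _) _; rewrite mulrDl; apply: lerD.
    by apply: le_trans H _; rewrite expr2 mulrA ler_piMr// mulr_ge0.
  by rewrite normrM mulrC ler_wpM2r.
have cw tb s : {within D, continuous (w tb s)}.
  have [C1 C10 H1] := quadx s.
  have [C2 C20 H2] : exists2 C, 0 <= C & forall (p : spacetime) (h : R), D p ->
     `|h| <= 1 -> D (h *: e None + p) ->
     `|w tb s (h *: e None + p) - w tb s p| <= C * `|h|.
    case: tb; last first.
      have [C C0 H] := quadt s; have [C' C'0 H'] := wle true s.
      exists (C + C') => [|p h Dp h1 Dh]; first exact: addr_ge0.
      by apply: (quad_lip _ (w true s)) => //; [exact: H'|exact: H].
    have [C C0 H] := quadtt s; have [C' C'0 H'] := wle true s.
    have /choice[C'' HC''] : forall i : 'I_n, exists C, 0 <= C /\ forall p, D p ->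
        `|w false [:: i, i & s] p| <= C.
      by move=> i; have [B B0 HB] := wle false [:: i, i & s]; exists B.
    have S0 : 0 <= \sum_i C'' i by apply: sumr_ge0 => i _; have [] := HC'' i.
    exists (C + (`|mu| * C' + \sum_i C'' i)) => [|p h Dp h1 Dh].
      by rewrite !addr_ge0// mulr_ge0.
    apply: (quad_lip _ (fun p => - mu * w true s p +
       expR (- p.1) * \sum_(i < n) w false [:: i, i & s] p)) => //; last exact: H.
    apply: le_trans (ler_normD _ _) _; rewrite !normrM normrN; apply: lerD.
      by rewrite ler_wpM2l// H'.
    rewrite -[leRHS]mul1r ler_pM ?expN1//.
    apply: le_trans (ler_norm_sum _ _ _) _; apply: ler_sum => i _.
    by have [_] := HC'' i; apply.
  have /choice[C3 HC3] : forall i : 'I_n, exists C, 0 <= C /\ forall p, D p ->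
      `|w tb (i :: s) p| <= C.
    by move=> i; have [B B0 HB] := wle tb (i :: s); exists B.
  have S0 : 0 <= \sum_i C3 i by apply: sumr_ge0 => i _; have [] := HC3 i.
  apply: (@lipschitz_continuous _ _ _ (C2 + (C1 + \sum_i C3 i))).
    by rewrite !addr_ge0.
  move=> p [i|] h Dp h1 Dh; last first.
    by apply: le_trans (H2 p h Dp h1 Dh) _; rewrite ler_wpM2r// lerDl addr_ge0.
  apply: (@le_trans _ _ ((C1 + C3 i) * `|h|)).
    apply: (quad_lip _ (w tb (i :: s))) => //; last exact: H1.
    by have [_] := HC3 i; apply.
  rewrite ler_wpM2r// -[leLHS]add0r lerD// lerD2l (bigD1 i)//= lerDl.
  by apply: sumr_ge0 => l _; have [] := HC3 l.
(* The family is closed under differentiation up to smooth coefficients: the equation trades a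
   second time derivative for one time derivative and two space derivatives. *)
have Cw tb s k : Ck D e k (w tb s).
  elim: k tb s => [|k IH] tb s; split=> //; try exact: cw.
  case=> [i|]; first by exists (w tb (i :: s)); split=> [p Dp|]; [exact: hx|exact: IH].
  case: tb; last by exists (w true s); split=> [p Dp|]; [exact: ht|exact: IH].
  exists (fun p => - mu * w true s p + expR (- p.1) * \sum_(i < n) w false [:: i, i & s] p).
  split; first by move=> p Dp; exact: htt.
  apply: CkD; first by apply: CkZ; exact: IH.
  apply: CkM; first by apply: Ck_exp; apply: CkN; exact: Ck_time.
  by apply: Ck_sum => i; exact: IH.
have data tb F : (forall k, exists2 B, 0 <= B & BkS B k F) ->
    (forall m (j : {ffun 'I_n -> 'I_((m ^ 2 + m ^ 2).+1)%N}), (0 < m)%N ->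
      T m tb [::] 0 (pt j) = F (pt j)) ->
    forall x, w tb [::] (0, x) = F x.
  move=> BF TF x; have [B B0 HB] := BF 1%N.
  have [C C0 [N HN]] : exists2 C, 0 <= C & exists N, forall m, (N <= m)%N -> forall i x,
      `|T m tb [:: i] 0 x| <= C.
    have /choice[C HC] : forall i : 'I_n, exists C, 0 <= C /\ \forall m \near \oo,
        forall tb t x, 0 <= t -> `|T m tb [:: i] t x| <= C.
      by move=> i; have [C C0 H] := Tle [:: i]; exists C.
    have /choice[N HN] : forall i : 'I_n, exists N, forall m, (N <= m)%N ->
        forall x, `|T m tb [:: i] 0 x| <= C i.
      move=> i; have [_ [N _ HN]] := HC i; exists N => m Nm y.
      by apply: (HN m Nm).
    exists (\sum_i C i); first by apply: sumr_ge0 => i _; have [] := HC i.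
    exists (\max_i N i) => m Nm i y; apply: (@le_trans _ _ (C i)).
      by apply: HN; apply: leq_trans Nm; exact: (leq_bigmax i).
    by rewrite (bigD1 i)//= lerDl sumr_ge0// => l _; have [] := HC l.
  (* The approximations match the data only at lattice points. One lies within 1/m of x in each
     coordinate, and both functions are Lipschitz with constants independent of m. *)
  have Tx : T m tb [::] 0 x @[m --> \oo] --> F x.
    apply/cvgrPdist_le => eps eps0; near=> m.
    have m0 : (0 < m)%N by near: m; exact: nbhs_infty_gt.
    have mp : 0 < m%:R :> R by rewrite ltr0n.
    have Nm : (N <= m)%N by near: m; exact: nbhs_infty_ge.
    have xm : \sum_i `|x 0 i| <= m%:R by near: m; exact: nbhs_infty_ger.
    have em : n%:R * (C + B) / eps <= m%:R by near: m; exact: nbhs_infty_ger.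
    have /choice[l Hl] : forall i, exists l : 'I_((m ^ 2 + m ^ 2).+1)%N,
        `|x 0 i - centered l / m%:R| <= m%:R^-1.
      move=> i; apply: nearest_lattice => //; apply: le_trans xm.
      by rewrite (bigD1 i)//= lerDl sumr_ge0.
    pose j := [ffun i => l i].
    have xj i : `|x 0 i - pt j 0 i| <= m%:R^-1 by rewrite mxE ffunE.
    have H1 : `|F x - F (pt j)| <= n%:R * (B * m%:R^-1).
      apply: (coordinatewise_dist_le _ xj) => z i h hm.
      by apply: le_trans (Bk_dist_le i h z HB) _; rewrite ler_wpM2l.
    have H2 : `|T m tb [::] 0 x - T m tb [::] 0 (pt j)| <= n%:R * (C * m%:R^-1).
      apply: (coordinatewise_dist_le _ xj) => z i h hm.
      have := @derive_dist_le _ (fun c => T m tb [::] 0 (c *: E i + z))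
        (fun c => T m tb [:: i] 0 (c *: E i + z)) 0 h C.
      rewrite scale0r add0r subr0 => H; apply: (@le_trans _ _ (C * `|h|)).
        by apply: H => c _; [exact: approx_dx|exact: HN].
      by rewrite ler_wpM2l.
    rewrite -(subrKA (F (pt j))) -[F (pt j) - _]opprB -{2}TF//.
    apply: le_trans (ler_normB _ _) _; apply: le_trans (lerD H1 H2) _.
    rewrite -mulrDr -mulrDl mulrA ler_pdivrMr//.
    by move: em; rewrite ler_pdivrMr// [C + B]addrC [m%:R * eps]mulrC.
  have Tu := cvg_trans (cvg_app _ U_oo) Tx.
  have D0 : D (0, x) by rewrite /future /=.
  exact: (cvg_unique _ (cvT tb [::] (0, x) D0) Tu).
exists w; split=> //; split.
- apply: data => [k|m j m0]; last by have [] := approx_data f g ha hb j m0.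
  by have [B B0 [Hf Hg]] := Bfg k; exists B.
- apply: data => [k|m j m0]; last by have [] := approx_data f g ha hb j m0.
  by have [B B0 [Hf Hg]] := Bfg k; exists B.
move=> B B0 Hf Hg p Dp; apply: (ultra_lim_le U_oo (cvT false [::] p Dp)).
near=> m; apply: (approx_le ha hb) => //.
- by near: m; exact: nbhs_infty_gt.
- by near: m; exact: nbhs_infty_ger.
Unshelve. all: by end_near.
Qed.

End existence.

(** * The discrete energy in a light cone *)

Section cone_weight.
Context {R : realType}.
Implicit Types a b : R.

Definition pos_part a : R := Num.max 0 a.

Lemma pos_part_ge0 a : 0 <= pos_part a. Proof. by rewrite le_max lexx. Qed.

(** The positive part has a corner at 0, while its square has a quadratic Taylor remainder
    everywhere; this is why the weight of the energy is a square. *)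
Lemma pos_part_sqr_quad a b :
  `|pos_part a ^+ 2 - pos_part b ^+ 2 - 2 * pos_part b * (a - b)| <= (a - b) ^+ 2.
Proof.
rewrite /pos_part; have [a0|a0] := leP a 0; have [b0|b0] := leP b 0.
- by rewrite expr0n /= subrr mulr0 mul0r subr0 normr0 sqr_ge0.
- have ab : 0 <= b * - a by rewrite mulr_ge0; lra.
  have := sqr_ge0 a; have := sqr_ge0 b; rewrite ler_norml !expr2 => ? ?; lra.
- have ab : 0 <= a * - b by rewrite mulr_ge0; lra.
  have := sqr_ge0 a; have := sqr_ge0 b; rewrite ler_norml !expr2 => ? ?; lra.
- have -> : a ^+ 2 - b ^+ 2 - 2 * b * (a - b) = (a - b) ^+ 2 by ring.
  by rewrite ger0_norm ?sqr_ge0.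
Qed.

Lemma is_derive_pos_part_sqr a : is_derive a (1 : R) (fun x => pos_part x ^+ 2) (2 * pos_part a).
Proof.
have H : wderive setT (fun x => pos_part x ^+ 2) (1 : R) (a *: (1 : R) + 0) (2 * pos_part a).
  rewrite addr0 /GRing.scale /= mulr1; apply: (@wderive_quad _ _ _ _ _ _ _ 1) => h _ _.
  rewrite /GRing.scale /= mulr1 mul1r (real_normK (num_real h)).
  have := pos_part_sqr_quad (h + a) a; rewrite addrK; congr (`|_ - _| <= _); ring.
have := is_derive_wderive _ H; rewrite addr0.
have -> : (fun s : R => pos_part (s *: (1 : R) + 0) ^+ 2) = (fun x => pos_part x ^+ 2).
  by apply/funext => s; rewrite addr0 /GRing.scale /= mulr1.
by apply; exists 1.
Qed.

End cone_weight.

Section energy.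
Context {R : realType} {n : nat} (m : nat) (mu z B : R).
(** The weight vanishes where some |y_i| >= 3, and a shift by h <= 1 then stays within 4 <= m: the
    wrap-around of the lattice is never felt. *)
Hypothesis m_ge4 : (4 <= m)%N.
Local Notation N := ((m ^ 2 + m ^ 2).+1)%N.
Local Notation lattice := {ffun 'I_n -> 'I_N}.
Local Notation E := (@space_frame R n).
Let h : R := m%:R^-1.
Let r : R := 1 + 2 * z.
Context (V P : 'rV[R]_n -> R) (Vxx : 'I_n -> 'rV[R]_n -> R).
Implicit Types (y : 'rV[R]_n) (i : 'I_n).

(* The support |y| <= r of the weight shrinks at the coordinate speed z = exp(-t/2)
   of light. Using difference quotients in the energy, rather than derivatives,
   avoids the symmetry of mixed derivatives. *)
Definition dist2 y : R := r ^+ 2 - \sum_(i < n) y 0 i ^+ 2.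

Definition weight y : R := pos_part (dist2 y) ^+ 2.

Definition cube (L : R) y := forall i, `|y 0 i| <= L.

Hypothesis mu0 : 0 <= mu.
Hypothesis z01 : 0 <= z <= 1.
Hypothesis B0 : 0 <= B.
Local Notation d i y := (dq h i V y).
Hypothesis HP : forall y, cube 4 y -> `|P y| <= B.
Hypothesis Hd : forall i y, cube 4 y -> `|d i y| <= B.
Hypothesis Hdd : forall i y, cube 4 y -> `|d i y - d i (- (h *: E i) + y)| <= B * h.
Hypothesis HVxx : forall i y, cube 4 y ->
  `|Vxx i y - m%:R * (d i y - d i (- (h *: E i) + y))| <= B * h.

Let m_gt0 : (0 < m)%N. Proof. by apply: leq_trans m_ge4. Qed.
Let mR_gt0 : 0 < m%:R :> R. Proof. by rewrite ltr0n. Qed.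
Let h_gt0 : 0 < h. Proof. by rewrite invr_gt0. Qed.
Let h_le1 : h <= 1. Proof. by rewrite invf_le1// ler1n. Qed.
Let mh : m%:R * h = 1. Proof. by rewrite mulfV// gt_eqF. Qed.

Lemma dist2_le y i : dist2 y <= 9 - y 0 i ^+ 2.
Proof.
rewrite /dist2 (bigD1 i)//= opprD addrA.
have : 0 <= \sum_(a < n | a != i) y 0 a ^+ 2 by apply: sumr_ge0 => a _; exact: sqr_ge0.
have : r ^+ 2 <= 9 by rewrite /r expr2; case/andP: z01 => ? ?; nra.
lra.
Qed.

Lemma pos_part_dist2_le9 y : pos_part (dist2 y) <= 9.
Proof.
rewrite ge_max; apply/andP; split; first by [].
rewrite /dist2; have : 0 <= \sum_(a < n) y 0 a ^+ 2 by apply: sumr_ge0 => a _; exact: sqr_ge0.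
have : r ^+ 2 <= 9 by rewrite /r expr2; case/andP: z01 => ? ?; nra.
lra.
Qed.

Lemma weight_outside y i : 3 <= `|y 0 i| -> pos_part (dist2 y) = 0.
Proof.
move=> y3; apply/max_l; apply: le_trans (dist2_le y i) _.
rewrite -(real_normK (num_real (y 0 i))) expr2; nra.
Qed.

Lemma dist2_translate i y : dist2 (- (h *: E i) + y) = dist2 y + (2 * h * y 0 i - h ^+ 2).
Proof.
rewrite /dist2 -addrA; congr (_ + _).
rewrite (bigD1 i)//= [X in _ = - X + _](bigD1 i)//= !mxE !eqxx /=.
rewrite (eq_bigr (fun a => y 0 a ^+ 2)).
  rewrite mulr1; ring.
by move=> a ai; rewrite !mxE eqxx (negbTE ai) /= mulr0 oppr0 add0r.
Qed.

(** The backward difference approximates minus the gradient, 4 y_i [pos_part]. The error is 18 h +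
    81 h: the positive part is at most 9, and |2 y_i - h| <= 9 on the cube. *)
Lemma weight_dq i y : cube 4 y ->
  `|m%:R * (weight (- (h *: E i) + y) - weight y) - 4 * y 0 i * pos_part (dist2 y)| <= 99 * h.
Proof.
move=> y4; have yi := y4 i.
have H := pos_part_sqr_quad (dist2 (- (h *: E i) + y)) (dist2 y).
have E1 : dist2 (- (h *: E i) + y) - dist2 y = h * (2 * y 0 i - h).
  by rewrite dist2_translate addrAC subrr add0r; ring.
rewrite E1 in H.
have := ler_wpM2l (ltW mR_gt0) H; rewrite -[m%:R in leLHS](gtr0_norm mR_gt0) -normrM => {}H.
have p9 := pos_part_dist2_le9 y; have p0 := pos_part_ge0 (dist2 y).
set W1 := weight _; set X := pos_part (dist2 y) in p9 p0 H *.
have -> : m%:R * (W1 - weight y) - 4 * y 0 i * X =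
  m%:R * (pos_part (dist2 (- (h *: E i) + y)) ^+ 2 - X ^+ 2 - 2 * X * (h * (2 * y 0 i - h))) -
   2 * X * h * (m%:R * h) + 4 * y 0 i * X * (m%:R * h - 1).
  by rewrite /W1 /weight -/X; ring.
rewrite mh subrr mulr0 addr0 mulr1.
apply: le_trans (ler_normB _ _) _.
have h2 : `|2 * X * h| <= 18 * h.
  by rewrite ger0_norm ?mulr_ge0 ?(ltW h_gt0)// ler_wpM2r ?(ltW h_gt0)//; lra.
have h3 : m%:R * (h * (2 * y 0 i - h)) ^+ 2 <= 81 * h.
  have -> : m%:R * (h * (2 * y 0 i - h)) ^+ 2 = (m%:R * h) * (2 * y 0 i - h) ^+ 2 * h by ring.
  rewrite mh mul1r ler_wpM2r ?(ltW h_gt0)//.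
  have : `|2 * y 0 i - h| <= 9.
    apply: le_trans (ler_normB _ _) _; rewrite normrM (ger0_norm (ltW h_gt0)).
    by rewrite [`|2|]ger0_norm//; have := h_le1; lra.
  rewrite -(real_normK (num_real (2 * y 0 i - h))) expr2 => k9.
  by have := normr_ge0 (2 * y 0 i - h); nra.
lra.
Qed.

(** The time derivative of the energy density when z = exp(-t/2), P = V_t, and P_t is given by the
    equation: then z' = - z/2, the radius r has derivative - z, and z^2 has derivative - z^2. *)
Definition energy_rate y : R :=
  2 * pos_part (dist2 y) * (2 * r * - z) * (P y ^+ 2 + z ^+ 2 * \sum_(i < n) d i y ^+ 2) +
  weight y * (2 * P y * (- mu * P y + z ^+ 2 * \sum_(i < n) Vxx i y) +
    (- z ^+ 2 * \sum_(i < n) d i y ^+ 2 +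
     z ^+ 2 * \sum_(i < n) 2 * d i y * dq h i P y)).

(** The difference quotient of P is moved onto the product of the weight and the difference quotient
    of V; only the sums over the lattice agree. *)
Let rate_by_parts y : R :=
  2 * pos_part (dist2 y) * (2 * r * - z) * (P y ^+ 2 + z ^+ 2 * \sum_(i < n) d i y ^+ 2) +
  weight y * (2 * P y * (- mu * P y + z ^+ 2 * \sum_(i < n) Vxx i y) -
    z ^+ 2 * \sum_(i < n) d i y ^+ 2) +
  \sum_(i < n) 2 * z ^+ 2 * m%:R * P y *
    (weight (- (h *: E i) + y) * d i (- (h *: E i) + y) - weight y * d i y).

Lemma sum_energy_rate :
  \sum_(j : lattice) energy_rate (pt j) = \sum_(j : lattice) rate_by_parts (pt j).
Proof.
apply/eqP; rewrite -subr_eq0 -sumrB; apply/eqP.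
have E1 (j : lattice) : energy_rate (pt j) - rate_by_parts (pt j) = \sum_(i < n) 2 * z ^+ 2 * m%:R *
  (weight (pt j) * d i (pt j) * P (h *: E i + pt j) -
   weight (- (h *: E i) + pt j) * d i (- (h *: E i) + pt j) * P (pt j)).
  rewrite /energy_rate /rate_by_parts; set y := pt j.
  have -> : weight y * (2 * P y * (- mu * P y + z ^+ 2 * \sum_(i < n) Vxx i y) +
    (- z ^+ 2 * \sum_(i < n) d i y ^+ 2 + z ^+ 2 * \sum_(i < n) 2 * d i y * dq h i P y)) =
   weight y * (2 * P y * (- mu * P y + z ^+ 2 * \sum_(i < n) Vxx i y) -
    z ^+ 2 * \sum_(i < n) d i y ^+ 2) + \sum_(i < n) weight y * z ^+ 2 * (2 * d i y * dq h i P y).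
    by rewrite -mulr_sumr; ring.
  have aux (a c u v : R) : a + (c + u) - (a + c + v) = u - v by ring.
  rewrite aux -sumrB.
  by apply: eq_bigr => i _; rewrite /dq /h invrK; ring.
under eq_bigr do rewrite E1.
rewrite exchange_big /= big1// => i _; rewrite -mulr_sumr sumrB.
set Z := fun y => weight (- (h *: E i) + y) * d i (- (h *: E i) + y) * P y.
have := @lattice_shift _ _ _ m_gt0 Z i; rewrite -/h => <-.
  rewrite -sumrB big1 ?mulr0// => j _; rewrite /Z !addKr subrr//.
move=> x xm; rewrite /Z /weight (@weight_outside _ i) ?expr0n ?mul0r//.
rewrite !mxE !eqxx /= mulr1.
have m4 : 4 <= m%:R :> R by rewrite ler_nat.
have := ler_normD (- h + x 0 i) h; rewrite addrAC addNr add0r (gtr0_norm h_gt0).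
by have := h_le1; lra.
Qed.

(** Per direction the error is at most 2 B times (81 + 198 + 108) B h = 387 B h, which is below 800
    B^2 h. *)
Definition rate_const : R := 800 * n%:R * B ^+ 2.

Lemma rate_const_ge0 : 0 <= rate_const.
Proof.
by rewrite /rate_const -natrM; apply: mulr_ge0; [exact: ler0n|exact: sqr_ge0].
Qed.

(** Up to O(h) the second derivatives cancel, and the terms in - mu P^2 and - z^2 |d|^2 have a good
    sign. The flux through the cone, from differences of the weight, is absorbed by the shrinking of
    the cone. *)
Lemma rate_by_parts_le y : cube 4 y -> rate_by_parts y <= rate_const * h.
Proof.
move=> y4; rewrite /rate_by_parts.
set p := pos_part (dist2 y); have p0 : 0 <= p := pos_part_ge0 _.
have p9 : p <= 9 := pos_part_dist2_le9 y.
have [z0 z1] := andP z01.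
have wE : weight y = p ^+ 2 by [].
have w81 : weight y <= 81 by rewrite wE expr2; nra.
have w0 : 0 <= weight y by rewrite wE sqr_ge0.
have Py := HP y4.
have r1 : 0 < r by rewrite /r; lra.
have z2 : z ^+ 2 <= 1 by rewrite expr2; nra.
have z20 : 0 <= z ^+ 2 by rewrite sqr_ge0.
have term i : 2 * z ^+ 2 * m%:R * P y *
    (weight (- (h *: E i) + y) * d i (- (h *: E i) + y) - weight y * d i y) <=
   800 * B ^+ 2 * h - weight y * (2 * P y * z ^+ 2 * Vxx i y) +
     8 * z ^+ 2 * p * P y * (y 0 i * d i y).
  set W1 := weight (- (h *: E i) + y); set d1 := d i (- (h *: E i) + y).
  (* The three discretization errors: of the second derivative, of the gradient of the weight, and
     of the shift in the difference quotient. *)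
  pose e1 := Vxx i y - m%:R * (d i y - d1).
  pose e2 := m%:R * (W1 - weight y) - 4 * y 0 i * p.
  pose e3 := d i y - d1.
  have H1 : `|e1| <= B * h := HVxx i y4.
  have H2 : `|e2| <= 99 * h := weight_dq i y4.
  have H3 : `|e3| <= B * h := Hdd i y4.
  have -> : 2 * z ^+ 2 * m%:R * P y * (W1 * d1 - weight y * d i y) =
    2 * z ^+ 2 * P y * (weight y * e1 + e2 * d1 - 4 * y 0 i * p * e3)
    - weight y * (2 * P y * z ^+ 2 * Vxx i y) + 8 * z ^+ 2 * p * P y * (y 0 i * d i y).
    by rewrite /e1 /e2 /e3; ring.
  rewrite lerD2r lerD2r; apply: le_trans (ler_norm _) _.
  have h0 := ltW h_gt0; have Bh0 : 0 <= B * h by rewrite mulr_ge0.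
  have Hd1 : `|d1| <= 2 * B.
    rewrite -[d1](subKr (d i y)); apply: le_trans (ler_normB _ _) _.
    have := Hd i y4; have : B * h <= B by rewrite ler_piMr.
    rewrite -/d1 -/e3; lra.
  have yi := y4 i.
  have K1 : `|weight y * e1| <= 81 * (B * h).
    by rewrite normrM ger0_norm//; apply: ler_pM.
  have K2 : `|e2 * d1| <= 99 * h * (2 * B) by rewrite normrM; apply: ler_pM.
  have K3 : `|4 * y 0 i * p * e3| <= 4 * 3 * 9 * (B * h).
    (* The factors 3 and 9 bound |y_i| and p where p is nonzero; elsewhere the term vanishes. *)
    have [y3|y3] := leP 3 `|y 0 i|.
      by rewrite /p (weight_outside y3) mulr0 mul0r normr0 mulr_ge0.
    rewrite normrM; apply: ler_pM => //; rewrite normrM (ger0_norm p0) normrM.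
    apply: ler_pM => //; apply: ler_pM => //; first by rewrite ger0_norm.
    exact: ltW.
  rewrite normrM.
  have K4 : `|2 * z ^+ 2 * P y| <= 2 * B.
    rewrite normrM ger0_norm ?mulr_ge0//; apply: ler_pM => //; first by rewrite mulr_ge0.
    lra.
  apply: (@le_trans _ _ (2 * B * (387 * (B * h)))); last first.
    by rewrite expr2; have := mulr_ge0 B0 Bh0; lra.
  apply: ler_pM => //; apply: le_trans (ler_normB _ _) _.
  apply: (@le_trans _ _ (81 * (B * h) + 99 * h * (2 * B) + 4 * 3 * 9 * (B * h))).
    by apply: lerD => //; apply: le_trans (ler_normD _ _) _; exact: lerD.
  lra.
set Sd := \sum_(i < n) d i y ^+ 2; set Sv := \sum_(i < n) Vxx i y.
pose Syd := \sum_(i < n) y 0 i * d i y.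
have Sd0 : 0 <= Sd by apply: sumr_ge0 => i _; exact: sqr_ge0.
have H : \sum_(i < n) 2 * z ^+ 2 * m%:R * P y *
    (weight (- (h *: E i) + y) * d i (- (h *: E i) + y) - weight y * d i y) <=
    rate_const * h - weight y * (2 * P y * z ^+ 2 * Sv) + 8 * z ^+ 2 * p * P y * Syd.
  apply: le_trans (ler_sum _ (fun i _ => term i)) _.
  rewrite big_split sumrB /= sumr_const card_ord -!mulr_sumr -/Sv -/Syd.
  by rewrite /rate_const -mulr_natr; lra.
(* The causality inequality: expand the sum of the squares (r z d_i - y_i P)^2 and use |y| <= r on
   the support of the weight. *)
have key : 2 * z * P y * Syd * p <= r * (P y ^+ 2 + z ^+ 2 * Sd) * p.
  have [b0|b0] := leP (dist2 y) 0; first by rewrite /p /pos_part (max_l b0) !mulr0.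
  rewrite ler_wpM2r// -(ler_pM2l r1).
  have : 0 <= \sum_(i < n) (r * z * d i y - y 0 i * P y) ^+ 2.
    by apply: sumr_ge0 => i _; exact: sqr_ge0.
  have -> : \sum_(i < n) (r * z * d i y - y 0 i * P y) ^+ 2 =
      r ^+ 2 * z ^+ 2 * Sd - 2 * r * z * P y * Syd + P y ^+ 2 * \sum_(i < n) y 0 i ^+ 2.
    rewrite /Sd /Syd !mulr_sumr -sumrB -big_split /=; apply: eq_bigr => i _; ring.
  have yr : P y ^+ 2 * \sum_(i < n) y 0 i ^+ 2 <= P y ^+ 2 * r ^+ 2.
    by rewrite ler_wpM2l ?sqr_ge0//; move: b0; rewrite /dist2 subr_gt0 => /ltW.
  by rewrite ![r ^+ 2]expr2 in yr *; lra.
have key2 := ler_wpM2l z0 key.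
have t1 : 0 <= mu * (weight y * P y ^+ 2).
  by apply: mulr_ge0 => //; apply: mulr_ge0 => //; exact: sqr_ge0.
have t2 : 0 <= weight y * (z ^+ 2 * Sd).
  by apply: mulr_ge0 => //; exact: mulr_ge0.
apply: le_trans (lerD (lexx _) H) _.
rewrite -/p -/Sv -/Sd [z ^+ 2]expr2 in t2 key2 *; lra.
Qed.

Lemma rate_by_parts_outside y : ~ cube 4 y -> rate_by_parts y = 0.
Proof.
move=> y4; have [i yi] : exists i, 4 < `|y 0 i|.
  apply: contrapT => H; apply: y4 => i; rewrite leNgt; apply/negP => yi.
  by apply: H; exists i.
have V0 : pos_part (dist2 y) = 0 by apply: (@weight_outside _ i); lra.
have V1 a : pos_part (dist2 (- (h *: E a) + y)) = 0.
  apply: (@weight_outside _ i); rewrite !mxE eqxx /=.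
  have := ler_normD (- (h * (i == a)%:R) + y 0 i) (h * (i == a)%:R).
  rewrite addrAC addNr add0r normrM (gtr0_norm h_gt0).
  have : `|(i == a)%:R| <= 1 :> R by case: eqP; rewrite ?normr1 ?normr0.
  have h0 := h_gt0; have h1 := h_le1; have n0 : 0 <= `|(i == a)%:R| :> R by [].
  move: `|(i == a)%:R| n0 => c c0 c1; nra.
rewrite /rate_by_parts /weight V0 expr0n /= !(mulr0, mul0r) !add0r big1// => a _.
by rewrite V1 expr0n /= !mul0r subrr mulr0.
Qed.

(** Only O(m^n) lattice points lie in the cube: there each 17/(1 + y_i^2) is at least 1, since 17 =
    1 + 4^2. *)
Lemma sum_rate_le :
  \sum_(j : lattice) energy_rate (pt j) <= rate_const * h * (17 * (8 * m%:R)) ^+ n.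
Proof.
rewrite sum_energy_rate.
have C0 : 0 <= rate_const * h.
  by apply: mulr_ge0; [exact: rate_const_ge0|exact: ltW].
have K (j : lattice) : rate_by_parts (pt j) <=
    rate_const * h * (17 ^+ n * \prod_(i < n) (1 + pt j 0 i ^+ 2)^-1).
  have pos1 (x : R) : 0 < 1 + x ^+ 2 by rewrite ltr_pwDl// sqr_ge0.
  have [y4|y4] := pselect (cube 4 (pt j : 'rV[R]_n)); last first.
    rewrite rate_by_parts_outside// mulr_ge0// mulr_ge0 ?exprn_ge0// prodr_ge0// => i _.
    by rewrite invr_ge0 ltW.
  apply: le_trans (rate_by_parts_le y4) _; rewrite ler_peMr//.
  rewrite -[X in _ ^+ X]card_ord -prodr_const -big_split /=.
  apply: (big_ind (fun x : R => 1 <= x)) => // [x y|i _]; first exact: mulr_ege1.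
  rewrite ler_pdivlMr// mul1r -(real_normK (num_real (pt j 0 i))).
  have := y4 i; have := normr_ge0 (pt j 0 i : R); rewrite expr2; nra.
apply: le_trans (ler_sum _ (fun j _ => K j)) _.
rewrite -!mulr_sumr ler_wpM2l// exprMn ler_wpM2l ?exprn_ge0//.
exact: lattice_sum_le.
Qed.

End energy.

(** * One-sided calculus on the half-line and second differences *)

Section half_line.
Context {R : realType}.
Local Notation half_line := [set s : R | 0 <= s].
Implicit Types (f df : R -> R) (t l c : R).

Lemma is_derive_half_line f t l : 0 < t -> wderive half_line f (1 : R) t l ->
  is_derive t (1 : R) f l.
Proof.
move=> t0 H; have E (s : R) : s *: (1 : R) + 0 = s by rewrite addr0 /GRing.scale /= mulr1.
have := @is_derive_wderive _ _ half_line f (1 : R) 0 l t.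
rewrite E (_ : (fun s : R => f (s *: (1 : R) + 0)) = f); last first.
  by apply/funext => s; rewrite E.
apply=> //; exists t => // h ht /=; rewrite /GRing.scale /= mulr1.
by move: ht; rewrite ltr_norml => /andP[]; lra.
Qed.

Lemma continuous_half_line f df (T : R) :
  (forall t, 0 <= t <= T -> wderive half_line f (1 : R) t (df t)) ->
  {within `[0, T], continuous f}.
Proof.
move=> H; apply/subspace_continuousP => t /=; rewrite in_itv /= => t0T.
have /wderiveP/(_ 1 ltr01)[d d0 Hd] := H t t0T.
apply/cvgrPdist_le => e e0; have K0 : 0 < `|df t| + 1 by rewrite ltr_wpDl.
rewrite /within /=; apply/nbhs_ballP.
exists (Num.min d (e / (`|df t| + 1))) => /=; first by rewrite lt_min d0 divr_gt0.
move=> x; rewrite /ball /= lt_min => /andP[xd xe]; rewrite in_itv /= => /andP[x0 _].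
rewrite distrC in xd; have := Hd (x - t) xd.
rewrite /GRing.scale /= mulr1 subrK mul1r => /(_ x0) K.
rewrite distrC -(subrK ((x - t) * df t) (f x - f t)).
apply: le_trans (ler_normD _ _) _; apply: le_trans (lerD K (lexx _)) _.
rewrite normrM -{1}[`|x - t|]mulr1 -mulrDr distrC [1 + _]addrC.
by rewrite -ler_pdivlMr// ltW.
Qed.

Lemma mvt_half_line f df (T c : R) : 0 <= T ->
  (forall t, 0 <= t <= T -> wderive half_line f (1 : R) t (df t)) ->
  (forall t, 0 < t < T -> df t <= c) -> f T - f 0 <= c * T.
Proof.
move=> T0 H Hc; rewrite -{2}[T]subr0; apply: (mvt_le (df := df)) => //.
  move=> t /andP[t0 tT]; apply: is_derive_half_line => //; apply: H.
  by rewrite !ltW.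
exact: continuous_half_line H.
Qed.

(** Multiplied by m and m^2 respectively, these give the O(h) errors that the energy estimate
    assumes. For the cubic bound one differentiates in the step length, which reduces it to a
    quadratic remainder for [phi1]. *)
Lemma second_difference (phi phi1 phi2 phi3 : R -> R) (h B : R) : 0 <= h ->
  (forall x, - h <= x <= h -> [/\ is_derive x (1 : R) phi (phi1 x),
     is_derive x (1 : R) phi1 (phi2 x), is_derive x (1 : R) phi2 (phi3 x),
     `|phi2 x| <= B & `|phi3 x| <= B]) ->
  `|phi h - phi 0 - (phi 0 - phi (- h))| <= 2 * B * h ^+ 2 /\
  `|phi h - phi 0 - (phi 0 - phi (- h)) - h ^+ 2 * phi2 0| <= 2 * B * h ^+ 3.
Proof.
move=> h0 H.
have nhh : - h <= h by lra.
have R1 c x : - h <= c <= h -> Num.min 0 c <= x <= Num.max 0 c -> - h <= x <= h.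
  move=> /andP[c1 c2] /andP[x1 x2]; apply/andP; split.
    by apply: le_trans x1; rewrite le_min c1; lra.
  by apply: le_trans x2 _; rewrite ge_max c2 andbT.
have B0 : 0 <= B.
  have z0 : - h <= 0 <= h by lra.
  by have [_ _ _ Hb _] := H 0 z0; exact: le_trans Hb.
have T1 c : - h <= c <= h -> `|phi c - phi 0 - c * phi1 0| <= B * `|c| ^+ 2.
  move=> ch; have := @taylor1_le _ phi phi1 phi2 0 c B; rewrite subr0; apply=> x xc.
  - by have [] := H x (R1 c x ch xc).
  - by have [] := H x (R1 c x ch xc).
  - by have [] := H x (R1 c x ch xc).
have T2 c : - h <= c <= h -> `|phi1 c - phi1 0 - c * phi2 0| <= B * `|c| ^+ 2.
  move=> ch; have := @taylor1_le _ phi1 phi2 phi3 0 c B; rewrite subr0; apply=> x xc.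
  - by have [] := H x (R1 c x ch xc).
  - by have [] := H x (R1 c x ch xc).
  - by have [] := H x (R1 c x ch xc).
have hh : - h <= h <= h by rewrite nhh lexx.
have hn : - h <= - h <= h by rewrite nhh lexx.
split.
  have := T1 h hh; have := T1 (- h) hn; rewrite normrN (ger0_norm h0) => K1 K2.
  have -> : phi h - phi 0 - (phi 0 - phi (- h)) =
    (phi h - phi 0 - h * phi1 0) + (phi (- h) - phi 0 - - h * phi1 0) by ring.
  apply: le_trans (ler_normD _ _) _; lra.
pose psi c := phi c - phi 0 - (phi 0 - phi (- c)) - c ^+ 2 * phi2 0.
have := @derive_dist_le _ psi (fun c => phi1 c - phi1 (- c) - 2 * c * phi2 0) 0 h
  (2 * B * h ^+ 2).
have psi0 : psi 0 = 0 by rewrite /psi oppr0; ring.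
have E3 : 2 * B * h ^+ 3 = 2 * B * h ^+ 2 * h by ring.
rewrite E3 psi0 !subr0 (ger0_norm h0); apply=> x.
  move=> xh; have xr := R1 h x hh xh.
  have nxr : - h <= - x <= h by case/andP: xr => ? ?; lra.
  have [d1 _ _ _ _] := H x xr; have [d2 _ _ _ _] := H (- x) nxr.
  have dN : is_derive x (1 : R) (fun x : R => - x) (-1).
    exact: (is_deriveN (is_derive_id x (1 : R))).
  have d3 := @is_derive1_comp _ phi (fun x => - x) x _ _ d2 dN.
  have dX : is_derive x (1 : R) (fun x : R => x ^+ 2) (x + x).
    have dX := is_deriveM (is_derive_id x (1 : R)) (is_derive_id x (1 : R)).
    by apply: (is_derive_eq dX); rewrite /GRing.scale /= !mulr1.
  have d4 := is_deriveB (is_deriveB (is_deriveB d1 (is_derive_cst (phi 0) x (1 : R)))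
    (is_deriveB (is_derive_cst (phi 0) x (1 : R)) d3)) (is_deriveZ (phi2 0) dX).
  have -> : psi =
     (fun c => phi c - phi 0 - (phi 0 - phi (- c)) - phi2 0 * c ^+ 2).
    by apply/funext => c; rewrite /psi [phi2 0 * _]mulrC.
  by apply: (is_derive_eq d4); rewrite /GRing.scale /=; ring.
move=> xh; have xr := R1 h x hh xh.
have nxr : - h <= - x <= h by case/andP: xr => ? ?; lra.
have := T2 x xr; have := T2 (- x) nxr; rewrite normrN => K1 K2.
have -> : phi1 x - phi1 (- x) - 2 * x * phi2 0 =
  (phi1 x - phi1 0 - x * phi2 0) - (phi1 (- x) - phi1 0 - - x * phi2 0) by ring.
apply: le_trans (ler_normB _ _) _.
have : B * `|x| ^+ 2 <= B * h ^+ 2.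
  rewrite ler_wpM2l// lerXn2r ?nnegrE// ler_norml; exact: xr.
lra.
Qed.

End half_line.

(** * Restriction to coordinate lines, and bounds on compact sets *)

Section spacetime_tools.
Context {R : realType} {n : nat}.
Local Notation spacetime := (R^o * 'rV[R]_n)%type.
Local Notation e := (@spacetime_frame R n).
Local Notation D := (@future R n).
Local Notation E := (@space_frame R n).
Implicit Types (F G : spacetime -> R) (t : R) (x y : 'rV[R]_n).

Lemma wderive_time F t x l : wderive D F (e None) (t, x) l ->
  wderive [set s : R | 0 <= s] (fun s => F (s, x)) (1 : R) t l.
Proof.
move=> /wderiveP H; apply/wderiveP => eps /H[d d0 Hd]; exists d => // h hd h0.
have := Hd h hd; rewrite frame_time [h *: _]/GRing.scale /= mulr1; apply.
by move: h0; rewrite /= /GRing.scale /= mulr1.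
Qed.

Lemma is_derive_space F G i t x (c : R) : 0 <= t ->
  (forall p, D p -> wderive D F (e (Some i)) p (G p)) ->
  is_derive c (1 : R) (fun c => F (t, c *: E i + x)) (G (t, c *: E i + x)).
Proof.
move=> t0 H; have := @is_derive_wderive _ _ D F (e (Some i)) (t, x) (G (t, c *: E i + x)) c.
rewrite frame_space (_ : (fun s : R => F (s *: e (Some i) + (t, x))) =
  (fun s => F (t, s *: E i + x))); last by apply/funext => s; rewrite frame_space.
apply; last exact: H.
by exists 1 => // h _; rewrite frame_space.
Qed.

Lemma cube_bound F (T : R) (L : R) (x0 : 'rV[R]_n) : 0 <= T -> 0 <= L ->
  {within D, continuous F} ->
  exists2 B, 0 <= B & forall t y, 0 <= t <= T -> cube L y -> `|F (t, y + x0)| <= B.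
Proof.
move=> T0 L0 cF.
pose A2 := [set x : 'rV[R]_n | forall i, `[x0 0 i - L, x0 0 i + L]%classic (x ord0 i)].
have cA2 : compact A2.
  exact: (@rV_compact R n (fun i => `[x0 0 i - L, x0 0 i + L]%classic)
    (fun i => @segment_compact R _ _)).
pose A : set spacetime := `[0, T] `*` A2.
have cA : compact A by apply: compact_setX => //; exact: segment_compact.
have AD : A `<=` D by move=> [t x] [/= + _]; rewrite in_itv /= => /andP[].
have A0 : A !=set0.
  exists (0, x0); split=> /=; first by rewrite in_itv /= lexx.
  by move=> i; rewrite /= in_itv /=; apply/andP; split; lra.
have cF' : {within A, continuous (fun p => `|F p|)}.
  apply/subspace_continuousP => p Ap.
  have /subspace_continuousP/(_ p (AD p Ap)) := cF => cp.
  have cp' : F @ within A (nbhs p) --> F p.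
    apply: cvg_trans cp => P HP.
    have {}HP : nbhs p [set q | D q -> P (F q)] := HP.
    change (nbhs p [set q | A q -> P (F q)]).
    by move: HP; apply: filterS => q Dq Aq; apply: Dq; exact: AD.
  exact: cvg_norm cp'.
have [p Ap pmax] := compact_EVT_max A0 cA cF'.
exists `|F p| => // t y tT yL; apply: pmax; rewrite inE; split=> //=.
move=> i; rewrite /= in_itv /= mxE; have := yL i; rewrite ler_norml => /andP[]; lra.
Qed.

End spacetime_tools.

(** * Uniqueness for the linear equation *)

(** With m = q p, the p indices m^2 + l, l < p, have coordinates l / m in [0, 1/q], so a fixed box
    of side 1/q contains at least p^n lattice points. *)
Lemma lattice_count {R : realType} (n q p m : nat) : (0 < q)%N -> (0 < p)%N ->
  m = (q * p)%N ->
  p%:R ^+ n <= \sum_(j : {ffun 'I_n -> 'I_((m ^ 2 + m ^ 2).+1)%N})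
    \prod_(i < n) (if (0 <= (pt j : 'rV[R]_n) 0 i <= q%:R^-1) then 1 else 0) :> R.
Proof.
move=> q0 p0 mE; set N := ((m ^ 2 + m ^ 2).+1)%N.
have m0 : (0 < m)%N by rewrite mE muln_gt0 q0.
have mp : 0 < m%:R :> R by rewrite ltr0n.
pose c (l : 'I_N) : R := if 0 <= (centered l / m%:R : R) <= q%:R^-1 then 1 else 0.
have -> : \sum_(j : {ffun 'I_n -> 'I_N})
    \prod_(i < n) (if (0 <= (pt j : 'rV[R]_n) 0 i <= q%:R^-1) then 1 else 0) = (\sum_l c l) ^+ n.
  by rewrite -(sum_prod n c); apply: eq_bigr => j _; apply: eq_bigr => i _; rewrite mxE.
have pm : (p <= m ^ 2)%N.
  by apply: (@leq_trans m); [rewrite mE leq_pmull|rewrite -{1}[m]expn1 leq_pexp2l].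
have cge : p%:R <= \sum_l c l.
  rewrite -big_mkcond /= sumr_const ler_nat.
  have fP (l : 'I_p) : (m ^ 2 + l < N)%N.
    by rewrite ltnS leq_add2l; apply: leq_trans pm; exact: ltnW.
  pose F (l : 'I_p) : 'I_N := Ordinal (fP l).
  have Finj : injective F by move=> l l' [] /addnI H; exact: val_inj.
  rewrite -[X in (X <= _)%N]card_ord -(card_codom Finj).
  apply: (@leq_trans #|[pred l : 'I_N | 0 <= (centered l / m%:R : R) <= q%:R^-1]|); last first.
    by apply: eq_leq; apply: eq_card.
  apply: subset_leq_card.
  apply/fintype.subsetP => x /codomP[l ->]; rewrite inE /centered /= natrD addrAC subrr add0r.
  rewrite divr_ge0//= ler_pdivrMr// mE natrM mulKf ?pnatr_eq0 -?lt0n// ler_nat.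
  exact: ltnW.
by rewrite lerXn2r ?nnegrE//; apply: le_trans cge.
Qed.

Section uniqueness.
Context {R : realType} {n : nat} (mu : R).
Local Notation spacetime := (R^o * 'rV[R]_n)%type.
Local Notation e := (@spacetime_frame R n).
Local Notation D := (@future R n).
Local Notation E := (@space_frame R n).
Hypothesis mu0 : 0 <= mu.
Context (w wt : spacetime -> R) (wx wxx wxxx : 'I_n -> spacetime -> R).
Hypothesis cwt : {within D, continuous wt}.
Hypothesis cwx : forall i, {within D, continuous (wx i)}.
Hypothesis cwxx : forall i, {within D, continuous (wxx i)}.
Hypothesis cwxxx : forall i, {within D, continuous (wxxx i)}.
Hypothesis dwt : forall p, D p -> wderive D w (e None) p (wt p).
Hypothesis dwx : forall i p, D p -> wderive D w (e (Some i)) p (wx i p).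
Hypothesis dwxx : forall i p, D p -> wderive D (wx i) (e (Some i)) p (wxx i p).
Hypothesis dwxxx : forall i p, D p -> wderive D (wxx i) (e (Some i)) p (wxxx i p).
Hypothesis eqn : forall p, D p -> wderive D wt (e None) p
  (- mu * wt p + expR (- p.1) * \sum_(i < n) wxx i p).
Hypothesis w0 : forall x, w (0, x) = 0.
Hypothesis wt0 : forall x, wt (0, x) = 0.

Let light_speed (t : R) : R := expR (- (t / 2)).

Let light_speed_sqr t : light_speed t ^+ 2 = expR (- t).
Proof. by rewrite /light_speed expr2 -expRD -opprD -splitr. Qed.

Section at_point.
Context (T : R) (x0 : 'rV[R]_n).
Hypothesis T_ge0 : 0 <= T.

Definition energy (m : nat) (t : R) : R :=
  \sum_(j : {ffun 'I_n -> 'I_((m ^ 2 + m ^ 2).+1)%N})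
    weight (light_speed t) (pt j) * (wt (t, pt j + x0) ^+ 2 +
      expR (- t) * \sum_(i < n) dq m%:R^-1 i (fun y => w (t, y + x0)) (pt j) ^+ 2).

Definition energy_deriv (m : nat) (t : R) : R :=
  \sum_(j : {ffun 'I_n -> 'I_((m ^ 2 + m ^ 2).+1)%N})
    energy_rate m mu (light_speed t) (fun y => w (t, y + x0)) (fun y => wt (t, y + x0))
      (fun i y => wxx i (t, y + x0)) (pt j).

Local Notation half_line := [set s : R | 0 <= s].

Lemma wderive_energy m t : 0 <= t ->
  wderive half_line (energy m) (1 : R) t (energy_deriv m t).
Proof.
move=> t0; apply: wderive_bigsum => j; set y := pt j; rewrite /energy_rate.
have dw x : wderive half_line (fun s => w (s, x)) (1 : R) t (wt (t, x)).
  by apply: wderive_time; exact: dwt.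
have dW x : wderive half_line (fun s => wt (s, x)) (1 : R) t
    (- mu * wt (t, x) + light_speed t ^+ 2 * \sum_(i < n) wxx i (t, x)).
  by rewrite light_speed_sqr; apply: wderive_time; exact: (eqn (p := (t, x))).
have dz : wderive half_line light_speed (1 : R) t (- (light_speed t / 2)).
  have d1 : wderive half_line (fun s : R => - (s / 2)) (1 : R) t (- (2^-1)).
    apply: (@wderive_quad _ _ _ _ _ _ _ 0) => h _ _.
    rewrite /GRing.scale /= mulr1 mul0r (_ : - ((h + t) / 2) - _ - _ = 0) ?normr0//; ring.
  by have := wderive_comp d1 (is_derive_expR _); rewrite mulrN.
have de : wderive half_line (fun s : R => expR (- s)) (1 : R) t (- light_speed t ^+ 2).
  have d1 : wderive half_line (fun s : R => - s) (1 : R) t (- 1).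
    apply: (@wderive_quad _ _ _ _ _ _ _ 0) => h _ _.
    rewrite /GRing.scale /= mulr1 mul0r (_ : - (h + t) - _ - _ = 0) ?normr0//; ring.
  by have := wderive_comp d1 (is_derive_expR _); rewrite mulrN mulr1 light_speed_sqr.
have dwei : wderive half_line (fun s => weight (light_speed s) y) (1 : R) t
    (2 * pos_part (dist2 (light_speed t) y) * (2 * (1 + 2 * light_speed t) * - light_speed t)).
  have d1 : wderive half_line (fun s => 1 + 2 * light_speed s) (1 : R) t (- light_speed t).
    have := wderiveD (wderive_cst half_line (1 : R) (1 : R) t) (wderiveZ (c := 2) dz).
    by congr wderive; field.
  have d2 := wderiveD (wderiveM d1 d1) (wderive_cst half_line (- \sum_(i < n) y 0 i ^+ 2) (1 : R) t).
  have d3 := wderive_comp d2 (is_derive_pos_part_sqr _).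
  move: d3; congr wderive.
  by rewrite /dist2 expr2; ring.
have ddq i : wderive half_line (fun s => dq m%:R^-1 i (fun y => w (s, y + x0)) y) (1 : R) t
    (dq m%:R^-1 i (fun y => wt (t, y + x0)) y).
  by apply: wderiveZ; apply: wderiveD => //; exact: wderiveN.
have dS := @wderive_bigsum _ _ _ _ (index_enum 'I_n) (fun i s =>
    dq m%:R^-1 i (fun y => w (s, y + x0)) y * dq m%:R^-1 i (fun y => w (s, y + x0)) y)
    1 t _ (fun i => wderiveM (ddq i) (ddq i)).
have := wderiveM dwei (wderiveD (wderiveM (dW (y + x0)) (dW (y + x0))) (wderiveM de dS)).
set d1 := (X in wderive _ _ _ _ X -> _); set d2 := (X in _ -> wderive _ _ _ _ X).
have <- : d1 = d2.
  rewrite /d1 /d2; have E1 : \sum_(i < n) (dq m%:R^-1 i (fun y => wt (t, y + x0)) y *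
      dq m%:R^-1 i (fun y => w (t, y + x0)) y + dq m%:R^-1 i (fun y => w (t, y + x0)) y *
      dq m%:R^-1 i (fun y => wt (t, y + x0)) y) =
    \sum_(i < n) 2 * dq m%:R^-1 i (fun y => w (t, y + x0)) y *
      dq m%:R^-1 i (fun y => wt (t, y + x0)) y.
    by apply: eq_bigr => i _; ring.
  have E2 : \sum_(i < n) (dq m%:R^-1 i (fun y => w (t, y + x0)) y *
      dq m%:R^-1 i (fun y => w (t, y + x0)) y) =
     \sum_(i < n) dq m%:R^-1 i (fun y => w (t, y + x0)) y ^+ 2.
    by apply: eq_bigr => i _; rewrite expr2.
  by rewrite E1 E2 -light_speed_sqr; ring.
by congr wderive; apply/funext => s.
Qed.

Lemma energy0 m : energy m 0 = 0.
Proof.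
rewrite /energy big1// => j _; rewrite wt0 big1 ?mulr0 ?addr0 ?expr0n ?mulr0//.
by move=> i _; rewrite /dq !w0 subrr mulr0 expr0n.
Qed.

(** The energy is a plain sum over the lattice; m^n makes up for the missing volume element, and the
    gain is the factor 1/m. *)
Lemma energy_le : exists2 C, 0 <= C & forall m, (4 <= m)%N ->
  energy m T <= C * (m%:R^-1 * m%:R ^+ n).
Proof.
(* Half-side 6 leaves room for the shifts by at most 1 of points of the cube of half-side 4. *)
have [B1 B10 H1] := cube_bound x0 T_ge0 (ler0n R 6) cwt.
have mk (F : 'I_n -> spacetime -> R) : (forall i, {within D, continuous (F i)}) ->
    exists2 B, 0 <= B & forall i t y, 0 <= t <= T -> cube 6 y -> `|F i (t, y + x0)| <= B.
  move=> cF; have /choice[B HB] : forall i, exists B, 0 <= B /\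
      forall t y, 0 <= t <= T -> cube 6 y -> `|F i (t, y + x0)| <= B.
    by move=> i; have [B B0 HB] := cube_bound x0 T_ge0 (ler0n R 6) (cF i); exists B.
  exists (\sum_i B i); first by apply: sumr_ge0 => i _; have [] := HB i.
  move=> i t y tT y6; have [_ /(_ t y tT y6)] := HB i; move=> H; apply: le_trans H _.
  by rewrite (bigD1 i)//= lerDl; apply: sumr_ge0 => a _; have [] := HB a.
have [B2 B20 H2] := mk wx cwx; have [B3 B30 H3] := mk wxx cwxx.
have [B4 B40 H4] := mk wxxx cwxxx.
(* One constant for all hypotheses of the energy estimate; 2 (B3 + B4) is what [second_difference]
   yields. *)
pose B := B1 + B2 + 2 * (B3 + B4).
have B0 : 0 <= B by rewrite /B; lra.
exists (T * rate_const (n := n) B * (17 * 8) ^+ n).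
  apply: mulr_ge0; last by apply: exprn_ge0; rewrite -natrM ler0n.
  by apply: mulr_ge0; [exact: T_ge0|exact: rate_const_ge0].
move=> m m4; have m0 : (0 < m)%N by apply: leq_trans m4.
have mp : 0 < m%:R :> R by rewrite ltr0n.
set h : R := m%:R^-1; have h0 : 0 < h by rewrite invr_gt0.
have h1 : h <= 1 by rewrite invf_le1// ler1n.
have hm : h * m%:R = 1 by rewrite mulVf// gt_eqF.
rewrite -[leLHS]subr0 -(energy0 m).
have hE t : 0 <= t <= T -> wderive half_line (energy m) (1 : R) t (energy_deriv m t).
  by move=> /andP[? _]; exact: wderive_energy.
suff rate t : 0 < t < T ->
    energy_deriv m t <= rate_const (n := n) B * h * (17 * (8 * m%:R)) ^+ n.
  apply: le_trans (mvt_half_line T_ge0 hE rate) _.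
  by rewrite [17 * (8 * _)]mulrA exprMn -/h le_eqVlt; apply/orP; left; apply/eqP; ring.
move=> /andP[t0 tT]; have tT' : 0 <= t <= T by rewrite !ltW.
have t0' := ltW t0.
have cube6 i y c : cube 4 y -> - h <= c <= h -> cube 6 (c *: E i + y).
  move=> y4 /andP[c1 c2] a; rewrite !mxE eqxx /=.
  apply: le_trans (ler_normD _ _) _; have := y4 a; rewrite normrM.
  have : `|c| <= 1 by rewrite ler_norml; lra.
  by case: (a == i); rewrite ?normr1 ?normr0; lra.
have dS F G i y c : (forall p, D p -> wderive D F (e (Some i)) p (G p)) ->
    is_derive c (1 : R) (fun c => F (t, c *: E i + y + x0)) (G (t, c *: E i + y + x0)).
  move=> H; have := @is_derive_space _ _ F G i t (y + x0) c t0' H.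
  rewrite addrA; congr is_derive; apply/funext => s; by rewrite addrA.
have SD i y : cube 4 y ->
   let V := fun y => w (t, y + x0) in
   `|V (h *: E i + y) - V y - (V y - V (- (h *: E i) + y))| <= 2 * (B3 + B4) * h ^+ 2 /\
   `|V (h *: E i + y) - V y - (V y - V (- (h *: E i) + y)) - h ^+ 2 * wxx i (t, y + x0)|
      <= 2 * (B3 + B4) * h ^+ 3.
  move=> y4 V; have := @second_difference _ (fun c => w (t, c *: E i + y + x0))
    (fun c => wx i (t, c *: E i + y + x0)) (fun c => wxx i (t, c *: E i + y + x0))
    (fun c => wxxx i (t, c *: E i + y + x0)) h (B3 + B4) (ltW h0).
  rewrite scale0r add0r scaleNr; apply=> c ch.
  have c6 := cube6 i y c y4 ch.
  split; [exact: (dS _ _ i y c (@dwx i))|exact: (dS _ _ i y c (@dwxx i))|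
    exact: (dS _ _ i y c (@dwxxx i))| |].
    by apply: le_trans (H3 i t _ tT' c6) _; lra.
  by apply: le_trans (H4 i t _ tT' c6) _; lra.
have z01 : 0 <= light_speed t <= 1.
  by rewrite expR_ge0 -[leRHS]expR0 ler_expR oppr_le0 divr_ge0.
have dqE i y : let V := fun y => w (t, y + x0) in
    dq h i V y - dq h i V (- (h *: E i) + y) =
    m%:R * (V (h *: E i + y) - V y - (V y - V (- (h *: E i) + y))).
  by rewrite /dq /h invrK addNKr; ring.
rewrite /energy_deriv; apply: sum_rate_le => //.
- move=> y y4; apply: le_trans (H1 t y tT' _) _; last by rewrite /B; lra.
  by move=> i; have := y4 i; lra.
- move=> i y y4; rewrite /dq /h invrK normrM (ger0_norm (ltW mp)).
  have := @derive_dist_le _ (fun c => w (t, c *: E i + y + x0))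
    (fun c => wx i (t, c *: E i + y + x0)) 0 h B2.
  rewrite scale0r add0r subr0 (ger0_norm (ltW h0)) (min_l (ltW h0)) (max_r (ltW h0)) => K.
  have {}K := K (fun c _ => dS _ _ i y c (@dwx i)).
  have K' : `|w (t, h *: E i + y + x0) - w (t, y + x0)| <= B2 * h.
    apply: K => c /andP[c0 c1]; apply: H2 => //; apply: cube6 => //; lra.
  have := ler_wpM2l (ltW mp) K'; rewrite mulrCA [m%:R * h]mulrC hm mulr1 => K2.
  by apply: le_trans K2 _; rewrite /B; lra.
- move=> i y y4; rewrite dqE normrM (ger0_norm (ltW mp)).
  have [K _] := SD i y y4; have := ler_wpM2l (ltW mp) K.
  move=> K2; apply: le_trans K2 _.
  have -> : m%:R * (2 * (B3 + B4) * h ^+ 2) = (h * m%:R) * (2 * (B3 + B4) * h) by ring.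
  by rewrite hm mul1r ler_wpM2r ?(ltW h0)// /B; lra.
- move=> i y y4; rewrite dqE distrC.
  have [_ K] := SD i y y4; have := ler_wpM2l (mulr_ge0 (ltW mp) (ltW mp)) K.
  rewrite -[m%:R * m%:R in leLHS](ger0_norm (mulr_ge0 (ltW mp) (ltW mp))) -normrM => K2.
  set X := w _ - _ - _ in K2 *.
  have -> : m%:R * (m%:R * X) - wxx i (t, y + x0) =
     m%:R * m%:R * (X - h ^+ 2 * wxx i (t, y + x0)) +
       ((h * m%:R) ^+ 2 - 1) * wxx i (t, y + x0) by ring.
  rewrite hm expr1n subrr mul0r addr0; apply: le_trans K2 _.
  have -> : m%:R * m%:R * (2 * (B3 + B4) * h ^+ 3) = (h * m%:R) ^+ 2 * (2 * (B3 + B4) * h) by ring.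
  by rewrite hm expr1n mul1r ler_wpM2r ?(ltW h0)// /B; lra.
Qed.

(** If the velocity were nonzero, a fixed box near x0 would contribute order m^n to the energy,
    whereas the energy is only of order m^n / m. *)
Lemma velocity_eq0 : wt (T, x0) = 0.
Proof.
apply/eqP; apply/negP => /negP wn0.
have eta0 : 0 < `|wt (T, x0)| by rewrite normr_gt0.
set eta := `|wt (T, x0)| in eta0.
(* Besides continuity of the velocity, 2 n <= q is imposed so that |y|^2 <= n/q <= 1/2 in the box;
   as r >= 1, the weight is at least 1/4 there. *)
have [q q0 [qn Hq]] : exists2 q, (0 < q)%N & (2 * n <= q)%N /\
    forall y : 'rV[R]_n, (forall i, 0 <= y 0 i <= q%:R^-1) -> eta / 2 <= `|wt (T, y + x0)|.
  have DT : D (T, x0) by [].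
  have /subspace_continuousP/(_ _ DT)/cvgrPdist_le/(_ (eta / 2)) := cwt.
  rewrite divr_gt0// => /(_ isT); rewrite /within /= => /nbhs_ballP[d /= d0 Hd].
  exists (maxn (2 * n) (Num.truncn (d^-1)).+1); first by rewrite leq_max ltn0Sn orbT.
  split; first by rewrite leq_maxl.
  move=> y Hy; have qd : (maxn (2 * n) (Num.truncn (d^-1)).+1)%:R^-1 < d.
    rewrite invf_plt ?posrE ?ltr0n ?leq_max ?ltn0Sn ?orbT//.
    apply: lt_le_trans (truncnS_gt _) _; by rewrite ler_nat leq_maxr.
  have := Hd (T, y + x0) _ DT.
  have b : ball (T, x0) d (T, y + x0).
    split; first exact: ballxx.
    split=> // a i; rewrite ord1 mxE /ball /= opprD addrCA subrr addr0 normrN.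
    by have /andP[y1 y2] := Hy i; rewrite ger0_norm//; exact: le_lt_trans qd.
  move=> /(_ b) K; have := ler_normB (wt (T, x0) - wt (T, y + x0)) (- wt (T, y + x0)).
  by rewrite opprK subrK normrN -/eta; lra.
have [C C0 HC] := energy_le.
(* Each lattice point of the box contributes at least 1/4 (eta/2)^2 = eta^2/16. *)
have low p : (0 < p)%N -> p%:R ^+ n * (eta ^+ 2 / 16) <= energy (q * p)%N T.
  move=> p0; have cnt := lattice_count (R := R) n q0 p0 (erefl (q * p)%N).
  move: cnt; set m := (q * p)%N => cnt.
  have e16 : 0 <= eta ^+ 2 / 16 by rewrite divr_ge0// sqr_ge0.
  apply: le_trans (ler_wpM2r e16 cnt) _; rewrite mulr_suml; apply: ler_sum => j _.
  set y := pt j.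
  have S0 : 0 <= expR (- T) * \sum_(i < n) dq m%:R^-1 i (fun y => w (T, y + x0)) y ^+ 2.
    by rewrite mulr_ge0 ?expR_ge0// sumr_ge0// => i _; rewrite sqr_ge0.
  have [H|] := boolP [forall i, 0 <= y 0 i <= q%:R^-1]; last first.
    rewrite negb_forall => /existsP[i Hi].
    rewrite (bigD1 i)//= (negbTE Hi) !mul0r; apply: mulr_ge0; first exact: sqr_ge0.
    by apply: addr_ge0 => //; exact: sqr_ge0.
  have {}H i : 0 <= y 0 i <= q%:R^-1 by move/forallP: H.
  rewrite big1; last by move=> i _; rewrite H.
  rewrite mul1r; have K := Hq y H.
  have P1 : eta ^+ 2 / 4 <= wt (T, y + x0) ^+ 2.
    rewrite -(real_normK (num_real (wt _))).
    have -> : eta ^+ 2 / 4 = (eta / 2) ^+ 2 by field.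
    by apply: lerXn2r; rewrite ?nnegrE// divr_ge0 ?(ltW eta0).
  have P2 : 4^-1 <= weight (light_speed T) y.
    have D2 : 2^-1 <= dist2 (light_speed T) y.
      have r1 : 1 <= (1 + 2 * light_speed T) ^+ 2 by rewrite exprn_ege1// lerDl mulr_ge0// expR_ge0.
      have : \sum_(i < n) y 0 i ^+ 2 <= \sum_(i < n) q%:R^-1.
        apply: ler_sum => i _; have /andP[y1 y2] := H i; apply: le_trans y2.
        rewrite expr2 ler_piMr//; have /andP[_ y2] := H i; apply: le_trans y2 _.
        by rewrite invf_le1 ?ltr0n// ler1n.
      rewrite sumr_const card_ord -mulr_natl => S1.
      have : n%:R / q%:R <= 2^-1 :> R.
        rewrite ler_pdivrMr ?ltr0n// mulrC ler_pdivlMr// -natrM ler_nat mulnC//.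
      rewrite /dist2; lra.
    have : 2^-1 <= pos_part (dist2 (light_speed T) y) by rewrite le_max D2 orbT.
    rewrite /weight expr2; set X := pos_part _ => X2; nra.
  have -> : eta ^+ 2 / 16 = 4^-1 * (eta ^+ 2 / 4) by field.
  apply: ler_pM => //; first by rewrite divr_ge0// sqr_ge0.
  by apply: le_trans P1 _; rewrite lerDl.
(* The box, hence q, is fixed; p alone tends to infinity, and any p > A contradicts the two
   bounds. *)
pose A := C * q%:R ^+ n * 16 / eta ^+ 2.
pose p := maxn 4 (Num.truncn A).+1.
have p4 : (4 <= p)%N by rewrite leq_maxl.
have p0 : (0 < p)%N by apply: leq_trans p4.
have m4 : (4 <= q * p)%N by apply: leq_trans p4 _; rewrite leq_pmull.
have := le_trans (low p p0) (HC _ m4).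
have pR : 0 < p%:R :> R by rewrite ltr0n.
have qR : 1 <= q%:R :> R by rewrite ler1n.
have e2 : 0 < eta ^+ 2 by rewrite exprn_gt0.
have pn : 0 < p%:R ^+ n :> R by rewrite exprn_gt0.
have Ap : A < p%:R.
  by apply: lt_le_trans (truncnS_gt _) _; rewrite ler_nat leq_maxr.
have h2 : C * ((q * p)%:R^-1 * (q * p)%:R ^+ n) <= C * (p%:R^-1 * (q%:R ^+ n * p%:R ^+ n)).
  rewrite ler_wpM2l// natrM exprMn ler_wpM2r ?mulr_ge0 ?exprn_ge0//.
  by rewrite lef_pV2 ?posrE ?mulr_gt0 ?(lt_le_trans _ qR)// ler_peMl// ltW.
move=> h3; have := le_trans h3 h2.
have -> : C * (p%:R^-1 * (q%:R ^+ n * p%:R ^+ n)) = p%:R ^+ n * (C * q%:R ^+ n / p%:R) by ring.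
rewrite ler_pM2l// ler_pdivlMr// => h4.
move: Ap; rewrite /A ltr_pdivrMr// => h5; lra.
Qed.

End at_point.

Lemma linear_uniqueness p : D p -> w p = 0.
Proof.
case: p => T x0 T0; rewrite /future /= in T0.
have H (sg : R) : sg * w (T, x0) <= 0.
  have := @mvt_half_line _ (fun t => sg * w (t, x0)) (fun t => sg * wt (t, x0)) T 0 T0.
  rewrite w0 mulr0 subr0 mul0r; apply.
    by move=> t /andP[t0 _]; apply: wderiveZ; apply: wderive_time; exact: dwt.
  by move=> t /andP[/ltW t0 _]; rewrite velocity_eq0// mulr0.
by have := H 1; have := H (-1); lra.
Qed.

End uniqueness.

(** * Test functions *)

Section test_functions.
Context {R : realType} {n : nat}.
Local Notation E := (@space_frame R n).
Local Notation BkS := (Bk setT E).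
Implicit Types f g : 'rV[R]_n -> R.

Lemma coord_le_norm (x : 'rV[R]_n) i : `|x 0 i| <= `|x|.
Proof.
rewrite [leRHS]/Num.norm /= mx_normrE; apply/bigmax_geP; right => /=.
by exists (0, i).
Qed.

Lemma compact_support_vanish f : compact (closure [set x | f x != 0]) ->
  exists2 L, 0 <= L & vanish L f.
Proof.
move=> /compact_bounded[M [_ HM]]; exists (`|M| + 2); first by rewrite addr_ge0.
move=> x [i xi]; apply/eqP; apply: contraPT xi => fx; apply/negP; rewrite -ltNge.
apply: le_lt_trans (coord_le_norm x i) _.
have M1 : M < `|M| + 1 by have := ler_norm M; lra.
apply: le_lt_trans (HM _ M1 x _) _; last by lra.
by apply: subset_closure => /=.
Qed.

Lemma continuous_vanish_bounded L f : 0 <= L -> {within setT, continuous f} -> vanish L f ->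
  exists2 B, 0 <= B & forall x, `|f x| <= B.
Proof.
move=> L0 /subspace_continuousP cf Vf.
have cA : compact [set x : 'rV[R]_n | forall i, `[- L, L]%classic (x ord0 i)].
  exact: (@rV_compact R n (fun i => `[- L, L]%classic) (fun i => @segment_compact R _ _)).
have A0 : [set x : 'rV[R]_n | forall i, `[- L, L]%classic (x ord0 i)] !=set0.
  by exists 0 => i /=; rewrite mxE in_itv /=; lra.
have cf' : {within [set x : 'rV[R]_n | forall i, `[- L, L]%classic (x ord0 i)],
    continuous (fun x => `|f x|)}.
  apply/subspace_continuousP => p _; apply: cvg_norm; apply: cvg_within_filter.
  by have := cf p I; rewrite withinET.
have [p Ap pmax] := compact_EVT_max A0 cA cf'.
exists `|f p| => // x; have [xL|xL] := pselect (forall i, `|x 0 i| <= L).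
  by apply: pmax; rewrite inE /= => i; rewrite in_itv /= -ler_norml.
rewrite Vf ?normr0//; apply: contrapT => H; apply: xL => i.
by rewrite leNgt; apply/negP => /ltW xi; apply: H; exists i.
Qed.

Lemma Ck_vanish_bounded k L f : 0 <= L -> (forall j, Ck setT E j f) -> vanish L f ->
  exists2 B, 0 <= B & BkS B k f.
Proof.
elim: k L f => [|k IH] L f L0 Cf Vf;
  have [B0 B00 HB0] := continuous_vanish_bounded L0 (Ck0 (Cf 0%N)) Vf.
  by exists B0.
pose g i := derive_within setT f (E i).
have Hg i := Ck_deriv (fun p i => @setT_proper R _ _ E p i) Cf i.
(* At |x_a| = L a difference quotient may still see the support; the margin 1 makes both of its
   values vanish. *)
have Vg i : vanish (L + 1) (g i).
  move=> x [a xa].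
  apply: (wderive_uniq (fun p i => @setT_proper R _ _ E p i) (i := i) I (proj2 (Hg i) x I)).
  apply/wderiveP => eps eps0; exists 1 => // h h1 _.
  have fx : f x = 0 by apply: Vf; exists a; lra.
  have fhx : f (h *: E i + x) = 0.
    apply: Vf; exists a; rewrite !mxE eqxx /=.
    have := ler_normD (h * (a == i)%:R + x 0 a) (- (h * (a == i)%:R)).
    rewrite addrAC subrr add0r normrN normrM.
    by case: (a == i); rewrite ?normr1 ?normr0; lra.
  by rewrite fx fhx subrr mulr0 subr0 normr0 mulr_ge0// ltW.
have /choice[B HB] : forall i, exists B, 0 <= B /\ BkS B k (g i).
  move=> i; have [B B1 HB] := IH (L + 1) (g i) (addr_ge0 L0 ler01) (proj1 (Hg i)) (Vg i).
  by exists B.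
have S0 : 0 <= \sum_i B i by apply: sumr_ge0 => i _; have [] := HB i.
exists (B0 + \sum_i B i); first exact: addr_ge0.
split; first by move=> p _; apply: le_trans (HB0 p) _; rewrite lerDl.
move=> i; exists (g i); split; first by move=> p _; exact: (proj2 (Hg i)).
have [_] := HB i; apply: Bk_le; rewrite -[leLHS]add0r lerD//.
by rewrite (bigD1 i)//= lerDl sumr_ge0// => a _; have [] := HB a.
Qed.

Lemma test_functionP f : test_function f ->
  (forall k, Ck setT E k f) /\
  exists2 L, 0 <= L & vanish L f /\ forall k, exists2 B, 0 <= B & BkS B k f.
Proof.
move=> [/(smooth_onP (fun p i => @setT_proper R _ _ E p i)) Cf /compact_support_vanish[L L0 Vf]].
split=> //; exists L => //; split=> // k; exact: Ck_vanish_bounded Cf Vf.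
Qed.

Lemma vanishW (L M : R) f : L <= M -> vanish L f -> vanish M f.
Proof. by move=> LM Vf x [i xi]; apply: Vf; exists i; exact: le_trans xi. Qed.

(** F and G are the data of v = 1 - exp(-phi), as v_t = phi_t exp(-phi). The order of the
    quantifiers matters: L serves all k and [eps], and C depends on k alone, so the size of the data
    is linear in [eps]. *)
Lemma transformed_data f g : test_function f -> test_function g ->
  exists L, 0 <= L /\ (forall k, exists2 C, 0 <= C & forall eps : R, 0 <= eps <= 1 ->
    let F x := 1 - expR (- (eps * f x)) in
    let G x := eps * g x * expR (- (eps * f x)) in
    [/\ vanish L F, vanish L G, BkS (C * eps) k F & BkS (C * eps) k G]).
Proof.
move=> /test_functionP[_ [L1 L10 [V1 H1]]] /test_functionP[_ [L2 L20 [V2 H2]]].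
exists (L1 + L2); split; first exact: addr_ge0.
move=> k; have [B1 B10 Hf] := H1 k; have [B2 B20 Hg] := H2 k.
have [C1 C10 K1] := Bk_exp_small setT E k B10.
have [C2 C20 K2] := Bk_exp setT E k B10.
exists (C1 + 2 ^+ k * (B2 * C2)); first by rewrite addr_ge0// !mulr_ge0// exprn_ge0.
move=> eps e01; have /andP[e0 e1] := e01; move=> F G; split.
- have L12 : L1 <= L1 + L2 by rewrite lerDl.
  by move=> x Hx; rewrite /F (vanishW L12 V1 Hx) mulr0 oppr0 expR0 subrr.
- have L21 : L2 <= L1 + L2 by rewrite lerDr.
  by move=> x Hx; rewrite /G (vanishW L21 V2 Hx) mulr0 mul0r.
- by apply: Bk_le (K1 f Hf eps e01); rewrite ler_wpM2r// lerDl !mulr_ge0// exprn_ge0.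
have Ke : BkS C2 k (fun x => expR (- (eps * f x))).
  apply: K2; have := BkZ (- eps) Hf; rewrite normrN ger0_norm//.
  by under eq_fun do rewrite mulNr; apply: Bk_le; rewrite ler_piMl.
have := BkZ eps (BkM B20 C20 Hg Ke); rewrite ger0_norm//.
under eq_fun do rewrite mulrA; apply: Bk_le.
by rewrite mulrC ler_wpM2r// lerDr.
Qed.

End test_functions.

(** * Linearization *)

Section nirenberg_transform.
Context {R : realType} {n : nat}.
Local Notation spacetime := (R^o * 'rV[R]_n)%type.
Local Notation e := (@spacetime_frame R n).
Local Notation D := (@future R n).
Implicit Types phi : spacetime -> R.

Lemma global_smooth_Ck phi : smooth_on D e phi <-> forall k, Ck D e k phi.
Proof. by apply: smooth_onP => p a; exact: future_proper. Qed.

Lemma wderive_future phi a (p : spacetime) l : D p -> wderive D phi (e a) p l ->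
  derive_within D phi (e a) p = l.
Proof. by apply: wderive_derive_within => q b; exact: future_proper. Qed.

Lemma wderive_future_ext phi psi a (p : spacetime) l : D p -> (forall q, D q -> phi q = psi q) ->
  wderive D phi (e a) p l -> wderive D psi (e a) p l.
Proof. by move=> Dp H; apply: wderive_ext => // q; rewrite inE; exact: H. Qed.

(** Holds for solutions of any size. The additive constant of 1 - exp(-phi) is dropped since only
    differences of solutions are compared; the third space derivatives are there for the
    discretization error of the energy estimate. *)
Lemma exp_linearizes (u0 u1 : 'rV[R]_n -> R) phi : global_smooth_solution u0 u1 phi ->
  exists w wt (wx wxx wxxx : _ -> spacetime -> R),
  (forall p, w p = expR (- phi p)) /\
  [/\ [/\ {within D, continuous wt}, forall i, {within D, continuous (wx i)},
          forall i, {within D, continuous (wxx i)} & forall i, {within D, continuous (wxxx i)}],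
      forall p, D p -> wderive D w (e None) p (wt p),
      forall i p, D p -> [/\ wderive D w (e (Some i)) p (wx i p),
        wderive D (wx i) (e (Some i)) p (wxx i p) & wderive D (wxx i) (e (Some i)) p (wxxx i p)],
      forall p, D p -> wderive D wt (e None) p
        (- (n%:R / 2 + 1) * wt p + expR (- p.1) * \sum_(i < n) wxx i p)
    & forall x, w (0, x) = expR (- u0 x) /\ wt (0, x) = - u1 x * expR (- u0 x)].
Proof.
move=> [/global_smooth_Ck Cphi eqphi phi0 phi1].
pose w p := expR (- phi p).
have Cw k : Ck D e k w by apply: Ck_exp; exact: CkN.
have dP f : (forall k, Ck D e k f) -> forall a,
    (forall k, Ck D e k (derive_within D f (e a))) /\
    forall p, D p -> wderive D f (e a) p (derive_within D f (e a) p).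
  by move=> Cf a; apply: Ck_deriv => // p b; exact: future_proper.
have [Ct ht] := dP phi Cphi None; have [Ctt htt] := dP _ Ct None.
have Cx i := (dP phi Cphi (Some i)).1; have hx i := (dP phi Cphi (Some i)).2.
have Cxx i := (dP _ (Cx i) (Some i)).1; have hxx i := (dP _ (Cx i) (Some i)).2.
rewrite -/(dt phi) -/(dt (dt phi)) in Ct ht Ctt htt.
pose wd a p := - derive_within D phi (e a) p * w p.
pose wdd a p := (- derive_within D (derive_within D phi (e a)) (e a) p +
   derive_within D phi (e a) p ^+ 2) * w p.
have hw a p : D p -> wderive D w (e a) p (wd a p).
  move=> Dp; have := wderive_comp (wderiveN ((dP phi Cphi a).2 p Dp)) (is_derive_expR _).
  by rewrite /wd mulrC.
have hwd a p : D p -> wderive D (wd a) (e a) p (wdd a p).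
  move=> Dp; have := wderiveM (wderiveN ((dP _ (dP phi Cphi a).1 a).2 p Dp)) (hw a p Dp).
  by congr wderive; rewrite /wd /wdd; ring.
have Cwd a k : Ck D e k (wd a).
  by apply: CkM => //; apply: CkN; exact: (dP phi Cphi a).1.
have Cwdd a k : Ck D e k (wdd a).
  apply: CkM => //; apply: CkD; first by apply: CkN; exact: (dP _ (dP phi Cphi a).1 a).1.
  by apply: CkM; exact: (dP phi Cphi a).1.
exists w, (wd None), (fun i => wd (Some i)), (fun i => wdd (Some i)),
  (fun i => derive_within D (wdd (Some i)) (e (Some i))).
split=> //; split.
- split; [exact: Ck0 (Cwd None 0%N)|by move=> i; exact: Ck0 (Cwd (Some i) 0%N)|
    by move=> i; exact: Ck0 (Cwdd (Some i) 0%N)|].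
  by move=> i; exact: Ck0 ((dP _ (Cwdd (Some i)) (Some i)).1 0%N).
- exact: hw.
- move=> i p Dp; split; [exact: hw|exact: hwd|].
  exact: (dP _ (Cwdd (Some i)) (Some i)).2.
- move=> p Dp; have := hwd None p Dp; congr wderive.
  pose S1 := \sum_(i < n) derive_within D (derive_within D phi (e (Some i))) (e (Some i)) p.
  pose S2 := \sum_(i < n) derive_within D phi (e (Some i)) p * derive_within D phi (e (Some i)) p.
  pose a := derive_within D phi (e None) p.
  pose b := derive_within D (derive_within D phi (e None)) (e None) p.
  have E : - b - n%:R / 2 * a + expR (- p.1) * S1 - a = - (a * a) + expR (- p.1) * S2.
    exact: eqphi p Dp.
  have -> : \sum_(i < n) wdd (Some i) p = (- S1 + S2) * w p.
    by rewrite /wdd -mulr_suml big_split /= sumrN /S1 /S2; congr ((_ + _) * _).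
  rewrite /wdd /wd -/a -/b.
  have -> : b = - (n%:R / 2) * a + expR (- p.1) * S1 - a - (- (a * a) + expR (- p.1) * S2).
    by rewrite -E; ring.
  by ring.
move=> x; rewrite /w /wd phi0; split=> //.
by rewrite /w phi0 -[u1 x]phi1.
Qed.

Lemma solution_unique (u0 u1 : 'rV[R]_n -> R) phi psi :
  global_smooth_solution u0 u1 phi -> global_smooth_solution u0 u1 psi ->
  forall p, D p -> psi p = phi p.
Proof.
move=> /exp_linearizes[w [wt [wx [wxx [wxxx [wE [[c1 c2 c3 c4] ht hx htt d0]]]]]]].
move=> /exp_linearizes[v [vt [vx [vxx [vxxx [vE [[b1 b2 b3 b4] kt kx ktt k0]]]]]]].
move=> p Dp.
have cD (F G : spacetime -> R) : {within D, continuous F} -> {within D, continuous G} ->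
    {within D, continuous (fun p => F p + - G p)}.
  move=> cF cG; have CF : Ck D e 0 F by [].
  have CG : Ck D e 0 G by [].
  exact: Ck0 (CkD CF (CkN CG)).
have hD (F G : spacetime -> R) a q (l m : R) : wderive D F (e a) q l -> wderive D G (e a) q m ->
    wderive D (fun p => F p + - G p) (e a) q (l + - m).
  by move=> HF HG; apply: wderiveD => //; exact: wderiveN.
have mu0 : 0 <= n%:R / 2 + 1 :> R by rewrite addr_ge0// divr_ge0.
have H := @linear_uniqueness R n (n%:R / 2 + 1) mu0 (fun p => w p + - v p)
  (fun p => wt p + - vt p) (fun i p => wx i p + - vx i p) (fun i p => wxx i p + - vxx i p)
  (fun i p => wxxx i p + - vxxx i p).
suff : w p + - v p = 0.
  move/eqP; rewrite subr_eq0 wE vE => /eqP /expR_inj /oppr_inj ->//.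
apply: H => //.
- exact: cD.
- by move=> i; exact: cD.
- by move=> i; exact: cD.
- by move=> i; exact: cD.
- by move=> q Dq; apply: hD; auto.
- by move=> i q Dq; have [? _ _] := hx i q Dq; have [? _ _] := kx i q Dq; exact: hD.
- by move=> i q Dq; have [_ ? _] := hx i q Dq; have [_ ? _] := kx i q Dq; exact: hD.
- by move=> i q Dq; have [_ _ ?] := hx i q Dq; have [_ _ ?] := kx i q Dq; exact: hD.
- move=> q Dq; have := hD _ _ _ _ _ _ (htt q Dq) (ktt q Dq); congr wderive.
  by rewrite sumrB; ring.
- by move=> x; rewrite (d0 x).1 (k0 x).1 subrr.
- by move=> x; rewrite (d0 x).2 (k0 x).2 subrr.
Qed.

(** For phi = - ln (1 - v), second derivatives satisfy phi_aa = v_aa/(1 - v) + phi_a^2; summed with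
    the signs of the metric, the squares are exactly Q(phi, phi). *)
Lemma log_solves (v vt : spacetime -> R) (vx vxx : 'I_n -> spacetime -> R) :
  (forall k, Ck D e k v) -> (forall p, D p -> 0 < 1 - v p) ->
  (forall p, D p -> wderive D v (e None) p (vt p)) ->
  (forall i p, D p -> wderive D v (e (Some i)) p (vx i p)) ->
  (forall i p, D p -> wderive D (vx i) (e (Some i)) p (vxx i p)) ->
  (forall p, D p -> wderive D vt (e None) p
     (- (n%:R / 2 + 1) * vt p + expR (- p.1) * \sum_(i < n) vxx i p)) ->
  global_smooth_solution (fun x => - ln (1 - v (0, x)))
    (fun x => vt (0, x) / (1 - v (0, x))) (fun p => - ln (1 - v p)).
Proof.
move=> Cv v1 ht hx hxx htt; set phi := fun p => - ln (1 - v p).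
have Cu k : Ck D e k (fun p => 1 + - v p) by apply: CkD; [exact: Ck_cst|exact: CkN].
have Cphi k : Ck D e k phi by apply: CkN; apply: Ck_ln => // p Dp; exact: v1.
have d1 a (l : R) p : D p -> wderive D v (e a) p l -> wderive D phi (e a) p (l / (1 - v p)).
  move=> Dp H; have := wderiveN (wderive_comp (wderiveD (wderive_cst D 1 (e a) p) (wderiveN H))
    (is_derive1_ln (v1 p Dp))).
  by congr wderive; ring.
have d2 a (f : spacetime -> R) (l : R) p : D p -> (forall q, D q -> wderive D v (e a) q (f q)) ->
    wderive D f (e a) p l ->
    derive_within D phi (e a) p = f p / (1 - v p) /\
    derive_within D (derive_within D phi (e a)) (e a) p =
      (l + f p ^+ 2 / (1 - v p)) / (1 - v p).
  move=> Dp Hv Hf; have E q : D q -> derive_within D phi (e a) q = f q / (1 - v q).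
    by move=> Dq; apply: wderive_future => //; exact: (d1 _ _ _ Dq (Hv q Dq)).
  split; first exact: E.
  apply: wderive_future => //; apply: (@wderive_future_ext (fun q => f q * (1 + - v q)^-1)) => //.
    by move=> q Dq; rewrite E.
  have un0 : 1 + - v p != 0 by rewrite gt_eqF// v1.
  have di := @is_deriveV _ id _ _ _ un0 (is_derive_id (1 + - v p) (1 : R)).
  have := wderiveM Hf (wderive_comp (wderiveD (wderive_cst D 1 (e a) p) (wderiveN (Hv p Dp))) di).
  by congr wderive; rewrite /GRing.scale /=; field.
split.
- exact/global_smooth_Ck.
- move=> p Dp; have [E1 E2] := d2 None vt _ p Dp ht (htt p Dp).
  have F1 i := (d2 (Some i) (vx i) _ p Dp (hx i) (hxx i p Dp)).1.
  have F2 i := (d2 (Some i) (vx i) _ p Dp (hx i) (hxx i p Dp)).2.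
  pose a := derive_within D phi (e None) p.
  pose b := derive_within D (derive_within D phi (e None)) (e None) p.
  pose S1 := \sum_(i < n) derive_within D (derive_within D phi (e (Some i))) (e (Some i)) p.
  pose S2 := \sum_(i < n) derive_within D phi (e (Some i)) p * derive_within D phi (e (Some i)) p.
  suff : - b - n%:R / 2 * a + expR (- p.1) * S1 - a = - (a * a) + expR (- p.1) * S2 by [].
  have un0 : 1 - v p != 0 by rewrite gt_eqF// v1.
  have ES1 : S1 = (\sum_(i < n) vxx i p) / (1 - v p) + S2.
    rewrite mulr_suml -big_split /=; apply: eq_bigr => i _.
    transitivity ((vxx i p + vx i p ^+ 2 / (1 - v p)) / (1 - v p)); first exact: F2.
    transitivity (vxx i p / (1 - v p) + vx i p / (1 - v p) * (vx i p / (1 - v p))).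
      by field.
    by congr (_ + _ * _); symmetry; exact: F1.
  have Ea : a = vt p / (1 - v p) := E1.
  have Eb : b = (- (n%:R / 2 + 1) * vt p + expR (- p.1) * (\sum_(i < n) vxx i p) +
    vt p ^+ 2 / (1 - v p)) / (1 - v p) := E2.
  rewrite ES1 Ea Eb {ES1 Ea Eb}; move: S2 (\sum_(i < n) vxx i p) => s2 s; field.
  by rewrite un0.
- by move=> x.
- move=> x; have D0 : D (0, x) by rewrite /future /=.
  by apply: wderive_future => //; apply: d1 => //; exact: ht.
Qed.

End nirenberg_transform.

Unset Implicit Arguments.

Theorem theorem1p1 (R : realType) (n : nat) (n_ge1 : (1 <= n)%N)
    (f g : 'rV[R]_n -> R) (Cf : test_function f) (Cg : test_function g) :
  exists eps0 : R, 0 < eps0 /\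
    forall eps : R, 0 <= eps <= eps0 ->
      exists phi : R^o * 'rV[R]_n -> R,
        global_smooth_solution (fun x => eps * f x) (fun x => eps * g x) phi /\
        forall psi : R^o * 'rV[R]_n -> R,
          global_smooth_solution (fun x => eps * f x) (fun x => eps * g x) psi ->
          forall p, future p -> psi p = phi p.
Proof.
have [L [L0 data]] := transformed_data Cf Cg.
(* The number of derivatives on which the sup bound of [linear_existence] depends. *)
have [C C0 HC] := data (1 + n).*2.
pose K := approx_bound (R := R) (n := n) L 0 * C.
have K0 : 0 <= K by rewrite mulr_ge0// approx_bound_ge0.
have K1 : 0 < 2 * (K + 1) by rewrite mulr_gt0// ltr_wpDl.
(* Then K eps <= 1/2, which keeps 1 - w positive. The 1 in the minimum is the range where the data
   bounds hold, and K + 1 guards against K = 0. *)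
exists (Num.min 1 (2 * (K + 1))^-1); split; first by rewrite lt_min ltr01 invr_gt0.
move=> eps /andP[e0]; rewrite le_min => /andP[e1 eK].
have e01 : 0 <= eps <= 1 by rewrite e0.
suff [phi Hphi] : exists phi : R^o * 'rV[R]_n -> R,
    global_smooth_solution (fun x => eps * f x) (fun x => eps * g x) phi.
  by exists phi; split=> // psi Hpsi p; exact: (solution_unique Hphi Hpsi).
have [VF VG BF BG] := HC eps e01.
have mu1 : 1 <= 2 * (n%:R / 2 + 1) :> R.
  by rewrite mulrDr mulrCA mulfV// !mulr1; have := ler0n R n; lra.
have [|w [Cw hx ht htt [w0 w1 wle]]] := linear_existence mu1 L0 VF VG.
  move=> k; have [B B0 HB] := data k; have [_ _ ? ?] := HB eps e01.
  by exists (B * eps) => //; exact: mulr_ge0.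
have w12 p : future p -> 0 < 1 - w false [::] p.
  move=> Dp; have := wle (C * eps) (mulr_ge0 C0 e0) BF BG p Dp.
  rewrite mulrA -/K => wK.
  have : eps * (2 * (K + 1)) <= 1 by rewrite -ler_pdivlMr// div1r.
  have Ke : 0 <= K * eps by rewrite mulr_ge0.
  by have := ler_norm (w false [::] p); lra.
exists (fun p => - ln (1 - w false [::] p)).
have := @log_solves R n (w false [::]) (w true [::]) (fun i => w false [:: i])
  (fun i => w false [:: i; i]) (Cw false [::]) w12 (ht [::]) (hx false [::])
  (fun i => hx false [:: i] i) (htt [::]).
congr global_smooth_solution; apply/funext => x.
  by rewrite w0 subKr expRK opprK.
by rewrite w0 w1 subKr mulfK// gt_eqF// expR_gt0.
Qed.
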